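(* Let $k$ be an algebraically closed field of characteristic $5$, let $\Gamma\subset\mathbb{P}^2$ be a $k$-Hermitian curve, and let $\mathcal{D}$ be the set of connected components of the graph $G$ on the set $\mathcal{Q}$ of non-singular conics totally tangent to $\Gamma$. For distinct $D,D'\in\mathcal{D}$, we have $T(D,D')=T(D',D)$. For a fixed $D\in\mathcal{D}$, the number of $D'\in\mathcal{D}$ (with $D'\neq D$) such that $T(D,D')=\tau$ is $$\begin{cases}30 & \text{if }\tau=\beta^{21},\\ 42 & \text{if }\tau=\gamma^{21},\\ 7 & \text{if }\tau=\alpha^{15}\gamma^{6},\\ 70 & \text{if }\tau=\alpha^{3}\gamma^{18}.\end{cases}$$
   Context: Work over an algebraically closed field $k$ of characteristic $5$. A $k$-Hermitian curve is a projective plane curve $\Gamma\subset\mathbb{P}^2$ of degree $6$ that is projectively isomorphic (via $\mathrm{PGL}_3(k)$) to the Fermat curve $\Gamma_5: x^6+y^6+z^6=0$. $\mathcal{P}$ denotes the set of Weierstrass points of $\Gamma$; equivalently, the set of points $P\in\Gamma$ whose tangent line meets $\Gamma$ at $P$ with intersection multiplicity $6$ (for $\Gamma=\Gamma_5$, the $\mathbb{F}_{25}$-rational points). One has $|\mathcal{P}|=126$. A line of $\mathbb{P}^2$ is a special secant line of $\Gamma$ if it passes through two distinct points of $\mathcal{P}$. A non-singular conic $Q\subset\mathbb{P}^2$ is totally tangent to $\Gamma$ if $Q$ meets $\Gamma$ at six distinct points, each with intersection multiplicity $2$. $\mathcal{Q}$ denotes the set of all such conics; one has $|\mathcal{Q}|=3150$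 and $Q\cap\Gamma\subset\mathcal{P}$ for $Q\in\mathcal{Q}$. For $Q\in\mathcal{Q}$, $\mathcal{S}(Q)$ is the set of the $15$ special secant lines of $\Gamma$ passing through two distinct points of $Q\cap\Gamma$. $G$ is the graph with vertex set $\mathcal{Q}$ in which distinct $Q,Q'$ are adjacent if and only if $|Q\cap Q'|=4$ and $|\mathcal{S}(Q)\cap\mathcal{S}(Q')|=3$. $\mathcal{D}$ is the set of connected components of $G$ (there are $150$ of them); each $D\in\mathcal{D}$ is regarded as a subset of $\mathcal{Q}$, consisting of $21$ conics. For $Q\in\mathcal{Q}$ and $D'\in\mathcal{D}$ with $Q\notin D'$, the type $t(Q,D')\in\{\alpha,\beta,\gamma\}$ is defined by the values of $|Q\cap Q'\cap\Gamma|$ as $Q'$ runs over the $21$ conics of $D'$: $t(Q,D')=\alpha$ if the value is $2$ for $3$ conics and $0$ for $18$; $t(Q,D')=\beta$ if it is $2$ for $1$ conic, $1$ for $4$ conics and $0$ for $16$; $t(Q,D')=\gamma$ if it is $1$ for $6$ conics and $0$ for $15$. (One of these three cases always occurs.) For distinct $D,D'\in\mathcal{D}$, the type $T(D,D')$ is: $\beta^{21}$ if $t(Q,D')=\beta$ for all $Q\in D$; $\gamma^{21}$ if $t(Q,D')=\gamma$ for all $Q\in D$; $\alpha^{15}\gamma^{6}$ if $t(Q,D')=\alpha$ for $15$ conics $Q\in D$ and $\gamma$ for the other $6$; $\alpha^{3}\gamma^{18}$ if $t(Q,D')=\alpha$ for $3$ conics $Q\in D$ and $\gamma$ for the other $18$.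 (One of these four cases always occurs.) *)

(* Defs.v *)
From HB Require Import structures.
From mathcomp Require Import all_boot all_order all_algebra.
From mathcomp Require Import boolp classical_sets functions cardinality.
From mathcomp Require Import mpoly.
From Stdlib Require Import Relation_Operators.

Set Implicit Arguments.
Unset Strict Implicit.
Unset Printing Implicit Defensive.

Import GRing.Theory.
Local Open Scope ring_scope.
Local Open Scope classical_set_scope.
Local Open Scope card_scope.

Local Notation "x %:F" := (tofrac x).

Section PlaneGeometry.
Variable k : fieldType.

Definition proj_space (V : vectType k) : Type :=
  {U : {vspace V} | \dim U == 1%N}.

Definition point : Type := proj_space 'rV[k]_3.

(* A plane curve of degree d is a nonzero form of degree d up to scalars. *)
Definition plane_curve (d : nat) : Type := proj_space (dhomog 3 k d).

(* Homogeneous coordinates of a point, and a defining form of a curve; both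
   are nonzero, and each notion below is independent of their scaling. *)
Definition coords (P : point) : 'I_3 -> k := fun i => vpick (val P) 0 i.

Definition form d (C : plane_curve d) : {mpoly k[3]} := vpick (val C).

Definition on_curve d (C : plane_curve d) : set point :=
  [set P | (form C).@[coords P] = 0].

Definition nonsingular d (C : plane_curve d) : Prop :=
  forall P, on_curve C P -> exists i : 'I_3, ((form C)^`M(i)).@[coords P] != 0.

Definition tangent_form d (C : plane_curve d) (P : point) : {mpoly k[3]} :=
  \sum_(i < 3) ((form C)^`M(i)).@[coords P] *: 'X_i.

(* At a singular point of C the tangent form vanishes, hence there is no
   tangent line. *)
Definition is_tangent_line (L : plane_curve 1) d (C : plane_curve d)
    (P : point) : Prop :=
  on_curve C P /\ exists2 c : k, c != 0 & form L = c *: tangent_form C P.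

(* The local ring O_P of the plane at P, inside the field of fractions of the
   homogeneous coordinate ring. *)
Definition local_ring (P : point) : set {fraction {mpoly k[3]}} :=
  [set r | exists (e : nat) (a b : {mpoly k[3]}),
     [/\ a \is e.-homog, b \is e.-homog, b.@[coords P] != 0
       & r = a%:F / b%:F]].

(* The ideal of O_P generated by local equations of C and C'. *)
Definition local_ideal d d' (C : plane_curve d) (C' : plane_curve d')
    (P : point) : set {fraction {mpoly k[3]}} :=
  [set r | exists (e : nat) (u v b : {mpoly k[3]}),
     [/\ u * form C + v * form C' \is e.-homog, b \is e.-homog,
         b.@[coords P] != 0
       & r = (u * form C + v * form C')%:F / b%:F]].

(* dim_k O_P / (C, C')_P = n, witnessed by a basis of the quotient. *)
Definition intersection_multiplicity d d' (C : plane_curve d)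
    (C' : plane_curve d') (P : point) (n : nat) : Prop :=
  exists r_ : 'I_n -> {fraction {mpoly k[3]}},
    (forall i, local_ring P (r_ i)) /\
    (forall r, local_ring P r ->
       exists! c : 'rV[k]_n,
         local_ideal C C' P (r - \sum_(i < n) ((c 0 i)%:MP)%:F * r_ i)).

Definition fermat (d : nat) : {mpoly k[3]} := \sum_(i < 3) 'X_i ^+ d.

Definition linear_subst (A : 'M[k]_3) (f : {mpoly k[3]}) : {mpoly k[3]} :=
  f \mPo [tuple \sum_(j < 3) A i j *: 'X_j | i < 3].

(* Meant for k of characteristic 5. *)
Definition hermitian_curve (Gamma : plane_curve 6) : Prop :=
  exists2 A : 'M[k]_3, A \in unitmx
  & exists2 c : k, c != 0 & form Gamma = c *: linear_subst A (fermat 6).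

End PlaneGeometry.

Variant conic_type : Type := alpha | beta | gamma.

Variant component_type : Type := beta21 | gamma21 | alpha15gamma6 | alpha3gamma18.

Section Conics.
Variables (k : fieldType) (Gamma : plane_curve k 6).

Definition weierstrass_point : set (point k) :=
  [set P | exists2 L, is_tangent_line L Gamma P
         & intersection_multiplicity L Gamma P 6].

Definition special_secant : set (plane_curve k 1) :=
  [set L | exists P P', [/\ P <> P', weierstrass_point P,
             weierstrass_point P', on_curve L P & on_curve L P']].

Definition totally_tangent_conic : set (plane_curve k 2) :=
  [set Q | [/\ nonsingular Q,
     on_curve Q `&` on_curve Gamma #= `I_6
   & forall P, on_curve Q P -> on_curve Gamma P ->
       intersection_multiplicity Q Gamma P 2]].

Definition secants_of (Q : plane_curve k 2) : set (plane_curve k 1) :=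
  [set L | special_secant L /\
     exists P P', [/\ P <> P', (on_curve Q `&` on_curve Gamma) P,
       (on_curve Q `&` on_curve Gamma) P', on_curve L P & on_curve L P']].

Definition adjacent (Q Q' : plane_curve k 2) : Prop :=
  [/\ totally_tangent_conic Q, totally_tangent_conic Q', Q <> Q',
      on_curve Q `&` on_curve Q' #= `I_4
    & secants_of Q `&` secants_of Q' #= `I_3].

Definition components : set (set (plane_curve k 2)) :=
  [set D | exists2 Q, totally_tangent_conic Q
         & D = [set Q' | clos_refl_trans _ adjacent Q Q']].

(* The n-th entry is the number of conics Q' of D' such that Q, Q' and Gamma
   have exactly n common points. *)
Definition conic_type_profile (t : conic_type) : seq nat :=
  match t with
  | alpha => [:: 18; 0; 3]
  | beta => [:: 16; 4; 1]
  | gamma => [:: 15; 6]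
  end%N.

Definition has_conic_type (Q : plane_curve k 2) (D' : set (plane_curve k 2))
    (t : conic_type) : Prop :=
  forall n : nat,
    [set Q' | D' Q' /\ on_curve Q `&` on_curve Q' `&` on_curve Gamma #= `I_n]
      #= `I_(nth 0%N (conic_type_profile t) n).

(* Together with the counts, the first conjunct says that the conics of D not
   of type t are of type t'. *)
Definition splits (D D' : set (plane_curve k 2)) (t : conic_type) (m : nat)
    (t' : conic_type) (m' : nat) : Prop :=
  [/\ forall Q, D Q -> has_conic_type Q D' t \/ has_conic_type Q D' t',
      [set Q | D Q /\ has_conic_type Q D' t] #= `I_m
    & [set Q | D Q /\ has_conic_type Q D' t'] #= `I_m'].

Definition has_component_type (D D' : set (plane_curve k 2))
    (T : component_type) : Prop :=
  match T with
  | beta21 => forall Q, D Q -> has_conic_type Q D' beta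
  | gamma21 => forall Q, D Q -> has_conic_type Q D' gamma
  | alpha15gamma6 => splits D D' alpha 15 gamma 6
  | alpha3gamma18 => splits D D' alpha 3 gamma 18
  end.

End Conics.

Definition component_type_count (T : component_type) : nat :=
  match T with
  | beta21 => 30
  | gamma21 => 42
  | alpha15gamma6 => 7
  | alpha3gamma18 => 70
  end%N.

(* Main.v *)
(* A conic xz = y^2 with respect to a frame E is the image of s |-> (s^2, s, 1) E,
   and intersection numbers with it are vanishing orders of the pulled-back form.
   Write Gamma as the zero set of the Hermitian form v H F(v)^T, F the Frobenius
   map.  On a totally tangent conic the pulled-back form is a constant times the
   square of a polynomial; comparing coefficients, one can choose the frame E
   unitary, that is with E H F(E)^T = J for a fixed antidiagonal J.  The frames
   then form a single orbit of the finite group of J-unitary matrices over F_25,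
   and the totally tangent conics are enumerated by an explicit list of 150 * 21 conics.  Adjacency to
   the first conic is decided by enumeration; group elements transport it to all
   others, which yields the components.  Since any conic can be taken as the first
   one, it remains to read off the types of one component against the 149 others. *)
From HB Require Import structures.
From mathcomp Require Import all_boot all_order all_algebra.
From mathcomp Require Import boolp classical_sets functions cardinality.
From mathcomp Require Import mpoly ring zify.
From Stdlib Require Import Relation_Operators.
Require Import Defs.

Set Implicit Arguments.
Unset Strict Implicit.
Unset Printing Implicit Defensive.

Import GRing.Theory.
Local Open Scope ring_scope.
Local Open Scope classical_set_scope.
Local Open Scope card_scope.

(** Two facts make the problem finite. Restricted to a conic, the Hermitian form only has exponents
    i + 5 j with 0 <= i, j <= 2; for a totally tangent conic the gaps at 3, 4, 8, 9 force it into
    the shape (s^5 - s)^2 after a change of parameter, so the six contact points are P^1(F_5). And a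
    matrix X with X J F(X)^T = J is fixed by the square of F, hence has entries in F_25. An
    intersection multiplicity is given as a relation, by a basis of a local ring modulo an ideal.
    Vanishing orders can replace it once it is known that the order is a multiplicity and that the
    multiplicity is unique. The list of conics is certified complete without computing the order of
    the unitary group: the matrix of a conic with a unitary frame satisfies Hermitian equations in
    its six coefficients, and all normalized solutions over F_25 are looked up in the list. The four
    common points of adjacent conics may lie outside F_25, so they are certified through
    discriminants of quadratic factors and never listed. *)

Lemma rmorph_mmap n (R : comNzRingType) (S S' : comNzRingType)
    (psi : {rmorphism S -> S'}) (f : {rmorphism R -> S}) (f' : {rmorphism R -> S'})
    (h : 'I_n -> S) (p : {mpoly R[n]}) :
  (forall c, psi (f c) = f' c) ->
  psi (mmap f h p) = mmap f' (fun i => psi (h i)) p.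
Proof.
move=> ff'; rewrite /mmap rmorph_sum; apply: eq_bigr => m _.
rewrite rmorphM ff' /mmap1 rmorph_prod; congr (_ * _).
by apply: eq_bigr => i _; rewrite rmorphXn.
Qed.

Lemma mmap_dhomog n (R : comNzRingType) (S : comNzRingType) (f : {rmorphism R -> S})
    (h : 'I_n -> S) (c : S) d (p : {mpoly R[n]}) :
  p \is d.-homog -> mmap f (fun i => c * h i) p = c ^+ d * mmap f h p.
Proof.
move=> /dhomogP hp; rewrite /mmap mulr_sumr !big_seq; apply: eq_bigr => m /hp mdm.
rewrite mulrCA; congr (_ * _); have <- : mdeg m = d := mdm; rewrite /mmap1 mdegE -prodrXr -big_split /=.
by apply: eq_bigr => i _; rewrite exprMn.
Qed.

Lemma mmap_ext n (R S : comNzRingType) (f : {rmorphism R -> S})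
    (h h' : 'I_n -> S) (p : {mpoly R[n]}) : h =1 h' -> mmap f h p = mmap f h' p.
Proof. by move=> e; apply: eq_bigr => m _; congr (_ * _); apply: mmap1_eq. Qed.

Lemma meval_dhomog n (R : comNzRingType) (v : 'I_n -> R) c d (p : {mpoly R[n]}) :
  p \is d.-homog -> p.@[fun i => c * v i] = c ^+ d * p.@[v].
Proof. exact: mmap_dhomog. Qed.

(** Congruence modulo [J] is stable under sums and products, hence under substitution in a
    polynomial. It serves to restrict a form to a curve while staying inside the polynomial ring. *)
Lemma mmap_congr n (R S : comNzRingType) (f : {rmorphism R -> S}) (J : S)
    (h h' : 'I_n -> S) (p : {mpoly R[n]}) :
  (forall i, exists q, h i - h' i = q * J) ->
  exists q, mmap f h p - mmap f h' p = q * J.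
Proof.
move=> hh.
pose cg x y := exists q, x - y = q * J.
have cgM x y x' y' : cg x y -> cg x' y' -> cg (x * x') (y * y').
  move=> [q e] [q' e']; exists (q * x' + y * q').
  rewrite mulrDl -mulrA [x' * _]mulrC mulrA -e -mulrA -e'; ring.
have cg0 x : cg x x by exists 0; rewrite mul0r subrr.
have cgD x y x' y' : cg x y -> cg x' y' -> cg (x + x') (y + y').
  move=> [q e] [q' e']; exists (q + q'); rewrite mulrDl -e -e'; ring.
apply: (big_ind2 cg); [exact: (cg0 _) | exact: (@cgD) |].
move=> m _; apply: (cgM _); first exact: (cg0 _).
apply: (big_ind2 cg); [exact: (cg0 _) | exact: (@cgM) |] => i _.
elim: (m i) => [|r IH]; first exact: (cg0 _).
by rewrite !exprS; apply: (cgM _).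
Qed.

(** * Intersection multiplicities along a parametrized curve *)

Section LocalParameter.
Variables (k : fieldType).
Local Notation mp := {mpoly k[3]}.
Local Notation "x %:F" := (tofrac x).

Definition along (phi : 'I_3 -> {poly k}) (g : mp) : {poly k} := mmap (@polyC k) phi g.

Lemma along_is_zmod phi : zmod_morphism (along phi).
Proof. by move=> p q; rewrite /along mmapB. Qed.
Lemma along_is_monoid phi : monoid_morphism (along phi).
Proof. by split=> [|p q]; rewrite /along ?rmorph1 ?rmorphM. Qed.
HB.instance Definition _ phi := GRing.isZmodMorphism.Build mp {poly k} (along phi) (along_is_zmod phi).
HB.instance Definition _ phi := GRing.isMonoidMorphism.Build mp {poly k} (along phi) (along_is_monoid phi).

Lemma alongZ phi c g : along phi (c *: g) = c *: along phi g.
Proof. by rewrite /along mmapZ mul_polyC. Qed.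
Lemma horner_along phi g t : (along phi g).[t] = g.@[fun i => (phi i).[t]].
Proof.
rewrite /along /meval (_ : _.[t] = horner_eval t (mmap (@polyC k) phi g)) //.
by rewrite (rmorph_mmap (f' := idfun)) // => c; rewrite /= /horner_eval hornerC.
Qed.

Variables (a b : mp).
Hypothesis a1 : a \is 1.-homog.
Hypothesis b1 : b \is 1.-homog.

(** The polynomial p(a / b) multiplied by b^N. Coefficients beyond degree [N] are dropped, which is
    why bounds [size p <= N.+1] accompany it. *)
Definition homogenize (N : nat) (p : {poly k}) : mp := \sum_(j < N.+1) p`_j *: (a ^+ j * b ^+ (N - j)).

Lemma homogenize_dhomog N p : homogenize N p \is N.-homog.
Proof.
apply: rpred_sum => j _; apply: dhomogZ.
have := dhomogM (dhomogMn j a1) (dhomogMn (N - j) b1).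
by rewrite !mul1n subnKC // -ltnS.
Qed.

Hypothesis b_neq0 : b != 0.

Definition tofracC : k -> {fraction mp} := (@tofrac mp) \o (@mpolyC 3 k).
HB.instance Definition _ := GRing.RMorphism.on tofracC.

(** Evaluation at a / b. It is a ring morphism, so identities between homogenizations are checked in
    the fraction field. *)
Definition at_ratio : {poly k} -> {fraction mp} := horner_eval (a%:F / b%:F) \o map_poly tofracC.
HB.instance Definition _ := GRing.RMorphism.on at_ratio.

Lemma bF_neq0 : b%:F != 0. Proof. by rewrite tofrac_eq0. Qed.

Lemma tofrac_homogenize N (p : {poly k}) : (size p <= N.+1)%N ->
  (homogenize N p)%:F = b%:F ^+ N * at_ratio p.
Proof.
move=> sp; rewrite /at_ratio /= /horner_eval (@horner_coef_wide _ N.+1); last first.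
  exact: leq_trans (size_poly _ _) sp.
rewrite mulr_sumr rmorph_sum; apply: eq_bigr => j _.
rewrite coef_map /= -mul_mpolyC !rmorphM !rmorphXn /= expr_div_n.
have -> : b%:F ^+ N = b%:F ^+ j * b%:F ^+ (N - j) by rewrite -exprD subnKC // -ltnS.
have frac (L : fieldType) (x y z w : L) : x != 0 -> z * (y * w) = x * w * (z * (y / x)).
  by move=> x0; field.
exact: frac (expf_neq0 _ bF_neq0).
Qed.

Lemma along_homogenize phi N (p : {poly k}) : along phi a = 'X -> along phi b = 1 ->
  (size p <= N.+1)%N -> along phi (homogenize N p) = p.
Proof.
move=> ea eb sp; rewrite rmorph_sum.
transitivity (\poly_(i < N.+1) p`_i).
  rewrite poly_def; apply: eq_bigr => j _.
  by rewrite /= alongZ rmorphM !rmorphXn /= ea eb expr1n mulr1.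
apply/polyP => i; rewrite coef_poly; case: ltnP => // le_i.
by rewrite nth_default // (leq_trans sp).
Qed.

Variables (phi : 'I_3 -> {poly k}) (f : mp) (m : nat).
Hypothesis along_a : along phi a = 'X.
Hypothesis along_b : along phi b = 1.
Hypothesis along_f : along phi f = 0.
Hypothesis size_phi : forall i, (size (phi i) <= m.+2)%N.
Hypothesis congr_phi :
  forall i, exists q, b ^+ m * 'X_i - homogenize m.+1 (phi i) = q * f.

(** Modulo [f], each b^m X_i is the homogenized i-th coordinate of [phi]. Substituting this in [g]
    shows that, up to a power of [b], a form is determined modulo [f] by its restriction to the
    parametrized curve. *)
Lemma lift_along e g : g \is e.-homog -> exists N q,
  (size (along phi g) <= (N + e)%N.+1)%N /\
  b ^+ N * g - homogenize (N + e)%N (along phi g) = q * f.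
Proof.
move=> hg; set G := along phi g.
have [q eq_q] := mmap_congr (@mpolyC 3 k) g congr_phi.
(* The exponent m e clears denominators; the additional [size G] makes the required bound on the
   size of [G] automatic. *)
exists (m * e + size G)%N, (b ^+ size G * q); split.
  by apply: leqW; rewrite addnAC leq_addl.
have gE : mmap (@mpolyC 3 k) (fun i => b ^+ m * 'X_i) g = b ^+ (m * e) * g.
  rewrite (mmap_dhomog _ _ _ hg) exprM; congr (_ * _).
  rewrite -[RHS]comp_mpoly_id; apply: mmap_ext => i.
  by rewrite tnth_map tnth_ord_tuple.
rewrite {}gE in eq_q.
rewrite -mulrA -eq_q mulrBr mulrA -exprD [(size G + _)%N]addnC; congr (_ - _).
apply/eqP; rewrite -tofrac_eq tofrac_homogenize; last first.
  by apply: leqW; rewrite addnAC leq_addl.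
rewrite rmorphM rmorphXn /=.
rewrite [X in _ == _ * X](rmorph_mmap (f' := tofracC)) //.
rewrite [X in _ == _ * X](mmap_ext _ _ (h' := fun i => b%:F ^+ m.+1 * at_ratio (phi i))); last first.
  by move=> i /=; rewrite tofrac_homogenize.
rewrite (mmap_dhomog _ _ _ hg) mulrA -exprM -exprD.
rewrite /G /along (rmorph_mmap (f' := tofracC)); last first.
  by move=> c; rewrite /= /at_ratio /= map_polyC /horner_eval hornerC.
by apply/eqP; congr (_ ^+ _ * _); rewrite mulSn; lia.
Qed.

End LocalParameter.

(* The last two conditions say that a / b is an inverse of the parametrization on
   the curve f = 0, so that its local ring at P is that of the line at 0. *)
Definition parametrizes (k : fieldType) (f : {mpoly k[3]}) (P : point k)
    (phi : 'I_3 -> {poly k}) : Prop :=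
  [/\ exists2 c : k, c != 0 & forall i, coords P i = c * (phi i).[0],
      along phi f = 0
    & exists a b m, [/\ a \is 1.-homog, b \is 1.-homog,
        along phi a = 'X /\ along phi b = 1,
        forall i, (size (phi i) <= m.+2)%N
      & forall i, exists q, b ^+ m * 'X_i - homogenize a b m.+1 (phi i) = q * f]].

Section Multiplicity.
Variables (k : fieldType) (d d' : nat) (C : plane_curve k d) (C' : plane_curve k d').
Variables (P : point k) (phi : 'I_3 -> {poly k}).
Local Notation mp := {mpoly k[3]}.
Local Notation "x %:F" := (tofrac x).
Hypothesis C'_homog : form C' \is d'.-homog.
Hypothesis phiP : parametrizes (form C) P phi.
Variables (n : nat) (u : {poly k}).
Hypothesis along_C' : along phi (form C') = 'X^n * u.
Hypothesis u_neq0 : u.[0] != 0.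

Lemma meval_coords e g : g \is e.-homog ->
  (g.@[coords P] != 0) = ((along phi g).[0] != 0).
Proof.
case: phiP => -[c c0 eqc] _ _ hg; rewrite horner_along.
rewrite (meval_eq (v2 := fun i => c * (phi i).[0])) //.
by rewrite (meval_dhomog _ _ hg) mulf_eq0 expf_eq0 (negbTE c0) andbF.
Qed.

Lemma coprimep_Xn (v : {poly k}) : v.[0] != 0 -> coprimep v 'X^n.
Proof. by move=> v0; apply: coprimep_expr; rewrite -['X]subr0 -polyC0 coprimep_XsubC. Qed.

(** From left to right, restriction kills C and makes C' divisible by X^n, and a denominator nonzero
    at [P] restricts to a polynomial prime to X^n. Conversely, if [along phi g] is X^n w, the
    relation u (X^n w) = (X^n u) w lifts to the plane modulo C, and the multiplier of [g] does not
    vanish at [P] because u(0) is nonzero. *)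
Lemma local_idealP e g h : g \is e.-homog -> h \is e.-homog ->
  h.@[coords P] != 0 ->
  local_ideal C C' P (g%:F / h%:F) <-> 'X^n %| along phi g.
Proof.
move=> hg hh h0; have nz x e' : x \is e'.-homog -> x.@[coords P] != 0 -> x%:F != 0.
  by move=> _; apply: contra => /eqP/eqP; rewrite tofrac_eq0 => /eqP ->; rewrite meval0.
split.
  case=> e' [v [w [b [hvw hb b0 eqfr]]]].
  have eqm : g * b = h * (v * form C + w * form C').
    move/eqP: eqfr; rewrite (eqr_div _ _ (nz h e hh h0) (nz b e' hb b0)).
    by rewrite -!tofracM tofrac_eq [eqbRHS]mulrC => /eqP.
  have := congr1 (along phi) eqm; rewrite !(rmorphM, rmorphD) /=.
  case: phiP => _ -> _; rewrite mulr0 add0r along_C' => eqx.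
  have dv : 'X^n %| along phi g * along phi b.
    by rewrite eqx; do 2!apply: dvdp_mull; apply: dvdp_mulr.
  by rewrite Gauss_dvdpl // coprimep_sym coprimep_Xn // -(meval_coords hb) in dv.
case: phiP => -[c c0 eqc] fphi [a [b [m [ha hb [phia phib] szphi cphi]]]].
case/dvdpP => w eqw.
have bne0 : b != 0.
  by apply/eqP => be; move/eqP: phib; rewrite be rmorph0 eq_sym oner_eq0.
have [N [q [sz eqq]]] := lift_along ha hb bne0 szphi cphi hg.
have [N' [q' [sz' eqq']]] := lift_along ha hb bne0 szphi cphi C'_homog.
set M := (N + e)%N in sz eqq; set M' := (N' + d')%N in sz' eqq'.
have u_neq : u != 0 by apply: contra u_neq0 => /eqP ->; rewrite horner0.
have su : (size u <= M'.+1)%N.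
  by apply: leq_trans sz'; rewrite along_C' mulrC size_mulXn ?leq_addl.
have le_Xn (v : {poly k}) : (size v <= size ('X^n * v)%R)%N.
  by have [->|v0] := eqVneq v 0; rewrite ?mulr0 // mulrC size_mulXn ?leq_addl.
have sw : (size w <= M.+1)%N.
  by apply: leq_trans sz; rewrite eqw mulrC le_Xn.
set hu := homogenize a b M' u; set hw := homogenize a b M w.
(* Homogenization is multiplicative once the degrees match; both sides are the homogenization of u
   X^n w. *)
have key : hu * homogenize a b M (along phi g) = homogenize a b M' (along phi (form C')) * hw.
  apply/eqP; rewrite -tofrac_eq !rmorphM /= !(tofrac_homogenize _ bne0) // along_C' eqw.
  rewrite [w * _]mulrC !rmorphM /=; apply/eqP.
  have ac (L : fieldType) (x x' y s t : L) : x * s * (x' * (y * t)) = x * (y * s) * (x' * t).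
    by ring.
  exact: ac.
(* Replacing the homogenized restrictions by the forms themselves costs only multiples of
   [form C]. *)
have eqD : (hu * b ^+ N) * g = (hu * q - q' * hw) * form C + (b ^+ N' * hw) * form C'.
  have -> : hu * b ^+ N * g = hu * (homogenize a b M (along phi g) + q * form C).
    by rewrite -eqq; ring.
  rewrite mulrDr key.
  have -> : homogenize a b M' (along phi (form C')) = b ^+ N' * form C' - q' * form C.
    by rewrite -eqq'; ring.
  by ring.
have hD : hu * b ^+ N \is (M' + 1 * N).-homog.
  by apply: dhomogM; [exact: (homogenize_dhomog ha hb) | exact: dhomogMn].
have hD0 : (hu * b ^+ N).@[coords P] != 0.
  rewrite (meval_coords hD) rmorphM rmorphXn /= phib expr1n mulr1.
  by rewrite (along_homogenize phia phib su).
have hDh0 : (hu * b ^+ N * h).@[coords P] != 0 by rewrite mevalM mulf_neq0.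
exists (M' + 1 * N + e)%N, (hu * q - q' * hw), (b ^+ N' * hw), (hu * b ^+ N * h).
rewrite -eqD; split; [exact: dhomogM | exact: dhomogM | |].
  exact: hDh0.
apply/eqP; rewrite (eqr_div _ _ (nz _ _ hh h0) (nz _ _ (dhomogM hD hh) hDh0)).
by rewrite -!tofracM tofrac_eq; apply/eqP; ring.
Qed.

(** The powers of the local parameter a / b below n form a basis. Coordinates of g / h are the
    coefficients of a polynomial c of degree below n with G = H c modulo X^n, where G and H are the
    restrictions; since H(0) is nonzero there is exactly one. *)
Lemma intersection_multiplicity_order : intersection_multiplicity C C' P n.
Proof.
have [-[c0 c0_neq eqc] fphi [a [b [m [ha hb [phia phib] szphi cphi]]]]] := phiP.
have b0 : b.@[coords P] != 0.
  by rewrite (meval_coords hb) phib hornerC oner_neq0.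
have bne0 : b != 0 by apply: contra b0 => /eqP ->; rewrite meval0.
have bF := bF_neq0 bne0.
exists (fun i : 'I_n => (a ^+ i)%:F / (b ^+ i)%:F); split.
  move=> i; exists (1 * i)%N, (a ^+ i), (b ^+ i).
  by split=> //; [exact: dhomogMn | exact: dhomogMn | rewrite rmorphXn expf_neq0].
move=> _ [e [g [h [hg hh h0 ->]]]].
have hF : h%:F != 0.
  by rewrite tofrac_eq0; apply: contra h0 => /eqP ->; rewrite meval0.
have along_h0 : (along phi h).[0] != 0 by rewrite -(meval_coords hh).
have local_iff (c : 'rV[k]_n) :
  local_ideal C C' P (g%:F / h%:F - \sum_(i < n) ((c 0 i)%:MP)%:F * ((a ^+ i)%:F / (b ^+ i)%:F))
  <-> 'X^n %| along phi g - along phi h * rVpoly c.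
  have -> : \sum_(i < n) ((c 0 i)%:MP)%:F * ((a ^+ i)%:F / (b ^+ i)%:F)
     = at_ratio a b (rVpoly c).
    rewrite /at_ratio /= /horner_eval (@horner_coef_wide _ n); last first.
      exact: leq_trans (size_poly _ _) (size_poly _ _).
    apply: eq_bigr => i _; rewrite coef_map /= coef_rVpoly_ord !rmorphXn /=.
    by rewrite expr_div_n.
  have sc : (size (rVpoly c) <= n.+1)%N by rewrite leqW // size_poly.
  have hbn0 : (h * b ^+ n).@[coords P] != 0.
    by rewrite mevalM rmorphXn mulf_neq0 // expf_neq0.
  have hhb : h * b ^+ n \is (e + 1 * n).-homog by apply: dhomogM => //; apply: dhomogMn.
  have hgb : g * b ^+ n - h * homogenize a b n (rVpoly c) \is (e + 1 * n).-homog.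
    apply: rpredB; apply: dhomogM => //; first exact: dhomogMn.
    by rewrite mul1n; apply: homogenize_dhomog.
  have -> : g%:F / h%:F - at_ratio a b (rVpoly c) =
     (g * b ^+ n - h * homogenize a b n (rVpoly c))%:F / (h * b ^+ n)%:F.
    rewrite tofracB !tofracM (tofrac_homogenize _ bne0 sc) tofracXn.
    have fr (L : fieldType) (x y z t : L) : y != 0 -> z != 0 ->
        x / y - t = (x * z - y * (z * t)) / (y * z).
      by move=> y0 z0; field; rewrite y0 z0.
    exact: fr hF (expf_neq0 _ bF).
  rewrite (local_idealP hgb hhb hbn0) rmorphB !rmorphM rmorphXn /= phib expr1n mulr1.
  by rewrite (along_homogenize phia phib sc).
have /Bezout_eq1_coprimepP [[v w] /= eq1] := coprimep_Xn along_h0.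
(* By the Bezout relation [v] inverts the restriction of [h] modulo X^n. *)
set r := (v * along phi g) %% 'X^n.
have sr : (size r <= n)%N.
  by rewrite -ltnS -[n.+1](size_polyXn k) ltn_modp expf_neq0 ?polyX_eq0.
have dr : 'X^n %| along phi g - along phi h * r.
  have eqr : r = v * along phi g - (v * along phi g) %/ 'X^n * 'X^n.
    by rewrite [X in _ = X - _](divp_eq _ 'X^n) addrC addKr.
  have eqw : 1 - v * along phi h = w * 'X^n by rewrite -eq1 addrC addKr.
  rewrite eqr; set q := _ %/ _.
  have -> : along phi g - along phi h * (v * along phi g - q * 'X^n) =
    along phi g * (1 - v * along phi h) + along phi h * q * 'X^n by ring.
  by rewrite eqw mulrA -mulrDl dvdp_mull.
exists (poly_rV r); split; first by apply/local_iff; rewrite poly_rV_K.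
move=> c /local_iff dv.
have := dvdp_sub dr dv.
have -> : along phi g - along phi h * r - (along phi g - along phi h * rVpoly c) =
  (rVpoly c - r) * along phi h by ring.
rewrite Gauss_dvdpl; last by rewrite coprimep_sym coprimep_Xn.
move=> dcr; apply: (can_inj rVpolyK); rewrite poly_rV_K //; apply/eqP.
rewrite eq_sym -subr_eq0; apply/eqP; apply: contraTeq dcr => ne0.
apply/negP => /(dvdp_leq ne0); rewrite size_polyXn leqNgt ltnS => /negP; apply.
by apply: leq_trans (size_polyD _ _) _; rewrite geq_max size_polyN sr size_poly.
Qed.
End Multiplicity.

(** * Uniqueness of the intersection multiplicity *)

Section MultiplicityUnique.
Variables (k : fieldType) (d d' : nat) (C : plane_curve k d) (C' : plane_curve k d').
Variables (P : point k).
Local Notation I := (local_ideal C C' P).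

Lemma local_idealD x y : I x -> I y -> I (x + y).
Proof.
move=> [e [u [v [b [h hb b0 ->]]]]] [e' [u' [v' [b' [h' hb' b0' ->]]]]].
exists (e + e')%N, (b' * u + b * u'), (b' * v + b * v'), (b * b').
have -> : (b' * u + b * u') * form C + (b' * v + b * v') * form C' =
  b' * (u * form C + v * form C') + b * (u' * form C + v' * form C') by ring.
have nz (c : {mpoly k[3]}) : c.@[coords P] != 0 -> tofrac c != 0.
  by rewrite tofrac_eq0; apply: contra => /eqP ->; rewrite meval0.
split; [|exact: dhomogM|by rewrite mevalM mulf_neq0|].
  by apply: rpredD; [rewrite addnC|]; apply: dhomogM.
rewrite (tofracD (b' * _)) (tofracM b') (tofracM b (_ + _)) (tofracM b b').
have fr (L : fieldType) (p q z t : L) : z != 0 -> t != 0 ->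
  p / z + q / t = (t * p + z * q) / (z * t) by move=> z0 t0; field; rewrite t0.
exact: fr (nz _ b0) (nz _ b0').
Qed.

Lemma local_idealZ (c : k) x : I x -> I (tofrac c%:MP * x).
Proof.
move=> [e [u [v [b [h hb b0 ->]]]]].
exists e, (c *: u), (c *: v), b.
rewrite -!scalerAl -scalerDr; split=> //; first exact: rpredZ.
by rewrite -mul_mpolyC (tofracM c%:MP) mulrA.
Qed.

Lemma local_ideal0 : I 0.
Proof.
exists 0%N, 0, 0, 1; rewrite !mul0r addr0 tofrac0 mul0r rpred0 dhomog1.
by split=> //; rewrite meval1 oner_neq0.
Qed.

Lemma local_ideal_sum (T : finType) (F : T -> {fraction {mpoly k[3]}}) :
  (forall i, I (F i)) -> I (\sum_i F i).
Proof.
move=> h; apply: (big_ind I); [exact: local_ideal0 | exact: local_idealD | by []].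
Qed.

(** If n' < n, the n by n' matrix expressing the first basis in the second has a nonzero left kernel
    vector. The corresponding combination of the first basis lies in the ideal, so 0 would have two
    coordinate vectors. *)
Lemma intersection_multiplicity_le n n' : intersection_multiplicity C C' P n ->
  intersection_multiplicity C C' P n' -> (n <= n')%N.
Proof.
move=> [r [r_loc r_uniq]] [r' [_ r'_uniq]].
have ex i : exists c : 'rV[k]_n', I (r i - \sum_(j < n') tofrac ((c 0 j)%:MP) * r' j).
  by have [c [hc _]] := r'_uniq _ (r_loc i); exists c.
have [B hB] := fin_all_exists ex.
pose M := \matrix_(i < n, j < n') B i 0 j.
rewrite leqNgt; apply/negP => lt_n'n.
have : kermx M != 0.
  rewrite kermx_eq0 /row_free; apply: contraL lt_n'n => /eqP <-.
  by rewrite -leqNgt rank_leq_col.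
case/rowV0Pn => c /sub_kermxP cM c_neq0.
have zero_loc : local_ring P 0.
  exists 0%N, 0, 1; rewrite rpred0 dhomog1 meval1 oner_neq0.
  by split=> //; rewrite tofrac0 mul0r.
have [c' [_ uniq_c']] := r_uniq 0 zero_loc.
(* The sign appears because membership is stated for 0 minus the combination. *)
have c'c : c' = - c.
  apply: uniq_c'; rewrite sub0r -sumrN.
  have -> : \sum_(i < n) - (tofrac (((- c) 0 i)%:MP) * r i) =
     \sum_(i < n) tofrac ((c 0 i)%:MP) *
       (r i - \sum_(j < n') tofrac ((B i 0 j)%:MP) * r' j).
    under [RHS]eq_bigr do rewrite mulrBr mulr_sumr.
    rewrite sumrB exchange_big /= [X in _ - X]big1 ?subr0 => [|j _]; last first.
      under eq_bigr do rewrite mulrA -(tofracM (_%:MP)) -mpolyCM.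
      rewrite -mulr_suml -rmorph_sum -rmorph_sum /=.
      have /matrixP/(_ 0 j) := cM; rewrite !mxE => cMj.
      rewrite (_ : \sum_i c 0 i * B i 0 j = 0) ?rmorph0 ?mul0r // -[RHS]cMj.
      by apply: eq_bigr => i _; rewrite mxE.
    by apply: eq_bigr => i _; rewrite mxE mpolyCN tofracN mulNr opprK.
  by apply: local_ideal_sum => i; apply: local_idealZ.
have c'0 : c' = 0.
  apply: uniq_c'; rewrite big1 ?subr0; first exact: local_ideal0.
  by move=> i _; rewrite mxE mpolyC0 tofrac0 mul0r.
by move: c_neq0; rewrite -oppr_eq0 -c'c c'0 eqxx.
Qed.

Lemma intersection_multiplicity_unique n n' : intersection_multiplicity C C' P n ->
  intersection_multiplicity C C' P n' -> n = n'.
Proof. by move=> h h'; apply/eqP; rewrite eqn_leq !intersection_multiplicity_le. Qed.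

End MultiplicityUnique.

(** * Points, forms and conics in frames *)

Section ProjSpace.
Variables (k : fieldType) (V : vectType k) (P0 : proj_space V).

(** The span of 0 is not a point of the projective space; [P0] is the default value there. *)
Definition pspan (v : V) : proj_space V :=
  insubd (P0 : {U : {vspace V} | \dim U == 1%N}) <[v]>%VS.

Lemma val_pspan v : v != 0 -> val (pspan v) = <[v]>%VS.
Proof. by move=> v0; rewrite val_insubd dim_vline v0. Qed.

Lemma vpick_neq0 (P : proj_space V) : vpick (val P) != 0.
Proof. by rewrite vpick0 -dimv_eq0 (eqP (valP P)). Qed.

Lemma vpick_pspan v : v != 0 -> exists2 c, c != 0 & vpick (val (pspan v)) = c *: v.
Proof.
move=> v0; have := memv_pick (val (pspan v)).
have := vpick_neq0 (pspan v); rewrite val_pspan //.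
move=> n0 /vlineP [c e]; exists c => //.
by apply: contra n0 => /eqP c0; rewrite e c0 scale0r.
Qed.

Lemma pspan_vpick (P : proj_space V) : pspan (vpick (val P)) = P.
Proof.
apply: val_inj; rewrite val_pspan ?vpick_neq0 //; apply/eqP.
by rewrite eqEdim (eqP (valP P)) dim_vline vpick_neq0 andbT -memvE memv_pick.
Qed.

Lemma pspanZ c v : c != 0 -> pspan (c *: v) = pspan v.
Proof.
move=> c0; have [->|v0] := eqVneq v 0; first by rewrite scaler0.
apply: val_inj; rewrite !val_pspan ?scaler_eq0 ?negb_or ?c0 //; apply/eqP.
by rewrite eqEdim !dim_vline scaler_eq0 negb_or c0 v0 andbT -memvE memvZ ?memv_line.
Qed.

Lemma pspan_inj u v : u != 0 -> v != 0 -> pspan u = pspan v ->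
  exists2 c, c != 0 & u = c *: v.
Proof.
move=> u0 v0 e; have [c c0 eu] := vpick_pspan u0; have [d d0 ev] := vpick_pspan v0.
exists (c^-1 * d); first by rewrite mulf_neq0 ?invr_eq0.
by rewrite -scalerA -ev -e eu scalerA mulVf // scale1r.
Qed.
End ProjSpace.

Section PointsAndCurves.
Variable k : fieldType.
Local Notation mp := {mpoly k[3]}.

Lemma const_mx1_neq0 : (const_mx 1 : 'rV[k]_3) != 0.
Proof.
by apply/eqP => /matrixP/(_ 0 0); rewrite !mxE => /eqP; rewrite oner_eq0.
Qed.

Definition pt0 : point k.
Proof. by exists <[const_mx 1 : 'rV[k]_3]>%VS; rewrite dim_vline const_mx1_neq0. Defined.

Definition pt : 'rV[k]_3 -> point k := pspan pt0.
Definition vec (P : point k) : 'rV[k]_3 := vpick (val P).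
Definition ev (f : mp) (v : 'rV[k]_3) : k := f.@[fun i => v 0 i].

Lemma vec_neq0 P : vec P != 0. Proof. exact: vpick_neq0. Qed.
Lemma pt_vec P : pt (vec P) = P. Proof. exact: pspan_vpick. Qed.
Lemma vec_pt v : v != 0 -> exists2 c, c != 0 & vec (pt v) = c *: v.
Proof. exact: vpick_pspan. Qed.
Lemma ptZ c v : c != 0 -> pt (c *: v) = pt v. Proof. exact: pspanZ. Qed.
Lemma pt_inj u v : u != 0 -> v != 0 -> pt u = pt v -> exists2 c, c != 0 & u = c *: v.
Proof. exact: pspan_inj. Qed.

Lemma evZ d f c v : f \is d.-homog -> ev f (c *: v) = c ^+ d * ev f v.
Proof.
move=> hf; rewrite -(meval_dhomog _ _ hf); apply: meval_eq => i.
by rewrite mxE.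
Qed.

Lemma dhomogXU (i : 'I_3) : ('X_i : mp) \is 1.-homog.
Proof. by rewrite dhomogX; apply/eqP; exact: mdeg1. Qed.

Variable d : nat.

Definition monomial0 : dhomog 3 k d := indhomog d ('X_0 ^+ d).

Lemma monomial0_neq0 : monomial0 != 0.
Proof.
apply/eqP => /(congr1 val) /=; rewrite insubdK; last first.
  by have := dhomogMn d (dhomogXU 0); rewrite mul1n.
move/(congr1 (meval (fun=> 1))); rewrite meval0 rmorphXn /= mevalXU expr1n.
by move/eqP; rewrite oner_eq0.
Qed.

Definition curve0 : plane_curve k d.
Proof. by exists <[monomial0]>%VS; rewrite dim_vline monomial0_neq0. Defined.

Definition curve (f : mp) : plane_curve k d := pspan curve0 (indhomog d f).

Lemma form_homog (C : plane_curve k d) : form C \is d.-homog.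
Proof. exact: dhomog_is_dhomog. Qed.

Lemma form_neq0 (C : plane_curve k d) : form C != 0.
Proof. by apply: contra (vpick_neq0 C) => /eqP h; apply/eqP/val_inj. Qed.

Lemma val_dhomog (f : mp) : f \is d.-homog -> val (indhomog d f) = f.
Proof. by move=> hf; rewrite insubdK. Qed.

Lemma dhomog_neq0 (f : mp) : f \is d.-homog -> f != 0 -> (indhomog d f) != 0.
Proof. by move=> hf; apply: contra => /eqP h; rewrite -(val_dhomog hf) h. Qed.

Lemma form_curve (f : mp) : f \is d.-homog -> f != 0 ->
  exists2 c, c != 0 & form (curve f) = c *: f.
Proof.
move=> hf f0; have [c c0 e] := vpick_pspan curve0 (dhomog_neq0 hf f0).
by exists c => //; rewrite /form e /= -[in RHS](val_dhomog hf).
Qed.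

Lemma curve_form (C : plane_curve k d) : curve (form C) = C.
Proof.
rewrite -[RHS](pspan_vpick curve0); congr (pspan _ _).
by apply: val_inj; rewrite val_dhomog // form_homog.
Qed.

Lemma curveZ c f : f \is d.-homog -> c != 0 -> curve (c *: f) = curve f.
Proof.
move=> hf c0; rewrite -[RHS](pspanZ _ _ c0); congr (pspan _ _).
by apply: val_inj; rewrite val_dhomog ?dhomogZ //= -[in LHS](val_dhomog hf).
Qed.

Lemma on_curveE (C : plane_curve k d) P : on_curve C P <-> ev (form C) (vec P) = 0.
Proof. by []. Qed.

Lemma on_curve_pt (C : plane_curve k d) v : v != 0 ->
  on_curve C (pt v) <-> ev (form C) v = 0.
Proof.
move=> v0; rewrite on_curveE; have [c c0 ->] := vec_pt v0.
rewrite (evZ _ _ (form_homog C)); split=> [/eqP|->]; last by rewrite mulr0.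
by rewrite mulf_eq0 expf_eq0 (negbTE c0) andbF => /eqP.
Qed.

End PointsAndCurves.
Arguments curve {k} d f.

Definition o0 : 'I_3 := Ordinal (isT : (0 < 3)%N).
Definition o1 : 'I_3 := Ordinal (isT : (1 < 3)%N).
Definition o2 : 'I_3 := Ordinal (isT : (2 < 3)%N).

Lemma I3_ind (P : 'I_3 -> Prop) : P o0 -> P o1 -> P o2 -> forall i, P i.
Proof.
move=> p0 p1 p2 [[|[|[|//]]] lti].
- by rewrite (_ : Ordinal lti = o0) //; apply: val_inj.
- by rewrite (_ : Ordinal lti = o1) //; apply: val_inj.
- by rewrite (_ : Ordinal lti = o2) //; apply: val_inj.
Qed.

Lemma sum3 (V : nmodType) (F : 'I_3 -> V) : \sum_i F i = F o0 + F o1 + F o2.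
Proof.
rewrite !big_ord_recl big_ord0 addr0 addrA.
by congr (F _ + F _ + F _); apply: val_inj.
Qed.

Definition row3 (R : Type) (x y z : R) : 'rV[R]_3 :=
  \row_j (if val j is 0%N then x else if val j is 1%N then y else z).

Lemma row3E (R : Type) (v : 'rV[R]_3) : v = row3 (v 0 o0) (v 0 o1) (v 0 o2).
Proof. by apply/rowP; apply: I3_ind; rewrite mxE. Qed.

(** * Linear, quadratic and Hermitian forms given by matrices *)

Section Forms.
Variable k : fieldType.
Local Notation mp := {mpoly k[3]}.

Definition linf (c : 'rV[k]_3) : mp := \sum_i c 0 i *: 'X_i.
Definition quadf (S : 'M[k]_3) : mp := \sum_i \sum_j S i j *: ('X_i * 'X_j).
Definition hermf (H : 'M[k]_3) : mp := \sum_i \sum_j H i j *: ('X_i * 'X_j ^+ 5).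

Lemma linf_homog c : linf c \is 1.-homog.
Proof. by apply: rpred_sum => i _; apply/dhomogZ/dhomogXU. Qed.

Lemma quadf_homog S : quadf S \is 2.-homog.
Proof.
apply: rpred_sum => i _; apply: rpred_sum => j _; apply: dhomogZ.
exact: dhomogM (dhomogXU _ _) (dhomogXU _ _).
Qed.

Section Substitution.
Variables (S : comNzRingType) (f : {rmorphism k -> S}) (v : 'rV[S]_3).
Local Notation sub := (mmap f (fun i => v 0 i)).

Lemma mmap_linf c : sub (linf c) = (v *m (map_mx f c)^T) 0 0.
Proof.
rewrite /linf rmorph_sum mxE; apply: eq_bigr => i _.
by rewrite /= mmapZ mmapX mmap1U !mxE mulrC.
Qed.

Lemma mmap_quadf A : sub (quadf A) = (v *m map_mx f A *m v^T) 0 0.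
Proof.
rewrite /quadf rmorph_sum -mulmxA mxE; apply: eq_bigr => i _.
rewrite rmorph_sum mxE mulr_sumr; apply: eq_bigr => j _.
by rewrite /= mmapZ rmorphM /= !mmapX !mmap1U !mxE mulrCA.
Qed.

Lemma mmap_hermf A : sub (hermf A) = (v *m map_mx f A *m (map_mx (fun x => x ^+ 5) v)^T) 0 0.
Proof.
rewrite /hermf rmorph_sum -mulmxA mxE; apply: eq_bigr => i _.
rewrite rmorph_sum mxE mulr_sumr; apply: eq_bigr => j _.
by rewrite /= mmapZ rmorphM rmorphXn /= !mmapX !mmap1U !mxE mulrCA.
Qed.
End Substitution.

Definition X3 : 'rV[mp]_3 := \row_i 'X_i.

Lemma mmap_X3 (p : mp) : mmap (@mpolyC 3 k) (fun i => X3 0 i) p = p.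
Proof.
rewrite -[RHS]comp_mpoly_id; apply: mmap_ext => i.
by rewrite mxE tnth_map tnth_ord_tuple.
Qed.

Lemma ev_linf c v : ev (linf c) v = (v *m c^T) 0 0.
Proof. by rewrite /ev /meval mmap_linf map_mx_id. Qed.

Lemma ev_quadf A v : ev (quadf A) v = (v *m A *m v^T) 0 0.
Proof. by rewrite /ev /meval mmap_quadf map_mx_id. Qed.

Lemma linfZ c v : linf (c *: v) = c *: linf v.
Proof. by rewrite /linf scaler_sumr; apply: eq_bigr => i _; rewrite mxE scalerA. Qed.

Lemma linf_inj u v : linf u = linf v -> u = v.
Proof.
move=> e; apply/rowP => i; have := congr1 (fun p => ev p (delta_mx 0 i)) e => /=.
by rewrite !ev_linf -!rowE !mxE.
Qed.

Lemma quadfZ c A : quadf (c *: A) = c *: quadf A.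
Proof.
rewrite /quadf scaler_sumr; apply: eq_bigr => i _; rewrite scaler_sumr.
by apply: eq_bigr => j _; rewrite mxE scalerA.
Qed.

(** Polarization: the value at a sum of two basis vectors yields 2 A_ij, and 2 is invertible. *)
Lemma quadf_inj A A' : 2%:R != 0 :> k -> A^T = A -> A'^T = A' ->
  quadf A = quadf A' -> A = A'.
Proof.
move=> n2 sA sA' e.
have h (u : 'rV[k]_3) : (u *m A *m u^T) 0 0 = (u *m A' *m u^T) 0 0 by rewrite -!ev_quadf e.
have bil (C : 'M[k]_3) (u w : 'rV[k]_3) : C^T = C -> ((u + w) *m C *m (u + w)^T) 0 0 =
   (u *m C *m u^T) 0 0 + (w *m C *m w^T) 0 0 + 2%:R * (u *m C *m w^T) 0 0.
  move=> sC; have sw : (w *m C *m u^T) 0 0 = (u *m C *m w^T) 0 0.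
    rewrite -[LHS]trace_mx11 -[RHS]trace_mx11 -mxtrace_tr !trmx_mul trmxK sC.
    by rewrite mulmxA.
  rewrite linearD /= !(mulmxDl, mulmxDr) !mxE.
  rewrite !mxE in sw; rewrite sw; ring.
apply/matrixP => i j.
have e2 : 2%:R * ((delta_mx 0 i : 'rV_3) *m A *m (delta_mx 0 j : 'rV_3)^T) 0 0 =
  2%:R * ((delta_mx 0 i : 'rV_3) *m A' *m (delta_mx 0 j : 'rV_3)^T) 0 0.
  have := h (delta_mx 0 i + delta_mx 0 j).
  by rewrite !bil // !h => /addrI.
move/(mulfI n2): e2.
by rewrite -!rowE trmx_delta -!colE !mxE.
Qed.

Lemma linf_dhomog f : f \is 1.-homog -> exists c, f = linf c.
Proof.
move=> hf; exists (\row_i f@_U_(i)).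
apply/mpolyP => m; rewrite /linf raddf_sum /=.
have [md|md] := eqVneq (mdeg m) 1%N.
  have /mdeg1P[i /eqP ->] : mdeg m == 1%N by apply/eqP.
  rewrite (bigD1 i) //= big1 ?addr0 => [|j ji]; rewrite mcoeffZ mcoeffXU !mxE.
    by rewrite eqxx mulr1.
  by rewrite (negbTE ji) mulr0.
rewrite (dhomog_nemf_coeff hf) // big1 // => i _.
rewrite mcoeffZ mcoeffX; case: eqP => [e|]; last by rewrite mulr0.
by move: md; rewrite -e mdeg1 eqxx.
Qed.

(** Every monomial of degree 2 is some X_i X_j, which gives a matrix; halving its sum with the
    transpose makes it symmetric. *)
Lemma quadf_dhomog f : 2%:R != 0 :> k -> f \is 2.-homog -> exists2 A, A^T = A & f = quadf A.
Proof.
move=> n2 hf; suff [A ->] : exists A, f = quadf A.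
  exists (2%:R^-1 *: (A + A^T)).
    by rewrite linearZ linearD /= trmxK addrC.
  rewrite quadfZ; apply: (scalerI n2); rewrite scalerA divff // scale1r.
  rewrite scaler_nat mulr2n /quadf.
  rewrite {2}exchange_big -big_split; apply: eq_bigr => i _.
  rewrite -big_split; apply: eq_bigr => j _ /=.
  by rewrite !mxE scalerDl ['X_j * _]mulrC.
rewrite [f]mpolyE; move/dhomogP: hf; move: (msupp f) => s hs.
suff span c : exists A, \sum_(m <- s) c m *: 'X_[m] = quadf A by exact: (span (fun m => f@_m)).
elim: s hs => [|m s IH] hs.
  by exists 0; rewrite big_nil /quadf big1 // => i _; rewrite big1 // => j _; rewrite mxE scale0r.
have [A eA] : exists A, \sum_(m <- s) c m *: 'X_[m] = quadf A.
  by apply: IH => m' hm'; apply: hs; rewrite in_cons hm' orbT.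
have md : mdeg m = 2%N by apply: hs; rewrite mem_head.
have [i hi] : exists i, (0 < m i)%N.
  apply/existsP; apply: contraTT (ltn0Sn 1) => /existsPn h; rewrite -md mdegE.
  by rewrite big1 // => i _; apply/eqP; rewrite -leqn0 leqNgt.
have le_im : (U_(i) <= m)%MM.
  by apply/mnm_lepP => j; rewrite mnm1E; case: eqP => [<-|].
have /mdeg1P[j /eqP ej] : mdeg (m - U_(i))%MM == 1%N.
  by have := mdegD (m - U_(i)) U_(i); rewrite submK // md mdeg1 addn1 => -[<-].
exists (A + c m *: delta_mx i j).
rewrite big_cons eA /quadf.
have -> : 'X_[m] = 'X_i * 'X_j :> mp by rewrite -mpolyXD -ej addmC submK.
have -> : c m *: ('X_i * 'X_j) = \sum_i' \sum_j' (c m *: delta_mx i j) i' j' *: ('X_i' * 'X_j') :> mp.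
  rewrite (bigD1 i) //= [X in _ + X]big1 => [|i' ne]; last first.
    by rewrite big1 // => j' _; rewrite !mxE (negbTE ne) mulr0 scale0r.
  rewrite addr0 (bigD1 j) //= big1 => [|j' ne]; last first.
    by rewrite !mxE (negbTE ne) andbF mulr0 scale0r.
  by rewrite !mxE !eqxx mulr1 addr0.
rewrite addrC -big_split; apply: eq_bigr => i' _; rewrite -big_split.
by apply: eq_bigr => j' _; rewrite /= [in RHS]mxE scalerDl.
Qed.

End Forms.

Definition mat3 (R : Type) (u v w : 'rV[R]_3) : 'M[R]_3 :=
  \matrix_(i, j) (if val i is 0%N then u 0 j else if val i is 1%N then v 0 j else w 0 j).

Lemma row3_mulmx (R : pzRingType) (a b c : R) (E : 'M[R]_3) j :
  (row3 a b c *m E) 0 j = a * E o0 j + b * E o1 j + c * E o2 j.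
Proof. by rewrite mxE sum3 !mxE. Qed.

(** As a symmetric matrix it is twice the quadratic form xz - y^2. The same matrix will be the Gram
    matrix of the Hermitian form in a well chosen frame, so one matrix controls both the conic and
    Gamma. *)
Definition Jmx (R : pzRingType) : 'M[R]_3 :=
  mat3 (row3 0 0 1) (row3 0 (- 2%:R) 0) (row3 1 0 0).

Lemma map_Jmx (R S : pzRingType) (f : {rmorphism R -> S}) : map_mx f (Jmx R) = Jmx S.
Proof.
apply/matrixP; apply: I3_ind; apply: I3_ind;
  by rewrite !mxE /= ?rmorph0 ?rmorph1 // rmorphN rmorph_nat.
Qed.

Lemma tr_Jmx (R : pzRingType) : (Jmx R)^T = Jmx R.
Proof. by apply/matrixP; apply: I3_ind; apply: I3_ind; rewrite !mxE. Qed.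

Lemma Jmx_form (R : comPzRingType) (y z : 'rV[R]_3) : (y *m Jmx R *m z^T) 0 0 =
  y 0 o0 * z 0 o2 - 2%:R * (y 0 o1 * z 0 o1) + y 0 o2 * z 0 o0.
Proof. by rewrite mxE sum3 !mxE !sum3 !mxE /=; ring. Qed.

Lemma unitmxP (k : fieldType) n (A : 'M[k]_n) :
  (forall v : 'rV_n, v *m A = 0 -> v = 0) -> A \in unitmx.
Proof.
move=> h; rewrite -row_free_unit -kermx_eq0; apply/eqP/row_matrixP => i.
by rewrite row0; apply: h; rewrite -row_mul mulmx_ker row0.
Qed.

(** * Conics and lines attached to a frame *)

Section Frames.
Variable k : fieldType.
Hypothesis n2 : 2%:R != 0 :> k.
Local Notation mp := {mpoly k[3]}.
Local Notation J := (Jmx k).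

Lemma Jmx_unit : J \in unitmx.
Proof.
apply: unitmxP => v h; have e j : (v *m J) 0 j = 0 by rewrite h mxE.
have := e o0; have := e o1; have := e o2; rewrite !mxE !sum3 !mxE /=.
rewrite !(mulr0, mulr1, add0r, addr0) => v0 v1 v2.
apply/rowP; apply: I3_ind; rewrite mxE //.
by move/eqP: v1; rewrite mulrN oppr_eq0 mulf_eq0 (negbTE n2) orbF => /eqP.
Qed.

(** The rows of [E] are the frame vectors, so v = y E has frame coordinates y = v E^-1, in which the
    conic has matrix J. *)
Definition conic_mx (E : 'M[k]_3) := invmx E *m J *m (invmx E)^T.
Definition conicE (E : 'M[k]_3) : plane_curve k 2 := curve 2 (quadf (conic_mx E)).
Definition coordf (E : 'M[k]_3) (j : 'I_3) : mp := linf (\row_i invmx E i j).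
(** The tangent to [conicE E] at parameter 0; for a unitary frame it will also be the tangent to
    Gamma there. *)
Definition lineE (E : 'M[k]_3) : plane_curve k 1 := curve 1 (coordf E o0).

Lemma tr_conic_mx E : (conic_mx E)^T = conic_mx E.
Proof. by rewrite /conic_mx !trmx_mul trmxK tr_Jmx mulmxA. Qed.

Section FixFrame.
Variables (E : 'M[k]_3) (Eu : E \in unitmx).

Section Eval.
Variables (S : comNzRingType) (f : {rmorphism k -> S}) (y : 'rV[S]_3).
Local Notation sub := (mmap f (fun i => (y *m map_mx f E) 0 i)).

Lemma map_mxVE : map_mx f E *m map_mx f (invmx E) = 1%:M.
Proof. by rewrite -map_mxM mulmxV // map_mx1. Qed.

Lemma mmap_conic_mx : sub (quadf (conic_mx E)) =
  y 0 o0 * y 0 o2 - 2%:R * (y 0 o1 * y 0 o1) + y 0 o2 * y 0 o0.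
Proof.
rewrite mmap_quadf /conic_mx !map_mxM -map_trmx map_Jmx trmx_mul !mulmxA.
rewrite -[y *m _ *m _]mulmxA map_mxVE mulmx1.
by rewrite -[_ *m _ *m (map_mx f E)^T]mulmxA -trmx_mul map_mxVE trmx1 mulmx1 Jmx_form.
Qed.

Lemma mmap_coordf j : sub (coordf E j) = y 0 j.
Proof.
rewrite mmap_linf.
have -> : (map_mx f (\row_i invmx E i j))^T = col j (map_mx f (invmx E)).
  by apply/matrixP => a b; rewrite !mxE.
by rewrite colE !mulmxA -[y *m _ *m _]mulmxA map_mxVE mulmx1 -colE mxE.
Qed.
End Eval.

Lemma row_mul_neq0 (y : 'rV[k]_3) : y != 0 -> y *m E != 0.
Proof.
by apply: contra => /eqP h; rewrite -[y](mulmxK Eu) h mul0mx.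
Qed.

Lemma ev_conic_mx (y : 'rV[k]_3) : ev (quadf (conic_mx E)) (y *m E) =
  2%:R * (y 0 o0 * y 0 o2 - y 0 o1 ^+ 2).
Proof.
have := mmap_conic_mx idfun y; rewrite (map_mx_id (f := idfun)) // => e.
by rewrite /ev /meval e; ring.
Qed.

Lemma ev_coordf j (y : 'rV[k]_3) : ev (coordf E j) (y *m E) = y 0 j.
Proof.
by have := mmap_coordf idfun y j; rewrite (map_mx_id (f := idfun)).
Qed.

Lemma quadf_conic_mx_neq0 : quadf (conic_mx E) != 0.
Proof.
apply/eqP => h; have := ev_conic_mx (row3 1 0 1).
rewrite h /ev meval0 !mxE /= mulr1 expr0n subr0 mulr1 => /esym/eqP.
by rewrite (negbTE n2).
Qed.

Lemma coordf_neq0 j : coordf E j != 0.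
Proof.
apply/eqP => h; have := ev_coordf j (const_mx 1).
by rewrite h /ev meval0 mxE => /esym/eqP; rewrite oner_eq0.
Qed.

Lemma form_conicE : exists2 c, c != 0 & form (conicE E) = c *: quadf (conic_mx E).
Proof. exact: form_curve (quadf_homog _) quadf_conic_mx_neq0. Qed.

Lemma form_lineE : exists2 c, c != 0 & form (lineE E) = c *: coordf E o0.
Proof. exact: form_curve (linf_homog _) (coordf_neq0 _). Qed.

Lemma on_conicE (y : 'rV[k]_3) : y != 0 ->
  on_curve (conicE E) (pt (y *m E)) <-> y 0 o0 * y 0 o2 = y 0 o1 ^+ 2.
Proof.
move=> y0; rewrite (on_curve_pt _ (row_mul_neq0 y0)); have [c c0 ->] := form_conicE.
rewrite /ev mevalZ -/(ev _ _) ev_conic_mx; split=> [/eqP|->].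
  by rewrite !mulf_eq0 (negbTE c0) (negbTE n2) subr_eq0 => /eqP.
by rewrite subrr !mulr0.
Qed.

Lemma pt_frame P : exists2 y : 'rV[k]_3, y != 0 & P = pt (y *m E).
Proof.
exists (vec P *m invmx E); last by rewrite mulmxKV // pt_vec.
by apply: contra (vec_neq0 P) => /eqP h; rewrite -[vec P](mulmxKV Eu) h mul0mx.
Qed.

Definition curve_pt (s : k) := pt (row3 (s ^+ 2) s 1 *m E).
Definition curve_oo := pt (row3 1 0 0 *m E).

Lemma row3_neq0 (x y z : k) : (row3 x y z != 0) = [|| x != 0, y != 0 | z != 0].
Proof.
apply/idP/idP; last first.
  apply: contraTN => /eqP /rowP h; have := h o0; have := h o1; have := h o2.
  by rewrite !mxE /= => -> -> ->; rewrite eqxx.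
apply: contraNT; rewrite !negb_or !negbK => /and3P[/eqP-> /eqP-> /eqP->].
by apply/eqP/rowP; apply: I3_ind; rewrite !mxE.
Qed.

Lemma conicE_points P : on_curve (conicE E) P <-> (exists s, P = curve_pt s) \/ P = curve_oo.
Proof.
split; last first.
  case=> [[s ->]|->]; apply/on_conicE; rewrite ?row3_neq0 ?oner_neq0 ?orbT // !mxE /=.
    by rewrite mulr1.
  by rewrite mulr0 expr0n.
have [y y0 ->] := pt_frame P.
rewrite (on_conicE y0) => h; have [z0|z0] := eqVneq (y 0 o2) 0.
  right; move/eqP: h; rewrite z0 mulr0 eq_sym sqrf_eq0 => /eqP y1.
  have x0 : y 0 o0 != 0.
    by move: y0; rewrite {1}[y]row3E row3_neq0 y1 z0 !eqxx !orbF.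
  rewrite /curve_oo -[RHS](ptZ _ x0) scalemxAl; congr (pt (_ *m E)).
  by apply/rowP; apply: I3_ind; rewrite !mxE ?y1 ?z0 ?mulr0 ?mulr1.
left; exists (y 0 o1 / y 0 o2); rewrite /curve_pt -[RHS](ptZ _ z0) scalemxAl.
congr (pt (_ *m E)); rewrite [y in LHS]row3E.
apply/rowP; apply: I3_ind; rewrite !mxE /= ?mulr1 //; last by rewrite mulrC divfK.
by rewrite expr_div_n -h; field.
Qed.

Lemma curve_pt_inj : injective curve_pt.
Proof.
move=> s t /pt_inj[]; rewrite ?row_mul_neq0 ?row3_neq0 ?oner_neq0 ?orbT //.
move=> c c0; rewrite scalemxAl => /(can_inj (mulmxK Eu)) /rowP h.
have := h o1; have := h o2; rewrite !mxE /= mulr1 => <-.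
by rewrite mul1r.
Qed.

Lemma curve_pt_oo s : curve_pt s <> curve_oo.
Proof.
move/pt_inj=> []; rewrite ?row_mul_neq0 ?row3_neq0 ?oner_neq0 ?orbT //.
move=> c c0; rewrite scalemxAl => /(can_inj (mulmxK Eu)) /rowP /(_ o2).
by rewrite !mxE /= mulr0 => /eqP; rewrite oner_eq0.
Qed.

Lemma coordfE i : 'X_i = \sum_j E j i *: coordf E j :> mp.
Proof.
rewrite -(mmap_X3 'X_i) mmapX mmap1U mxE.
have e : X3 k = (X3 k *m map_mx (@mpolyC 3 k) (invmx E)) *m map_mx (@mpolyC 3 k) E.
  by rewrite -mulmxA -map_mxM mulVmx // map_mx1 mulmx1.
have cf j : coordf E j = (X3 k *m map_mx (@mpolyC 3 k) (invmx E)) 0 j.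
  by rewrite -(mmap_X3 (coordf E j)) {1}e mmap_coordf.
have := congr1 (fun M : 'rV[mp]_3 => M 0 i) e; rewrite /= !mxE => ->.
apply: eq_bigr => j _; rewrite cf !mxE mulrC mul_mpolyC.
by congr (_ *: _); apply: eq_bigr => l _; rewrite !mxE.
Qed.

Definition conic_along : 'I_3 -> {poly k} := fun i => (row3 ('X ^+ 2) 'X 1 *m map_mx (@polyC k) E) 0 i.
Definition line_along : 'I_3 -> {poly k} := fun i => (row3 0 'X 1 *m map_mx (@polyC k) E) 0 i.

Lemma along_coordf (y : 'rV[{poly k}]_3) j : along (fun i => (y *m map_mx (@polyC k) E) 0 i) (coordf E j) = y 0 j.
Proof. exact: (mmap_coordf (@polyC k)). Qed.

Lemma conic_parametrizes : parametrizes (form (conicE E)) (curve_pt 0) conic_along.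
Proof.
have [c c0 ->] := form_conicE; split.
- have y0 : row3 (0 ^+ 2 : k) 0 1 != 0 by rewrite row3_neq0 oner_neq0 !orbT.
  have [d d0 e] := vec_pt (row_mul_neq0 y0).
  exists d => // i; have -> : coords (curve_pt 0) i = vec (curve_pt 0) 0 i by [].
  rewrite e mxE !row3_mulmx /conic_along row3_mulmx !mxE.
  by rewrite !hornerE /= expr0n.
- rewrite alongZ /along /conic_along (mmap_conic_mx (@polyC k)) !mxE /=.
  by rewrite (_ : _ - _ + _ = 0) ?scaler0 //; ring.
exists (coordf E o1), (coordf E o2), 1%N; split; rewrite ?linf_homog //.
- by rewrite !along_coordf !mxE.
- move=> i; rewrite /conic_along row3_mulmx !mxE mul1r.
  apply: leq_trans (size_polyD _ _) _; rewrite geq_max; apply/andP; split.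
    apply: leq_trans (size_polyD _ _) _; rewrite geq_max; apply/andP; split.
      by rewrite mulrC mul_polyC (leq_trans (size_scale_leq _ _)) // size_polyXn.
    by rewrite mulrC mul_polyC (leq_trans (size_scale_leq _ _)) // size_polyX.
  by rewrite (leq_trans (size_polyC_leq1 _)).
(* In frame coordinates y the difference is E_0i (y0 y2 - y1^2), while the form of the conic is 2 c
   (y0 y2 - y1^2). *)
move=> i; exists ((E o0 i / (2%:R * c))%:MP).
have -> : c *: quadf (conic_mx E) = (2%:R * c) *: (coordf E o0 * coordf E o2 - coordf E o1 ^+ 2).
  rewrite -(mmap_X3 (quadf _)).
  have -> : X3 k = (\row_j coordf E j) *m map_mx (@mpolyC 3 k) E.
    apply/rowP => j; rewrite !mxE coordfE; apply: eq_bigr => l _.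
    by rewrite !mxE mulrC mul_mpolyC.
  rewrite (mmap_conic_mx (@mpolyC 3 k)) !mxE -!mul_mpolyC mpolyCM rmorph_nat.
  by ring.
rewrite mul_mpolyC scalerA divfK ?mulf_neq0 // expr1 coordfE sum3.
have -> : conic_along i = E o0 i *: 'X^2 + E o1 i *: 'X + (E o2 i)%:P.
  by rewrite /conic_along row3_mulmx !mxE mul1r -!mul_polyC mulrC ['X * _]mulrC.
rewrite /homogenize sum3 /= !coefD !coefZ !coefXn !coefX !coefC /=.
rewrite !(mulr0, mulr1, addr0, add0r) (_ : (2 - 1 = 1)%N) //.
by rewrite -!mul_mpolyC; ring.
Qed.

Lemma line_parametrizes : parametrizes (form (lineE E)) (curve_pt 0) line_along.
Proof.
have [c c0 ->] := form_lineE; split.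
- have y0 : row3 (0 ^+ 2 : k) 0 1 != 0 by rewrite row3_neq0 oner_neq0 !orbT.
  have [d d0 e] := vec_pt (row_mul_neq0 y0).
  exists d => // i; have -> : coords (curve_pt 0) i = vec (curve_pt 0) 0 i by [].
  rewrite e mxE !row3_mulmx /line_along row3_mulmx !mxE.
  by rewrite !hornerE expr0n mul0r add0r /= mulr1.
- by rewrite alongZ along_coordf mxE scaler0.
exists (coordf E o1), (coordf E o2), 0%N; split; rewrite ?linf_homog //.
- by rewrite !along_coordf !mxE.
- move=> i; rewrite /line_along row3_mulmx !mxE mul0r add0r mul1r.
  apply: leq_trans (size_polyD _ _) _; rewrite geq_max; apply/andP; split.
    by rewrite mulrC mul_polyC (leq_trans (size_scale_leq _ _)) // size_polyX.
  by rewrite (leq_trans (size_polyC_leq1 _)).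
move=> i; exists ((E o0 i / c)%:MP).
rewrite mul_mpolyC scalerA divfK // expr0 mul1r coordfE sum3.
have -> : line_along i = E o1 i *: 'X + (E o2 i)%:P.
  by rewrite /line_along row3_mulmx !mxE mul0r add0r mul1r -!mul_polyC ['X * _]mulrC.
rewrite /homogenize !big_ord_recl big_ord0 /= !coefD !coefZ !coefX !coefC /=.
rewrite !(mulr0, mulr1, addr0, add0r) -!mul_mpolyC.
by ring.
Qed.

End FixFrame.
End Frames.

Lemma card_ordP (T : Type) (A : set T) n :
  (A #= `I_n)%card <-> exists f : 'I_n -> T, injective f /\ forall x, A x <-> exists i, f i = x.
Proof.
split=> [/card_set_bijP[g [g1 g2 g3]] | [f [f1 f2]]].
  have /choice [f hf] (i : 'I_n) : exists x, A x /\ g x = i.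
    by have [x Ax e] := g3 i (ltn_ord i); exists x.
  exists f; split=> [i j e|x].
    by apply: val_inj => /=; have [_ <-] := hf i; have [_ <-] := hf j; rewrite e.
  split=> [Ax|[i <-]]; last by have [] := hf i.
  exists (Ordinal (g1 _ Ax)); have [Af e] := hf (Ordinal (g1 _ Ax)).
  by apply: g2; rewrite ?inE.
apply/card_set_bijP.
have /choice [g hg] x : exists m : nat, A x -> exists2 i : 'I_n, f i = x & m = i.
  have [/f2 [i e]|] := pselect (A x); last by exists 0%N.
  by exists (val i) => _; exists i.
exists g; split.
- by move=> x /hg [i _ ->] /=; exact: ltn_ord.
- move=> x y; rewrite !inE => /hg [i <- ->] /hg [j <- ->] e.
  by congr f; apply: val_inj.
- move=> m /= ltm; exists (f (Ordinal ltm)); first by apply/f2; eexists.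
  have /hg [i /f1 ->] // : A (f (Ordinal ltm)) by apply/f2; eexists.
Qed.

Lemma card_ord_unique (T : Type) (A : set T) n m :
  (A #= `I_n)%card -> (A #= `I_m)%card -> n = m.
Proof.
move=> h h'; apply/card_eq_II; rewrite card_eq_sym in h; exact: card_eq_trans h h'.
Qed.

Section ChangeOfFrame.
Variable k : fieldType.
Hypothesis n2 : 2%:R != 0 :> k.
Local Notation J := (Jmx k).

(** Similitudes of J are the reparametrizations: they change the frame but not the conic. *)
Lemma conicE_mul (T E : 'M[k]_3) c : T \in unitmx -> E \in unitmx -> c != 0 ->
  T *m J *m T^T = c *: J -> conicE (T *m E) = conicE E.
Proof.
move=> Tu Eu c0 e; rewrite /conicE.
have -> : conic_mx (T *m E) = c^-1 *: conic_mx E.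
  have TE : T *m E \in unitmx by rewrite unitmx_mul Tu.
  apply: (canRL (scalerK c0)); rewrite /conic_mx.
  have -> : invmx (T *m E) = invmx E *m invmx T.
    apply: (can_inj (mulKmx TE)); rewrite mulmxV // -mulmxA (mulmxA E) mulmxV //.
    by rewrite mul1mx mulmxV.
  rewrite scalemxAl scalemxAr -e trmx_mul !mulmxA mulmxKV //.
  by rewrite -[_ *m T^T *m _]mulmxA -trmx_mul mulVmx // trmx1 mulmx1.
by rewrite quadfZ curveZ ?quadf_homog ?invr_eq0.
Qed.

(** [shift], [swap] and [stretch] describe the effect on (s^2, s, 1), up to a scalar, of the
    substitutions s + c, 1/s and c s. The first two preserve J; the last scales it by c^2. *)
Definition shift (c : k) : 'M[k]_3 :=
  mat3 (row3 1 0 0) (row3 (2%:R * c) 1 0) (row3 (c ^+ 2) c 1).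
Definition swap : 'M[k]_3 := mat3 (row3 0 0 1) (row3 0 1 0) (row3 1 0 0).
Definition stretch (c : k) : 'M[k]_3 :=
  mat3 (row3 (c ^+ 2) 0 0) (row3 0 c 0) (row3 0 0 1).

Lemma Jmx_entry m n (A : 'M[k]_(m, 3)) (B : 'M[k]_(n, 3)) i j :
  (A *m J *m B^T) i j = A i o0 * B j o2 - 2%:R * (A i o1 * B j o1) + A i o2 * B j o0.
Proof.
have := Jmx_form (row i A) (row j B); rewrite !mxE !sum3 => <-.
by rewrite !mxE !sum3 !mxE.
Qed.

Ltac mx3 := apply/matrixP; apply: I3_ind; apply: I3_ind; rewrite Jmx_entry !mxE /=; ring.

Lemma shift_J c : shift c *m J *m (shift c)^T = J.
Proof. by mx3. Qed.
Lemma swap_J : swap *m J *m swap^T = J.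
Proof. by mx3. Qed.
Lemma stretch_J c : stretch c *m J *m (stretch c)^T = c ^+ 2 *: J.
Proof. by mx3. Qed.

Lemma conicE_of_mx (E S : 'M[k]_3) c : E \in unitmx -> c != 0 ->
  E *m S *m E^T = c *: J -> conicE E = curve 2 (quadf S).
Proof.
move=> Eu c0 e; have -> : S = c *: conic_mx E.
  rewrite /conic_mx scalemxAl scalemxAr -e !mulmxA mulVmx // mul1mx.
  by rewrite -mulmxA -trmx_mul mulVmx // trmx1 mulmx1.
by rewrite quadfZ curveZ ?quadf_homog.
Qed.

Lemma mderivXU (i j : 'I_3) : ('X_j)^`M(i) = (j == i)%:R :> {mpoly k[3]}.
Proof.
rewrite mderivX mnm1E; case: eqP => [->|_]; last by rewrite scale0r.
by rewrite scale1r -[X in (X - _)%MM]add0m addmK mpolyX0.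
Qed.

Lemma mderiv_quadf (S : 'M[k]_3) i (v : 'rV[k]_3) :
  ((quadf S)^`M(i)).@[fun j => v 0 j] = (v *m S + v *m S^T) 0 i.
Proof.
transitivity (\sum_a \sum_b S a b * ((a == i)%:R * v 0 b + v 0 a * (b == i)%:R)).
  pose D := @mderiv 3 k i; pose V := @meval 3 k (fun j => v 0 j).
  rewrite /quadf (raddf_sum D) (raddf_sum V); apply: eq_bigr => a _.
  rewrite /= (raddf_sum D) (raddf_sum V).
  apply: eq_bigr => b _; rewrite /= mderivZ mderivM !mderivXU mevalZ mevalD !mevalM !mevalXU.
  by rewrite !rmorph_nat.
rewrite !mxE; under eq_bigr do (under eq_bigr do rewrite mulrDr; rewrite big_split /=).
rewrite big_split [LHS]addrC /=; congr (_ + _).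
  apply: eq_bigr => a _; rewrite (bigD1 i) //= big1 => [|b /negbTE ->]; last by rewrite !mulr0.
  by rewrite eqxx addr0 mulr1 mulrC.
rewrite (bigD1 i) //= [X in _ + X]big1 => [|a /negbTE ->]; last first.
  by rewrite big1 // => b _; rewrite mul0r mulr0.
by rewrite addr0; apply: eq_bigr => b _; rewrite eqxx mul1r mxE mulrC.
Qed.

End ChangeOfFrame.

(** * Totally tangent conics and unitary frames *)

Section ClosedField.
Variable k : closedFieldType.
Hypothesis n2 : 2%:R != 0 :> k.
Local Notation J := (Jmx k).

Lemma root_exists n (x : k) : (0 < n)%N -> exists y, y ^+ n = x.
Proof.
case: n => // n _; have [y ey] := solve_monicpoly (fun i => if i is 0%N then x else 0) (ltn0Sn n).
exists y; rewrite ey big_ord_recl /= mulr1 big1 ?addr0 // => i _.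
by rewrite mul0r.
Qed.

Lemma pt_indep (u v : 'rV[k]_3) a b : u != 0 -> v != 0 -> pt u <> pt v ->
  a *: u + b *: v = 0 -> a = 0 /\ b = 0.
Proof.
move=> u0 v0 uv e; have [b0|b0] := eqVneq b 0.
  split=> //; move/eqP: e; rewrite b0 scale0r addr0 scaler_eq0 (negbTE u0) orbF.
  by move/eqP.
have a0 : a != 0.
  apply: contra b0 => /eqP a0; move/eqP: e.
  by rewrite a0 scale0r add0r scaler_eq0 (negbTE v0) orbF.
case: uv; have -> : u = (- (b / a)) *: v.
  apply: (scalerI a0); rewrite scalerA mulrN mulrC divfK // scaleNr.
  by apply/eqP; rewrite -addr_eq0 e.
by rewrite ptZ // oppr_eq0 mulf_neq0 // invr_eq0.
Qed.

Lemma mat3_mulE (A B C : 'rV[k]_3) (S : 'M[k]_3) i j (M := mat3 A B C) :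
  (M *m S *m M^T) i j = (row i M *m S *m (row j M)^T) 0 0.
Proof. by rewrite -row_mul tr_row -row_mul !mxE; apply: eq_bigr => l _; rewrite !mxE. Qed.

Lemma row_mat3 (A B C : 'rV[k]_3) :
  (row o0 (mat3 A B C) = A) * (row o1 (mat3 A B C) = B) * (row o2 (mat3 A B C) = C).
Proof. by do 2?split; apply/rowP => i; rewrite !mxE. Qed.

(** The frame consists of P' (parameter infinity), a vector orthogonal to both points (their pole),
    and P (parameter 0). Only the length of the middle vector has to be adjusted. *)
Lemma conic_frame (S : 'M[k]_3) P P' : S^T = S -> S \in unitmx -> P <> P' ->
  ev (quadf S) (vec P) = 0 -> ev (quadf S) (vec P') = 0 ->
  exists2 E, E \in unitmx & [/\ curve 2 (quadf S) = conicE E, P = curve_pt E 0 & P' = curve_oo E].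
Proof.
move=> sS Su neP eP eP'; set e3 := vec P in eP; set e1 := vec P' in eP'.
pose bil (u w : 'rV[k]_3) := (u *m S *m w^T) 0 0.
have bilC u w : bil u w = bil w u.
  rewrite /bil -[LHS]trace_mx11 -[RHS]trace_mx11 -mxtrace_tr !trmx_mul trmxK sS.
  by rewrite mulmxA.
have bilDl a u b v w : bil (a *: u + b *: v) w = a * bil u w + b * bil v w.
  by rewrite /bil !mulmxDl -!scalemxAl !mxE.
have b33 : bil e3 e3 = 0 by rewrite /bil -ev_quadf.
have b11 : bil e1 e1 = 0 by rewrite /bil -ev_quadf.
have e1n0 : e1 != 0 := vec_neq0 _.
have e3n0 : e3 != 0 := vec_neq0 _.
have pt13 : pt e1 <> pt e3 by rewrite !pt_vec => e; apply: neP.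
have mx0 (A : 'M[k]_1) : A 0 0 = 0 -> A = 0.
  by move=> h; apply/matrixP => i j; rewrite !ord1 h mxE.
pose M := col_mx e1 e3.
have rM : \rank M = 2%N.
  apply/eqP; rewrite -[_ == _]/(row_free M) -kermx_eq0; apply/eqP/row_matrixP => i.
  rewrite row0; set v := row i _.
  have : v *m M = 0 by rewrite -row_mul mulmx_ker row0.
  rewrite -[v]hsubmxK mul_row_col [lsubmx v]mx11_scalar [rsubmx v]mx11_scalar !mul_scalar_mx.
  case/(pt_indep e1n0 e3n0 pt13) => -> ->.
  have z : (0 : k)%:M = 0 :> 'M_1 by rewrite -scalemx1 scale0r.
  by rewrite z row_mx0.
(* Otherwise the two points span a totally isotropic plane, which a nondegenerate form in dimension
   3 does not have. *)
have b13 : bil e1 e3 != 0.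
  apply/eqP => b13.
  have : M *m S *m M^T = 0.
    rewrite tr_col_mx mul_col_mx mul_col_row (mx0 (e1 *m S *m e1^T)) //.
    rewrite (mx0 (e1 *m S *m e3^T)) // (mx0 (e3 *m S *m e1^T)) -/(bil _ _) 1?bilC //.
    by rewrite (mx0 (e3 *m S *m e3^T)) // block_mx0.
  move/mulmx0_rank_max; rewrite mxrankMfree ?row_free_unit // mxrank_tr rM.
  by [].
have [e2 e2n0 e2M] : exists2 e2 : 'rV[k]_3, e2 != 0 & e2 *m (S *m M^T) = 0.
  have : kermx (S *m M^T) != 0.
    rewrite kermx_eq0 -row_leq_rank -ltnNge; apply: leq_ltn_trans (rank_leq_col _) _.
    by [].
  by case/rowV0Pn => v /sub_kermxP vM v0; exists v.
have [b21 b23] : bil e2 e1 = 0 /\ bil e2 e3 = 0.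
  move: e2M; rewrite tr_col_mx mul_mx_row mul_mx_row !mulmxA -row_mx0.
  by case/eq_row_mx => h1 h3; rewrite /bil h1 h3 mxE.
have bilDr a u b v w : bil w (a *: u + b *: v) = a * bil w u + b * bil w v.
  by rewrite bilC bilDl bilC (bilC v).
have frame_unit v : v != 0 -> bil v e1 = 0 -> bil v e3 = 0 -> mat3 e1 v e3 \in unitmx.
  move=> v0 v1 v3; apply: unitmxP => w.
  have := row3E w; move: (w 0 o0) (w 0 o1) (w 0 o2) => a b c -> h.
  have hsum : a *: e1 + (1 *: (b *: v + c *: e3)) = 0.
    rewrite -[RHS]h; apply/rowP => j; rewrite row3_mulmx !mxE /=; ring.
  have : bil (a *: e1 + (1 *: (b *: v + c *: e3))) e3 = 0 by rewrite hsum /bil !mul0mx mxE.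
  rewrite !bilDl v3 b33 !(mulr0, addr0) => /eqP; rewrite mulf_eq0 (negbTE b13) orbF => /eqP a0.
  have : bil (a *: e1 + (1 *: (b *: v + c *: e3))) e1 = 0 by rewrite hsum /bil !mul0mx mxE.
  rewrite !bilDl v1 b11 !mulr0 !add0r mul1r bilC => /eqP; rewrite mulf_eq0 (negbTE b13) orbF => /eqP c0.
  move: hsum; rewrite a0 c0 !scale0r add0r addr0 scale1r => /eqP; rewrite scaler_eq0 (negbTE v0) orbF => /eqP b0.
  by rewrite b0; apply/rowP; apply: I3_ind; rewrite !mxE.
(* Otherwise [e2] would be orthogonal to a whole basis. *)
have b22 : bil e2 e2 != 0.
  apply/eqP => b22; have Eu := frame_unit e2 e2n0 b21 b23.
  have : e2 *m (S *m (mat3 e1 e2 e3)^T) = 0.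
    apply/rowP => j; rewrite mulmxA [RHS]mxE.
    have -> : (e2 *m S *m (mat3 e1 e2 e3)^T) 0 j = bil e2 (row j (mat3 e1 e2 e3)).
      by rewrite /bil !mxE; apply: eq_bigr => l _; rewrite !mxE.
    by move: j; apply: I3_ind; rewrite row_mat3.
  have SEu : S *m (mat3 e1 e2 e3)^T \in unitmx by rewrite unitmx_mul Su unitmx_tr.
  by move/(congr1 (mulmx^~ (invmx (S *m (mat3 e1 e2 e3)^T)))); rewrite mulmxK // mul0mx => /eqP; rewrite (negbTE e2n0).
(* J has corner entries 1 and middle entry -2, so the middle vector must have square length -2
   [bil e1 e3]. *)
have [t et] := root_exists (- 2%:R * bil e1 e3 / bil e2 e2) (isT : (0 < 2)%N).
have t0 : t != 0.
  by rewrite -sqrf_eq0 et !mulf_neq0 ?oppr_eq0 ?invr_eq0.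
have te2 : t *: e2 = t *: e2 + 0 *: e2 by rewrite scale0r addr0.
have v0 : t *: e2 != 0 by rewrite scaler_eq0 negb_or t0.
have Eu : mat3 e1 (t *: e2) e3 \in unitmx.
  by apply: frame_unit; rewrite // te2 bilDl ?b21 ?b23 !mulr0 addr0.
exists (mat3 e1 (t *: e2) e3) => //; split.
- apply/esym; apply: (conicE_of_mx Eu b13); apply/matrixP => i j; rewrite mat3_mulE -/(bil _ _) [RHS]mxE.
  have bt u : bil (t *: e2) u = t * bil e2 u by rewrite te2 bilDl mul0r addr0.
  have btr u : bil u (t *: e2) = t * bil u e2 by rewrite bilC bt bilC.
  move: i j; apply: I3_ind; apply: I3_ind;
    rewrite !row_mat3 !mxE /= ?bt ?btr ?b11 ?b33 ?(bilC e1 e2) ?(bilC e3 e2) ?b21 ?b23 ?mulr0 ?mulr1 //.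
  by rewrite mulrA -expr2 et; field.
- have e : row3 (0 ^+ 2) 0 1 *m mat3 e1 (t *: e2) e3 = e3.
    by apply/rowP => j; rewrite row3_mulmx !mxE /=; ring.
  by rewrite /curve_pt e pt_vec.
- have e : row3 1 0 0 *m mat3 e1 (t *: e2) e3 = e1.
    by apply/rowP => j; rewrite row3_mulmx !mxE /=; ring.
  by rewrite /curve_oo e pt_vec.
Qed.

End ClosedField.

Lemma comp_along (k : fieldType) (phi : 'I_3 -> {poly k}) g (q : {poly k}) :
  along phi g \Po q = along (fun i => phi i \Po q) g.
Proof.
rewrite /along -[LHS]/(comp_poly q (mmap _ _ _)).
by rewrite (rmorph_mmap (f' := @polyC k)) // => c; rewrite /= comp_polyC.
Qed.

Lemma poly_order (k : fieldType) (p : {poly k}) : p != 0 ->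
  exists n u, p = 'X^n * u /\ u.[0] != 0.
Proof.
move=> p0; have [n [u /implyP/(_ p0) nr e]] := multiplicity_XsubC p 0.
by exists n, u; split; rewrite // e polyC0 subr0 mulrC.
Qed.

Lemma prod_XsubC2_dvd (k : fieldType) (s : seq k) (p : {poly k}) : uniq s ->
  (forall a, a \in s -> ('X - a%:P) ^+ 2 %| p) -> \prod_(a <- s) ('X - a%:P) ^+ 2 %| p.
Proof.
elim: s => [|a s IH] /=; first by rewrite big_nil dvd1p.
case/andP=> nas us h; rewrite big_cons Gauss_dvdp.
  by rewrite h ?mem_head // IH // => b bs; apply: h; rewrite in_cons bs orbT.
rewrite big_seq; apply: (big_ind (coprimep _)); first exact: coprimep1.
  by move=> q r; rewrite coprimepMr => -> ->.
move=> b bs; apply/coprimep_expl/coprimep_expr; rewrite coprimep_XsubC root_XsubC.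
by apply: contra nas => /eqP <-.
Qed.

(** * The Hermitian form restricted to a conic *)

Section Hermitian.
Variable k : closedFieldType.
Hypothesis char5 : 5%N \in [pchar k].
Local Notation J := (Jmx k).
Local Notation F := (pFrobenius_aut char5).
Local Notation FM := (map_mx F).

Lemma char5_neq0 n : (n%:R == 0 :> k) = (5 %| n)%N.
Proof. by rewrite (dvdn_pcharf char5). Qed.

Lemma n2 : 2%:R != 0 :> k. Proof. by rewrite char5_neq0. Qed.

(** Entry (i, j) is the coefficient at exponent (2 - i) + 5 (2 - j). These nine exponents are
    distinct, and 3, 4, 8, 9 are skipped. *)
Definition hpoly (M : 'M[k]_3) : {poly k} :=
  Poly [:: M o2 o2; M o1 o2; M o0 o2; 0; 0; M o2 o1; M o1 o1; M o0 o1; 0; 0;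
           M o2 o0; M o1 o0; M o0 o0].

(** The fifth power is a ring morphism in characteristic 5, so a change of frame acts on [H] by E H
    F(E)^T. *)
Lemma along_hermf_row (E H : 'M[k]_3) (w : 'rV[{poly k}]_3) :
  along (fun i => (w *m map_mx (@polyC k) E) 0 i) (hermf H) =
  (w *m map_mx (@polyC k) (E *m H *m (FM E)^T) *m (map_mx (fun x => x ^+ 5) w)^T) 0 0.
Proof.
have charP : 5%N \in [pchar {poly k}] by rewrite pchar_poly.
rewrite /along mmap_hermf.
have -> : map_mx (fun x : {poly k} => x ^+ 5) (w *m map_mx (@polyC k) E)
  = map_mx (fun x => x ^+ 5) w *m map_mx (@polyC k) (FM E).
  rewrite -[LHS]/(map_mx (pFrobenius_aut charP) _) map_mxM; congr (_ *m _).
  by apply/matrixP => i j; rewrite !mxE /= pFrobenius_autE -rmorphXn.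
set w5 := map_mx _ w; congr (_ 0 0).
by move: (FM E) => T; rewrite trmx_mul !map_mxM map_trmx !mulmxA.
Qed.

Lemma along_hermf (E H : 'M[k]_3) :
  along (conic_along E) (hermf H) = hpoly (E *m H *m (FM E)^T).
Proof.
rewrite along_hermf_row; move: (E *m H *m (FM E)^T) => M.
rewrite -mulmxA mxE sum3 !mxE !sum3 !mxE /= /hpoly.
by rewrite /= !cons_poly_def; ring.
Qed.

Section Gamma.
Variables (H : 'M[k]_3) (Hu : H \in unitmx) (g : k) (g0 : g != 0).
Variables (Gamma : plane_curve k 6).
Hypothesis form_Gamma : form Gamma = g *: hermf H.

Definition gram (E : 'M[k]_3) := E *m H *m (FM E)^T.

Lemma gramE E : gram E = E *m H *m (FM E)^T. Proof. by []. Qed.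

Lemma gram_mul (T E : 'M[k]_3) : gram (T *m E) = T *m gram E *m (FM T)^T.
Proof. by rewrite /gram map_mxM trmx_mul !mulmxA. Qed.

Lemma along_Gamma (E : 'M[k]_3) : along (conic_along E) (form Gamma) = g *: hpoly (gram E).
Proof. by rewrite form_Gamma alongZ along_hermf. Qed.

Lemma unit_FM (E : 'M[k]_3) : E \in unitmx -> FM E \in unitmx.
Proof. by move=> Eu; rewrite map_unitmx. Qed.

Lemma gram_unit (E : 'M[k]_3) : E \in unitmx -> gram E \in unitmx.
Proof. by move=> Eu; rewrite !unitmx_mul Eu Hu unitmx_tr unit_FM. Qed.

(** No two entries of [M] share an exponent, so each of them is read off as a coefficient. *)
Lemma hpoly_neq0 M : M \in unitmx -> hpoly M != 0.
Proof.
apply: contraTneq => h; have e n := congr1 (fun p : {poly k} => p`_n) h.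
have -> : M = 0.
  apply/matrixP; apply: I3_ind; apply: I3_ind; rewrite mxE.
  - by have := e 12%N; rewrite coef_Poly coef0.
  - by have := e 7%N; rewrite coef_Poly coef0.
  - by have := e 2%N; rewrite coef_Poly coef0.
  - by have := e 11%N; rewrite coef_Poly coef0.
  - by have := e 6%N; rewrite coef_Poly coef0.
  - by have := e 1%N; rewrite coef_Poly coef0.
  - by have := e 10%N; rewrite coef_Poly coef0.
  - by have := e 5%N; rewrite coef_Poly coef0.
  - by have := e 0%N; rewrite coef_Poly coef0.
by rewrite unitmxE det0 unitr0.
Qed.

Lemma ev_Gamma_along (E : 'M[k]_3) s : ev (form Gamma) (row3 (s ^+ 2) s 1 *m E) = g * (hpoly (gram E)).[s].
Proof.
rewrite -hornerZ -along_Gamma horner_along; apply: meval_eq => i.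
by rewrite /conic_along !row3_mulmx !mxE !hornerE.
Qed.

Lemma on_Gamma_pt (E : 'M[k]_3) s : E \in unitmx ->
  on_curve Gamma (curve_pt E s) <-> root (hpoly (gram E)) s.
Proof.
move=> Eu; rewrite on_curve_pt; last by rewrite row_mul_neq0 // row3_neq0 oner_neq0 !orbT.
rewrite ev_Gamma_along rootE; split=> [/eqP|/eqP->]; last by rewrite mulr0.
by rewrite mulf_eq0 (negbTE g0).
Qed.

Lemma order_mult (E : 'M[k]_3) n u : E \in unitmx -> hpoly (gram E) = 'X^n * u -> u.[0] != 0 ->
  intersection_multiplicity (conicE E) Gamma (curve_pt E 0) n.
Proof.
move=> Eu e u0; apply: (@intersection_multiplicity_order _ _ _ _ _ _ (conic_along E)
   (form_homog _) (conic_parametrizes n2 Eu) n (g *: u)).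
  by rewrite along_Gamma e scalerAr.
by rewrite hornerZ mulf_neq0.
Qed.

Lemma conicE_nonsingular (E : 'M[k]_3) : E \in unitmx -> nonsingular (conicE E).
Proof.
move=> Eu P _; have [c c0 e] := form_conicE n2 Eu.
have v0 : vec P *m conic_mx E != 0.
  apply: contra (vec_neq0 P) => /eqP h.
  have Su : conic_mx E \in unitmx.
    by rewrite !unitmx_mul unitmx_tr unitmx_inv Eu Jmx_unit ?n2.
  by rewrite -[vec P](mulmxK Su) h mul0mx.
have [i hi] : exists i, (vec P *m conic_mx E) 0 i != 0.
  apply/existsP; apply: contraR v0 => /existsPn h; apply/eqP/rowP => i.
  by rewrite [RHS]mxE; apply/eqP; have := h i; rewrite negbK.
exists i; rewrite e mderivZ mevalZ mulf_neq0 //.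
have -> : coords P = (fun j => vec P 0 j) by [].
rewrite mderiv_quadf tr_conic_mx mxE -mulr2n -mulr_natr.
by rewrite mulf_neq0 ?n2.
Qed.

Lemma nonsingular_mx (S : 'M[k]_3) (Q : plane_curve k 2) :
  S^T = S -> form Q = quadf S -> nonsingular Q -> S \in unitmx.
Proof.
move=> sS eQ ns; apply: unitmxP => v vS; apply/eqP; apply: contraT => v0.
have [c c0 ec] := vec_pt v0.
have h : vec (pt v) *m S = 0 by rewrite ec -scalemxAl vS scaler0.
have [|i] := ns (pt v).
  by rewrite on_curveE eQ ev_quadf h mul0mx mxE.
have -> : coords (pt v) = (fun j => vec (pt v) 0 j) by [].
by rewrite eQ mderiv_quadf sS h addr0 mxE eqxx.
Qed.

Lemma shift_unit (c : k) : shift c \in unitmx.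
Proof.
have := congr1 determinant (shift_J c); rewrite !det_mulmx det_tr => h.
rewrite unitmxE unitfE; apply: contraTneq (Jmx_unit n2) => d0.
by rewrite unitmxE -h d0 !mul0r unitr0.
Qed.

Lemma swap_unit : swap k \in unitmx.
Proof.
have := congr1 determinant (swap_J k); rewrite !det_mulmx det_tr => h.
rewrite unitmxE unitfE; apply: contraTneq (Jmx_unit n2) => d0.
by rewrite unitmxE -h d0 !mul0r unitr0.
Qed.

Lemma conicE_shift c (E : 'M[k]_3) : E \in unitmx -> conicE (shift c *m E) = conicE E.
Proof.
move=> Eu; apply: (conicE_mul (shift_unit c) Eu (oner_neq0 k)).
by rewrite scale1r shift_J.
Qed.

Lemma conicE_swap (E : 'M[k]_3) : E \in unitmx -> conicE (swap k *m E) = conicE E.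
Proof.
move=> Eu; apply: (conicE_mul swap_unit Eu (oner_neq0 k)).
by rewrite scale1r swap_J.
Qed.

Lemma curve_pt_shift c s (E : 'M[k]_3) : curve_pt (shift c *m E) s = curve_pt E (s + c).
Proof.
rewrite /curve_pt mulmxA; congr (pt (_ *m E)).
by apply/rowP; apply: I3_ind; rewrite row3_mulmx !mxE /=; ring.
Qed.

Lemma curve_pt_swap (E : 'M[k]_3) : curve_pt (swap k *m E) 0 = curve_oo E.
Proof.
rewrite /curve_pt /curve_oo mulmxA; congr (pt (_ *m E)).
by apply/rowP; apply: I3_ind; rewrite row3_mulmx !mxE /=; ring.
Qed.

Lemma hpoly_shift c (E : 'M[k]_3) : hpoly (gram (shift c *m E)) = hpoly (gram E) \Po ('X + c%:P).
Proof.
rewrite /gram -!along_hermf comp_along; apply: mmap_ext => i.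
rewrite /conic_along map_mxM mulmxA; set w := _ *m map_mx _ (shift c).
have -> : w = row3 (('X + c%:P) ^+ 2) ('X + c%:P) 1.
  apply/rowP; apply: I3_ind; rewrite row3_mulmx !mxE /= ?polyCM ?rmorphXn ?rmorph_nat ?polyC1 ?polyC0 /=; ring.
rewrite !row3_mulmx !mxE !rmorphD !rmorphM /= !comp_polyC !comp_polyX.
by [].
Qed.

(** The order of [hpoly] at 0 is an intersection multiplicity, so by uniqueness it equals the
    multiplicity 2 granted by tangency. *)
Lemma mult2_hpoly (E : 'M[k]_3) : E \in unitmx -> root (hpoly (gram E)) 0 ->
  (forall P, on_curve (conicE E) P -> on_curve Gamma P ->
       intersection_multiplicity (conicE E) Gamma P 2) ->
  exists2 u, hpoly (gram E) = 'X^2 * u & u.[0] != 0.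
Proof.
move=> Eu r0 h; have [n [u [e u0]]] := poly_order (hpoly_neq0 (gram_unit Eu)).
have := intersection_multiplicity_unique (order_mult Eu e u0).
have onQ : on_curve (conicE E) (curve_pt E 0).
  by apply/conicE_points; rewrite ?n2 //; left; exists 0.
have onG : on_curve Gamma (curve_pt E 0) by apply/on_Gamma_pt.
by move/(_ _ (h _ onQ onG)) => en; exists u; rewrite -?en.
Qed.

End Gamma.
End Hermitian.

(** * Every totally tangent conic has a unitary frame *)

Section TotallyTangent.
Variable k : closedFieldType.
Hypothesis char5 : 5%N \in [pchar k].
Local Notation J := (Jmx k).
Local Notation F := (pFrobenius_aut char5).
Local Notation FM := (map_mx F).
Local Notation n2 := (n2 char5).
Variables (H : 'M[k]_3) (Hu : H \in unitmx) (g : k) (g0 : g != 0).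
Variables (Gamma : plane_curve k 6).
Hypothesis form_Gamma : form Gamma = g *: hermf H.
Local Notation gram := (gram char5 H).

Lemma swap_entry (M : 'M[k]_3) i j :
  (swap k *m M *m (FM (swap k))^T) i j = M (rev_ord i) (rev_ord j).
Proof.
have -> : FM (swap k) = swap k.
  by apply/matrixP; apply: I3_ind; apply: I3_ind; rewrite !mxE /= ?rmorph0 ?rmorph1.
have sE (N : 'M[k]_3) i' j' : (swap k *m N) i' j' = N (rev_ord i') j'.
  rewrite mxE sum3; move: i'; apply: I3_ind; rewrite !mxE /= !(mul0r, mul1r, add0r, addr0);
    by congr (N _ _); apply: val_inj.
rewrite [LHS]mxE sum3 !sE; move: j; apply: I3_ind; rewrite !mxE /= !(mulr0, mulr1, add0r, addr0);
  by congr (M _ _); apply: val_inj.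
Qed.

(** In the application the pulled-back form is c X^2 h^2, and the three vanishing coefficients are
    its gaps at 3, 4 and 9. They kill the coefficients 1, 2 and 3 of [h] one after the other. *)
Lemma roots_quartic (rs : seq k) (h : {poly k}) : size rs = 4%N ->
  h = \prod_(a <- rs) ('X - a%:P) -> 0 \notin rs ->
  (h ^+ 2)`_1 = 0 -> (h ^+ 2)`_2 = 0 -> (h ^+ 2)`_7 = 0 ->
  exists2 b, b != 0 & h = 'X^4 + b%:P.
Proof.
move=> srs eh nr.
have sh : size h = 5%N by rewrite eh size_prod_XsubC srs.
have h4 : h`_4 = 1.
  by have /monicP := monic_prod_XsubC rs xpredT (fun a => a); rewrite -eh /lead_coef sh.
have h0 : h`_0 != 0.
  rewrite -horner_coef0 -rootE eh root_prod_XsubC; exact: nr.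
have hn i : (4 < i)%N -> h`_i = 0 by move=> lti; rewrite nth_default // sh.
rewrite !expr2 !coefM !big_ord_recl !big_ord0 /= /bump /= !addn0.
rewrite !(hn 5%N) // !(hn 6%N) // !(hn 7%N) // h4.
move=> e1 e2 e7.
have {}e1 : h`_0 * h`_1 + (h`_1 * h`_0 + 0) = 0 := e1.
have {}e2 : h`_0 * h`_2 + (h`_1 * h`_1 + (h`_2 * h`_0 + 0)) = 0 := e2.
have {}e7 : h`_0 * 0 + (h`_1 * 0 + (h`_2 * 0 + (h`_3 * 1 + (1 * h`_3
  + (0 * h`_2 + (0 * h`_1 + (0 * h`_0 + 0))))))) = 0 := e7.
have z1 : h`_1 = 0.
  apply/eqP; have/eqP : 2%:R * (h`_0 * h`_1) = 0 by rewrite -[RHS]e1; ring.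
  by rewrite !mulf_eq0 (negbTE h0) (negbTE n2).
have z2 : h`_2 = 0.
  apply/eqP; have/eqP : 2%:R * (h`_0 * h`_2) = 0 by rewrite -[RHS]e2 z1; ring.
  by rewrite !mulf_eq0 (negbTE h0) (negbTE n2).
have z3 : h`_3 = 0.
  apply/eqP; have/eqP : 2%:R * h`_3 = 0 by rewrite -[RHS]e7; ring.
  by rewrite !mulf_eq0 (negbTE n2).
exists h`_0 => //; apply/polyP => i; rewrite coefD coefXn coefC.
case: i => [|[|[|[|[|i]]]]]; rewrite /= ?addr0 ?add0r //.
by rewrite hn.
Qed.

Lemma stretch_unit (c : k) : c != 0 -> stretch c \in unitmx.
Proof.
move=> c0; have := congr1 determinant (stretch_J c); rewrite detZ !det_mulmx det_tr => h.
rewrite unitmxE unitfE; apply/eqP => d0; move/esym/eqP: h; rewrite d0 !mul0r.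
rewrite mulf_eq0 !expf_eq0 (negbTE c0) /= => /eqP dJ.
by have := Jmx_unit n2; rewrite unitmxE dJ unitr0.
Qed.

Definition stretch_d (c : k) (i : 'I_3) : k :=
  if val i is 0%N then c ^+ 2 else if val i is 1%N then c else 1.

Lemma stretch_entry c (M : 'M[k]_3) i j :
  (stretch c *m M *m (FM (stretch c))^T) i j = stretch_d c i * M i j * stretch_d c j ^+ 5.
Proof.
have sE (N : 'M[k]_3) i' j' : (stretch c *m N) i' j' = stretch_d c i' * N i' j'.
  by rewrite mxE sum3; move: i'; apply: I3_ind; rewrite !mxE /= !(mul0r, add0r, addr0).
rewrite [LHS]mxE sum3 !sE; move: j; apply: I3_ind;
  by rewrite !mxE /stretch_d /= ?rmorph0 ?rmorph1 ?pFrobenius_autE ?expr1n !(mulr0, mulr1, add0r, addr0).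
Qed.

(** Two contact points are put at parameters 0 and infinity. The form then has degree 10 with five
    double roots, one of them 0, so it is c X^2 h^2 with [h] a monic quartic; the gaps give h = X^4
    + b, and two scalings turn c X^2 (X^4 + b)^2 into X^2 (X^4 - 1)^2, whose matrix is J. *)
Lemma unitary_frame (Q : plane_curve k 2) : totally_tangent_conic Gamma Q ->
  exists2 E, E \in unitmx & gram E = J /\ Q = conicE E.
Proof.
case=> ns /card_ordP [f [f_inj fP]] tang.
have [S sS eQ] := quadf_dhomog n2 (form_homog Q).
have Su := nonsingular_mx sS eQ ns.
have fQ i : on_curve Q (f i) /\ on_curve Gamma (f i) by apply/fP; exists i.
pose i0 : 'I_6 := ord0; pose i1 : 'I_6 := lift ord0 ord0.
have ne10 : f i1 <> f i0 by move/f_inj/eqP; rewrite eq_sym (negbTE (neq_lift _ _)).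
have ev0 i : ev (quadf S) (vec (f i)) = 0 by rewrite -eQ; apply: (proj1 (fQ i)).
have [E Eu [eC eP eP']] := conic_frame n2 sS Su ne10 (ev0 i1) (ev0 i0).
rewrite -eQ curve_form in eC.
have /choice [s hs] (i : 'I_5) : exists s : k, f (lift ord0 i) = curve_pt E s.
  have [hQ _] := fQ (lift ord0 i).
  move: hQ; rewrite eC (conicE_points n2 Eu) => -[//|e].
  by move: e; rewrite -eP' => /f_inj/eqP; rewrite eq_sym (negbTE (neq_lift _ _)).
have s_inj : injective s.
  by move=> i j e; apply: (@lift_inj _ ord0); apply: f_inj; rewrite !hs e.
have s0 : s ord0 = 0 by apply: (curve_pt_inj Eu); rewrite -hs eP.
pose p := hpoly (gram E).
have pE : p = hpoly (gram E) by [].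
have tangE E' : E' \in unitmx -> conicE E' = Q -> forall P, on_curve (conicE E') P -> on_curve Gamma P ->
       intersection_multiplicity (conicE E') Gamma P 2.
  by move=> E'u ->.
(* Multiplicities are available at parameter 0 only; a translation of the parameter brings each
   affine contact point there. *)
have dvd_s a : a \in [seq s i | i <- enum 'I_5] -> ('X - a%:P) ^+ 2 %| p.
  case/mapP => i _ ->; set a' := s i.
  have E'u : shift a' *m E \in unitmx by rewrite unitmx_mul shift_unit.
  have cE' : conicE (shift a' *m E) = Q by rewrite conicE_shift.
  have r0 : root (hpoly (gram (shift a' *m E))) 0.
    apply/(on_Gamma_pt char5 g0 form_Gamma _ E'u); rewrite curve_pt_shift add0r -hs.
    by case: (fQ (lift ord0 i)).
  have [u eu _] := mult2_hpoly Hu g0 form_Gamma E'u r0 (tangE _ E'u cE').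
  have : p = hpoly (gram (shift a' *m E)) \Po ('X - a'%:P).
    by rewrite hpoly_shift // comp_polyXaddC_K.
  by rewrite eu comp_polyM comp_Xn_poly => ->; rewrite dvdp_mulr.
have us : uniq [seq s i | i <- enum 'I_5] by rewrite map_inj_uniq ?enum_uniq.
have := prod_XsubC2_dvd us dvd_s; rewrite prodrXl.
move: us; rewrite enum_ordSl /= s0 -map_comp.
set rs := [seq _ | i <- enum 'I_4] => /andP[nr _] /dvdpP [q eq].
have {}nr : 0 \notin rs by [].
have srs : size rs = 4%N by rewrite size_map size_enum_ord.
set h := \prod_(a <- rs) ('X - a%:P).
have {}eq : p = q * ('X * h) ^+ 2 by rewrite eq big_cons polyC0 subr0.
(* The sixth contact point is at infinity. After the swap, order exactly 2 at 0 says that the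
   coefficients 12 and 11 vanish and that the coefficient 10 does not. *)
have SEu : swap k *m E \in unitmx by rewrite unitmx_mul swap_unit.
have cSE : conicE (swap k *m E) = Q by rewrite conicE_swap.
have r0 : root (hpoly (gram (swap k *m E))) 0.
  apply/(on_Gamma_pt char5 g0 form_Gamma _ SEu); rewrite curve_pt_swap // -eP'.
  by case: (fQ i0).
have [u eu u0] := mult2_hpoly Hu g0 form_Gamma SEu r0 (tangE _ SEu cSE).
have coef_u n : (hpoly (gram (swap k *m E)))`_n = ('X^2 * u)`_n by rewrite eu.
have gramS i j : gram (swap k *m E) i j = gram E (rev_ord i) (rev_ord j).
  by rewrite gram_mul swap_entry.
have rev0 : rev_ord o0 = o2 by apply: val_inj.
have rev1 : rev_ord o1 = o1 by apply: val_inj.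
have rev2 : rev_ord o2 = o0 by apply: val_inj.
have p12 : gram E o0 o0 = 0.
  by have := coef_u 0%N; rewrite coef_Poly coefXnM /= gramS rev2.
have p11 : gram E o1 o0 = 0.
  by have := coef_u 1%N; rewrite coef_Poly coefXnM /= gramS rev2 rev1.
have p10 : gram E o2 o0 != 0.
  have := coef_u 2%N; rewrite coef_Poly coefXnM /= gramS rev2 rev0 => ->.
  by rewrite -horner_coef0.
have size_p : size p = 11%N.
  apply/eqP; rewrite eqn_leq; apply/andP; split.
    apply/leq_sizeP => j; rewrite coef_Poly.
    do 11?[case: j => [|j] //]; case: j => [|[|j]] /= _; rewrite ?p11 ?p12 ?nth_nil //.
  by rewrite ltnNge; apply/negP => /leq_sizeP/(_ _ (leqnn _))/eqP; rewrite coef_Poly /= (negbTE p10).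
have hm : h \is monic := monic_prod_XsubC _ _ _.
have Xhm : ('X * h) ^+ 2 \is monic by rewrite rpredX // rpredM // monicX.
have sXh : size (('X * h) ^+ 2) = 11%N.
  have Xh0 : 'X * h != 0 by rewrite mulf_neq0 ?polyX_eq0 ?monic_neq0.
  by rewrite expr2 size_mul // mulrC size_mulX ?monic_neq0 // size_prod_XsubC srs.
have q0 : q != 0 by apply/eqP => q0; move: size_p; rewrite eq q0 mul0r size_poly0.
have [c c0 eqc] : exists2 c, c != 0 & q = c%:P.
  have /eqP/size_poly1P [c c0 ->] : size q = 1%N; last by exists c.
  by move: size_p; rewrite eq size_Mmonic // sXh addnS /= addnC /= => -[].
have pc n : p`_n.+2 = c * (h ^+ 2)`_n.
  by rewrite eq eqc mul_polyC exprMn coefZ coefXnM /= subn2.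
have hcoef n : p`_n.+2 = 0 -> (h ^+ 2)`_n = 0.
  by rewrite pc => /eqP; rewrite mulf_eq0 (negbTE c0) => /eqP.
have [b b0 eh] : exists2 b, b != 0 & h = 'X^4 + b%:P.
  by apply: (roots_quartic srs) => //; apply: hcoef; rewrite coef_Poly.
have ep : p = c *: 'X^10 + (2%:R * b * c) *: 'X^6 + (c * b ^+ 2) *: 'X^2.
  rewrite eq eqc eh -!mul_polyC !polyCM ?polyC_exp (rmorph_nat (@polyC k)); ring.
have ent n : (hpoly (gram E))`_n = (c *: 'X^10 + (2%:R * b * c) *: 'X^6 + (c * b ^+ 2) *: 'X^2)`_n.
  by rewrite -ep.
(* Stretching by [l] turns X^4 + b into l^4 (X^4 - 1) and leaves the constant c l^10. Multiplying
   the frame by [mu] multiplies its Gram matrix by mu^(1 + 5), hence the sixth root. *)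
have [l el] := root_exists (- b) (isT : (0 < 4)%N).
have l0 : l != 0 by apply: contra b0 => /eqP l0; rewrite -oppr_eq0 -el l0 expr0n.
have bl : b = - l ^+ 4 by rewrite el opprK.
have [mu emu] := root_exists (c * l ^+ 10)^-1 (isT : (0 < 6)%N).
have cl0 : c * l ^+ 10 != 0 by rewrite mulf_neq0 // expf_neq0.
have mu0 : mu != 0 by apply: contra cl0 => /eqP mu0; rewrite -invr_eq0 -emu mu0 expr0n.
have LEu : stretch l *m E \in unitmx by rewrite unitmx_mul stretch_unit.
exists (mu *: (stretch l *m E)).
  by rewrite unitmxZ // unitfE.
split; last first.
  rewrite eC -mul_scalar_mx (@conicE_mul k _ (stretch l *m E) (mu ^+ 2)) //.
  - by rewrite (@conicE_mul k _ E (l ^+ 2)) ?stretch_unit ?expf_neq0 // stretch_J.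
  - by rewrite -scalemx1 unitmxZ ?unitmx1 // unitfE.
  - by rewrite expf_neq0.
  - by rewrite tr_scalar_mx mul_scalar_mx mul_mx_scalar scalerA expr2.
have -> : gram (mu *: (stretch l *m E)) = mu ^+ 6 *: gram (stretch l *m E).
  by rewrite !gramE map_mxZ linearZ /= -!scalemxAl -scalemxAr scalerA pFrobenius_autE -exprS.
rewrite gram_mul emu; apply: (scalerI cl0); rewrite scalerA divff // scale1r.
move: ent p12 p11; move: (gram E) => M en p12 p11.
apply/matrixP => i j; rewrite stretch_entry [RHS]mxE; move: i j; apply: I3_ind; apply: I3_ind; rewrite !mxE /stretch_d /=.
- by rewrite p12 !mulr0 mul0r.
- by have := en 7%N; rewrite coef_Poly /= !coefE /= !mulr0 !addr0 => ->; rewrite !(mulr0, mul0r).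
- have := en 2%N; rewrite coef_Poly /= !coefE /= !mulr0 !add0r mulr1 => ->; rewrite bl; ring.
- by rewrite p11 !mulr0 mul0r.
- have := en 6%N; rewrite coef_Poly /= !coefE /= !mulr0 !add0r addr0 mulr1 => ->; rewrite bl; ring.
- by have := en 1%N; rewrite coef_Poly /= !coefE /= !mulr0 !addr0 => ->; rewrite !(mulr0, mul0r).
- have := en 10%N; rewrite coef_Poly /= !coefE /= !mulr0 !addr0 mulr1 => ->; ring.
- by have := en 5%N; rewrite coef_Poly /= !coefE /= !mulr0 !addr0 => ->; rewrite !(mulr0, mul0r).
- by have := en 0%N; rewrite coef_Poly /= !coefE /= !mulr0 !addr0 => ->; rewrite !(mulr0, mul0r).
Qed.

End TotallyTangent.

(** * Contact points, tangents and secants of a unitary frame *)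

Section UnitaryFrames.
Variable k : closedFieldType.
Hypothesis char5 : 5%N \in [pchar k].
Local Notation J := (Jmx k).
Local Notation F := (pFrobenius_aut char5).
Local Notation FM := (map_mx F).
Local Notation n2 := (n2 char5).
Variables (H : 'M[k]_3) (Hu : H \in unitmx) (g : k) (g0 : g != 0).
Variables (Gamma : plane_curve k 6).
Hypothesis form_Gamma : form Gamma = g *: hermf H.
Local Notation gram := (gram char5 H).

Definition unitary_frame_of (E : 'M[k]_3) := E \in unitmx /\ gram E = J.

Lemma unitary_mul T E : unitary_frame_of E -> T \in unitmx -> T *m J *m (FM T)^T = J ->
  unitary_frame_of (T *m E).
Proof. by move=> [Eu eE] Tu eT; split; rewrite ?unitmx_mul ?Tu // gram_mul eE. Qed.

Lemma unitary_shift (c : k) E : c ^+ 5 = c -> unitary_frame_of E -> unitary_frame_of (shift c *m E).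
Proof.
move=> c5 uE; apply: unitary_mul; rewrite ?shift_unit //.
rewrite (_ : FM (shift c) = shift c) ?shift_J //.
apply/matrixP; apply: I3_ind; apply: I3_ind;
  by rewrite !mxE /= ?rmorph0 ?rmorph1 ?rmorphM ?rmorphXn ?rmorph_nat /= ?pFrobenius_autE ?c5.
Qed.

Lemma unitary_swap E : unitary_frame_of E -> unitary_frame_of (swap k *m E).
Proof.
move=> uE; apply: unitary_mul; rewrite ?swap_unit //.
rewrite (_ : FM (swap k) = swap k) ?swap_J //.
by apply/matrixP; apply: I3_ind; apply: I3_ind; rewrite !mxE /= ?rmorph0 ?rmorph1.
Qed.

Lemma hpoly_J : hpoly J = 'X^2 * ('X^8 - 2%:R *: 'X^4 + 1).
Proof.
rewrite /hpoly !mxE /= !cons_poly_def -mul_polyC !rmorphN !(rmorph_nat (@polyC k)) !polyC1 !polyC0.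
by ring.
Qed.

(** The six points of P^1(F_5) on the conic: index 0 stands for infinity and index s + 1 for the
    parameter s. *)
Definition hexv (i : 'I_6) : 'rV[k]_3 :=
  if val i is s.+1 then row3 (s%:R ^+ 2) s%:R 1 else row3 1 0 0.
Definition hexpt (E : 'M[k]_3) (i : 'I_6) : point k := pt (hexv i *m E).

Lemma hexv_neq0 i : hexv i != 0.
Proof. by case: i => -[|s] lts; rewrite /hexv /= row3_neq0 oner_neq0 ?orbT. Qed.

Lemma natr_F5 n : (n%:R : k) ^+ 5 = n%:R.
Proof. by rewrite -(pFrobenius_autE char5) rmorph_nat. Qed.

Lemma F5_natr (s : k) : s ^+ 5 = s -> exists2 n, (n < 5)%N & s = n%:R.
Proof.
move=> s5; have h5 : 5%:R = 0 :> k by apply/eqP; rewrite (char5_neq0 char5).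
have /eqP : s * ((s - 1) * ((s - 2%:R) * ((s - 3%:R) * (s - 4%:R)))) = 0.
  (* The expanded product is s^5 - 10 s^4 + 35 s^3 - 50 s^2 + 24 s, which is s^5 - s modulo 5. *)
  have -> : s * ((s - 1) * ((s - 2%:R) * ((s - 3%:R) * (s - 4%:R)))) =
     (s ^+ 5 - s) + 5%:R * (- 2%:R * s ^+ 4 + 7%:R * s ^+ 3 - 10%:R * s ^+ 2 + 5%:R * s) by ring.
  by rewrite s5 subrr h5 mul0r addr0.
rewrite !mulf_eq0 !subr_eq0 => /or4P[/eqP->|/eqP->|/eqP->|/orP[/eqP->|/eqP->]];
  [exists 0%N | exists 1%N | exists 2%N | exists 3%N | exists 4%N] => //.
Qed.

Lemma natr_inj5 n m : (n < 5)%N -> (m < 5)%N -> n%:R = m%:R :> k -> n = m.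
Proof.
wlog le_nm : n m / (n <= m)%N.
  by move=> h l1 l2 e; case/orP: (leq_total n m) => le; [|apply/esym]; apply: h.
move=> _ lm /esym/eqP; rewrite -subr_eq0 -natrB // (char5_neq0 char5) => /dvdnP [q].
by move: le_nm lm; clear -n m q; lia.
Qed.

Lemma hexv_root (s : k) : (hpoly J).[s] = 0 <-> s ^+ 5 = s.
Proof.
have -> : (hpoly J).[s] = (s ^+ 5 - s) ^+ 2 by rewrite hpoly_J !hornerE /=; ring.
by split=> [/eqP|->]; rewrite ?sqrf_eq0 ?subr_eq0 ?subrr ?expr0n // => /eqP.
Qed.

Section Frame.
Variables (E : 'M[k]_3) (uE : unitary_frame_of E).
Let Eu := proj1 uE.

Lemma conic_meets P :
  on_curve (conicE E) P /\ on_curve Gamma P <-> exists i, P = hexpt E i.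
Proof.
have root_E s : on_curve Gamma (curve_pt E s) <-> s ^+ 5 = s.
  rewrite (on_Gamma_pt char5 g0 form_Gamma s Eu) -hexv_root (proj2 uE).
  by split=> /rootP.
have oo_E : on_curve Gamma (curve_oo E).
  rewrite -curve_pt_swap; have [SEu eS] := unitary_swap uE.
  apply/(on_Gamma_pt char5 g0 form_Gamma _ SEu); rewrite eS.
  by apply/rootP/hexv_root; rewrite expr0n.
split.
  rewrite (conicE_points n2 Eu) => -[[[s ->]|->]]; last by exists ord0.
  by move=> /root_E/F5_natr [n ltn ->]; exists (Ordinal (ltn : (n.+1 < 6)%N)).
move=> [[[|s] lts] ->].
  by split=> //; apply/(conicE_points n2 Eu); right.
split; first by apply/(conicE_points n2 Eu); left; exists s%:R.
by apply/root_E; rewrite natr_F5.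
Qed.

Lemma hexpt_inj : injective (hexpt E).
Proof.
move=> [[|i] lti] [[|j] ltj] e; apply: val_inj => //=.
- by case: (curve_pt_oo Eu (esym e)).
- by case: (curve_pt_oo Eu e).
- by have /(natr_inj5 lti ltj) -> := curve_pt_inj Eu e.
Qed.

(** Translations by F_5 and the inversion act transitively on P^1(F_5) and preserve unitary frames,
    so local computations are only made at parameter 0. *)
Lemma hexpt_reframe i : exists E', [/\ unitary_frame_of E', conicE E' = conicE E &
  hexpt E i = curve_pt E' 0].
Proof.
case: i => [[|s] lts].
  exists (swap k *m E); split; [exact: unitary_swap | exact: conicE_swap|].
  by rewrite curve_pt_swap.
exists (shift s%:R *m E); split; [apply: unitary_shift => //; exact: natr_F5|exact: conicE_shift|].
by rewrite curve_pt_shift add0r.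
Qed.

Lemma unitary_mult2 : intersection_multiplicity (conicE E) Gamma (curve_pt E 0) 2.
Proof.
apply: (order_mult g0 form_Gamma Eu (u := 'X^8 - 2%:R *: 'X^4 + 1)).
  by rewrite (proj2 uE) hpoly_J.
by rewrite !hornerE /= !expr0n /= mulr0 subr0 add0r oner_neq0.
Qed.

(** Fifth powers have zero derivative, so only the linear factor of each term X_a X_b^5
    contributes. *)
Lemma mderiv_hermf (A : 'M[k]_3) i (v : 'rV[k]_3) :
  ((hermf A)^`M(i)).@[fun j => v 0 j] = (A *m (FM v)^T) i 0.
Proof.
pose D := @mderiv 3 k i; pose V := @meval 3 k (fun j => v 0 j).
have D5 (p : {mpoly k[3]}) : D (p ^+ 5) = 0.
  have h5 : 5%:R = 0 :> {mpoly k[3]}.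
    have /eqP h5 : 5%:R == 0 :> k by rewrite (char5_neq0 char5).
    by rewrite -(rmorph_nat (@mpolyC 3 k)) h5 rmorph0.
  rewrite /D !exprS expr0 !mderivM mderivC.
  have -> : forall (a b : {mpoly k[3]}), a * (p * (p * (p * (p * 1)))) + p * (a * (p * (p * (p * 1)))
     + p * (a * (p * (p * 1)) + p * (a * (p * 1) + p * (a * 1 + p * b)))) = 5%:R * a * p ^+ 4 + p ^+ 5 * b.
    by move=> a b; ring.
  by rewrite h5 !mul0r mulr0 addr0.
transitivity (\sum_a (a == i)%:R * \sum_b A a b * v 0 b ^+ 5).
  rewrite /hermf (raddf_sum D) (raddf_sum V); apply: eq_bigr => a _.
  rewrite /= (raddf_sum D) (raddf_sum V) mulr_sumr; apply: eq_bigr => b _.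
  rewrite /= /D mderivZ mderivM -/D D5 mulr0 addr0 /D mderivXU /V mevalZ mevalM.
  by rewrite rmorph_nat rmorphXn /= mevalXU mulrCA.
rewrite (bigD1 i) //= [X in _ + X]big1 => [|a /negbTE ->]; last by rewrite mul0r.
by rewrite eqxx mul1r addr0 mxE; apply: eq_bigr => b _; rewrite !mxE.
Qed.

(** At the third frame vector the gradient H F(v)^T is proportional to E^-1 J (0,0,1)^T, the first
    coordinate form. On the line where that form vanishes, parametrized by (0, s, 1), the Hermitian
    form is -2 s^6. *)
Lemma weierstrass_frame : weierstrass_point Gamma (curve_pt E 0).
Proof.
have v0 : row3 (0 ^+ 2 : k) 0 1 != 0 by rewrite row3_neq0 oner_neq0 !orbT.
have [c0 c0n ec] := vec_pt (row_mul_neq0 Eu v0).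
exists (lineE E); last first.
  apply: (@intersection_multiplicity_order _ _ _ _ _ _ (line_along E)
    (form_homog _) (line_parametrizes Eu) 6 (- 2%:R * g)%:P).
    rewrite form_Gamma alongZ (along_hermf_row char5) -/(gram E) (proj2 uE) map_Jmx Jmx_form.
    rewrite !mxE /= expr0n /= mul0r mulr0 add0r addr0 -mul_polyC polyCM rmorphN (rmorph_nat (@polyC k)).
    by ring.
  by rewrite hornerC mulf_neq0 // oppr_eq0 n2.
split.
  by apply/(on_Gamma_pt char5 g0 form_Gamma _ Eu)/rootP; rewrite (proj2 uE); apply/hexv_root; rewrite expr0n.
have [c cn ->] := form_lineE Eu.
have gc0 : g * c0 ^+ 5 != 0 by rewrite mulf_neq0 // expf_neq0.
exists (c / (g * c0 ^+ 5)); first by rewrite mulf_neq0 // invr_eq0.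
suff -> : tangent_form Gamma (curve_pt E 0) = (g * c0 ^+ 5) *: coordf E o0.
  by rewrite scalerA divfK.
rewrite /tangent_form /coordf /linf scaler_sumr; apply: eq_bigr => i _.
rewrite scalerA mxE; congr (_ *: _); rewrite form_Gamma mderivZ mevalZ -mulrA; congr (_ * _).
rewrite [LHS](mderiv_hermf H i (vec (curve_pt E 0))) ec map_mxZ linearZ /= -scalemxAr mxE.
rewrite pFrobenius_autE; congr (_ * _); rewrite map_mxM trmx_mul mulmxA.
have -> : H *m (FM E)^T = invmx E *m J by rewrite -(proj2 uE) gramE -!mulmxA mulKmx.
by rewrite Jmx_entry !mxE /= expr0n /= !rmorph0 rmorph1 !(mulr0, mulr1, subr0, addr0).
Qed.

End Frame.

Lemma totally_tangentP Q :
  totally_tangent_conic Gamma Q <-> exists2 E, unitary_frame_of E & Q = conicE E.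
Proof.
split=> [/(unitary_frame char5 Hu g0 form_Gamma) [E Eu [eE ->]]|[E uE ->]]; first by exists E.
split; first exact: conicE_nonsingular (proj1 uE).
  apply/card_ordP; exists (hexpt E); split; first exact: hexpt_inj.
  move=> P; split; first by case/(conic_meets uE) => i ->; exists i.
  by case=> i <-; apply/(conic_meets uE); exists i.
move=> P QP GP; have /(conic_meets uE) [i ->] := conj QP GP.
by have [E' [uE' <- ->]] := hexpt_reframe uE i; apply: unitary_mult2.
Qed.

Lemma weierstrass_hexpt E i : unitary_frame_of E -> weierstrass_point Gamma (hexpt E i).
Proof.
by move=> uE; have [E' [uE' _ ->]] := hexpt_reframe uE i; apply: weierstrass_frame.
Qed.

(** Contact points are Weierstrass points, so every line through two of them is automatically a
    special secant. *)
Lemma secants_ofP E L : unitary_frame_of E ->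
  secants_of Gamma (conicE E) L <->
  exists i j, [/\ i <> j, on_curve L (hexpt E i) & on_curve L (hexpt E j)].
Proof.
move=> uE; split.
  case=> _ [P [P' [neP /(conic_meets uE) [i ei] /(conic_meets uE) [j ej]]]].
  rewrite ei ej => Li Lj; exists i, j; split=> // eij.
  by apply: neP; rewrite ei ej eij.
case=> i [j [nij Li Lj]].
have neP : hexpt E i <> hexpt E j by move/(hexpt_inj uE).
split; first by exists (hexpt E i), (hexpt E j); split=> //; apply: weierstrass_hexpt.
by exists (hexpt E i), (hexpt E j); split=> //; apply/(conic_meets uE); eexists.
Qed.

End UnitaryFrames.

Lemma card_image_ord (T U : Type) (f : T -> U) (A : set T) n :
  {in A &, injective f} -> (f @` A #= `I_n) <-> (A #= `I_n).
Proof.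
move=> fi; have e := inj_card_eq fi; split=> h; last exact: card_eq_trans e h.
by apply: card_eq_trans h; rewrite card_eq_sym.
Qed.

(** * The unitary group on points, lines and conics *)

Section Action.
Variable k : closedFieldType.
Hypothesis char5 : 5%N \in [pchar k].
Local Notation J := (Jmx k).
Local Notation F := (pFrobenius_aut char5).
Local Notation FM := (map_mx F).
Local Notation n2 := (n2 char5).
Variables (H : 'M[k]_3) (Hu : H \in unitmx) (g : k) (g0 : g != 0).
Variables (Gamma : plane_curve k 6).
Hypothesis form_Gamma : form Gamma = g *: hermf H.
Local Notation uframe := (unitary_frame_of char5 H).

Definition isometry (G : 'M[k]_3) := G \in unitmx /\ G *m H *m (FM G)^T = H.

Lemma isometry_inv G : isometry G -> isometry (invmx G).
Proof.
move=> [Gu e]; split; first by rewrite unitmx_inv.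
rewrite -[H in LHS]e map_invmx !mulmxA mulVmx // mul1mx -mulmxA -trmx_mul mulVmx ?map_unitmx //.
by rewrite trmx1 mulmx1.
Qed.

Lemma uframe_isometry E G : uframe E -> isometry G -> uframe (E *m G).
Proof.
move=> [Eu eE] [Gu eG]; split; first by rewrite unitmx_mul Eu.
rewrite -[RHS]eE /gram map_mxM trmx_mul !mulmxA.
by rewrite -(mulmxA E) -(mulmxA E) eG.
Qed.

Definition actp (G : 'M[k]_3) (P : point k) := pt (vec P *m G).

Lemma actp_pt G v : G \in unitmx -> v != 0 -> actp G (pt v) = pt (v *m G).
Proof.
by move=> Gu v0; rewrite /actp; have [c c0 ->] := vec_pt v0; rewrite -scalemxAl ptZ.
Qed.

Lemma actpK G : G \in unitmx -> cancel (actp G) (actp (invmx G)).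
Proof.
move=> Gu P; rewrite [actp G P]/actp actp_pt ?unitmx_inv ?row_mul_neq0 ?vec_neq0 //.
by rewrite mulmxK // pt_vec.
Qed.

Lemma actpVK G : G \in unitmx -> cancel (actp (invmx G)) (actp G).
Proof.
by move=> Gu P; have := @actpK (invmx G) _ P; rewrite invmxK unitmx_inv => ->.
Qed.

Lemma actp_frame G E y : G \in unitmx -> E \in unitmx -> y != 0 ->
  actp G (pt (y *m E)) = pt (y *m (E *m G)).
Proof. by move=> Gu Eu y0; rewrite actp_pt ?row_mul_neq0 // mulmxA. Qed.

Lemma on_conicE_act G E P : G \in unitmx -> E \in unitmx ->
  on_curve (conicE (E *m G)) (actp G P) <-> on_curve (conicE E) P.
Proof.
move=> Gu Eu; have [y y0 ->] := pt_frame Eu P.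
have EGu : E *m G \in unitmx by rewrite unitmx_mul Eu.
by rewrite (actp_frame Gu Eu y0) (on_conicE n2 Eu y0) (on_conicE n2 EGu y0).
Qed.

Definition lcoef (L : plane_curve k 1) : 'rV[k]_3 := projT1 (cid (linf_dhomog (form_homog L))).
Lemma lcoefE L : form L = linf (lcoef L).
Proof. by rewrite /lcoef; case: cid. Qed.
(** Points are row vectors multiplied by [G], so coefficients of lines transform
    contragrediently. *)
Definition actl (G : 'M[k]_3) L : plane_curve k 1 := curve 1 (linf (lcoef L *m (invmx G)^T)).

Lemma linf_eq0 (c : 'rV[k]_3) : (linf c == 0) = (c == 0).
Proof.
apply/eqP/eqP => [h|->]; last by rewrite /linf big1 // => i _; rewrite mxE scale0r.
by apply: linf_inj; rewrite h /linf big1 // => i _; rewrite mxE scale0r.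
Qed.

Lemma lcoef_neq0 L : lcoef L != 0.
Proof. by rewrite -linf_eq0 -lcoefE form_neq0. Qed.

Lemma form_actl G L : G \in unitmx ->
  exists2 c, c != 0 & form (actl G L) = c *: linf (lcoef L *m (invmx G)^T).
Proof.
move=> Gu; apply: form_curve; first exact: linf_homog.
by rewrite linf_eq0 row_mul_neq0 ?unitmx_tr ?unitmx_inv ?lcoef_neq0.
Qed.

Lemma on_actl G L P : G \in unitmx -> on_curve (actl G L) (actp G P) <-> on_curve L P.
Proof.
move=> Gu; rewrite /actp on_curve_pt ?row_mul_neq0 ?vec_neq0 // on_curveE.
have [c c0 ->] := form_actl L Gu; rewrite (lcoefE L) /ev mevalZ -!/(ev _ _) !ev_linf.
rewrite trmx_mul trmxK mulmxA mulmxK //; split=> [/eqP|->]; last by rewrite mulr0.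
by rewrite mulf_eq0 (negbTE c0) => /eqP.
Qed.

Lemma actlK G : G \in unitmx -> cancel (actl G) (actl (invmx G)).
Proof.
move=> Gu L; have [c c0 e] := form_actl L Gu.
have -> : actl (invmx G) (actl G L) = curve 1 (linf (c *: lcoef L)).
  congr (curve _ (linf _)); have -> : lcoef (actl G L) = c *: (lcoef L *m (invmx G)^T).
    by apply: linf_inj; rewrite -lcoefE e linfZ.
  by rewrite invmxK -scalemxAl -mulmxA -trmx_mul mulmxV // trmx1 mulmx1.
by rewrite linfZ curveZ ?linf_homog // -lcoefE curve_form.
Qed.

Lemma hexpt_act G E i : G \in unitmx -> E \in unitmx -> actp G (hexpt E i) = hexpt (E *m G) i.
Proof. by move=> Gu Eu; rewrite /hexpt actp_frame // hexv_neq0. Qed.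

Lemma secants_of_act G E L : isometry G -> uframe E ->
  secants_of Gamma (conicE (E *m G)) (actl G L) <-> secants_of Gamma (conicE E) L.
Proof.
move=> iG uE; have uEG := uframe_isometry uE iG; have [Gu _] := iG; have [Eu _] := uE.
rewrite (secants_ofP g0 form_Gamma _ uEG) (secants_ofP g0 form_Gamma _ uE).
by split=> -[i [j [nij Li Lj]]]; exists i, j; split=> //;
  move: Li Lj; rewrite -!hexpt_act // !on_actl.
Qed.

Lemma conicE_eq (E E' : 'M[k]_3) : E \in unitmx -> E' \in unitmx ->
  conicE E = conicE E' <-> exists2 c, c != 0 & conic_mx E = c *: conic_mx E'.
Proof.
move=> Eu E'u; split; last first.
  by case=> c c0 e; rewrite /conicE e quadfZ curveZ ?quadf_homog.
move=> e; have [c c0 h] := form_conicE n2 Eu; have [c' c'0 h'] := form_conicE n2 E'u.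
exists (c^-1 * c'); first by rewrite mulf_neq0 ?invr_eq0.
apply: (quadf_inj n2); rewrite ?tr_conic_mx ?linearZ /= ?tr_conic_mx //.
by rewrite quadfZ -scalerA -h' -e h scalerA mulVf // scale1r.
Qed.

Lemma conic_mx_mul (E G : 'M[k]_3) : E \in unitmx -> G \in unitmx ->
  conic_mx (E *m G) = invmx G *m conic_mx E *m (invmx G)^T.
Proof.
move=> Eu Gu; have EGu : E *m G \in unitmx by rewrite unitmx_mul Eu.
have -> : conic_mx (E *m G) = (invmx G *m invmx E) *m J *m (invmx G *m invmx E)^T.
  rewrite /conic_mx (_ : invmx (E *m G) = invmx G *m invmx E) //.
  apply: (can_inj (mulKmx EGu)); rewrite mulmxV // -mulmxA (mulmxA G) mulmxV //.
  by rewrite mul1mx mulmxV.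
by rewrite trmx_mul /conic_mx !mulmxA.
Qed.

Lemma conicE_mulr (E E' G : 'M[k]_3) : E \in unitmx -> E' \in unitmx -> G \in unitmx ->
  conicE E = conicE E' -> conicE (E *m G) = conicE (E' *m G).
Proof.
move=> Eu E'u Gu /(conicE_eq Eu E'u) [c c0 e].
apply/conicE_eq; rewrite ?unitmx_mul ?Eu ?E'u //; exists c => //.
by rewrite !conic_mx_mul // e -scalemxAr -scalemxAl.
Qed.

Lemma cap2_act G E E' : G \in unitmx -> E \in unitmx -> E' \in unitmx ->
  on_curve (conicE (E *m G)) `&` on_curve (conicE (E' *m G)) =
  actp G @` (on_curve (conicE E) `&` on_curve (conicE E')).
Proof.
move=> Gu Eu E'u; apply/seteqP; split=> P; last first.
  move=> [P' [h1 h2] <-].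
  by split; [apply/(on_conicE_act P' Gu Eu) | apply/(on_conicE_act P' Gu E'u)].
set P' := actp (invmx G) P; have <- : actp G P' = P by apply: actpVK.
by case=> /(on_conicE_act P' Gu Eu) h1 /(on_conicE_act P' Gu E'u) h2; exists P'.
Qed.

Lemma secants_cap_act G E E' : isometry G -> uframe E -> uframe E' ->
  secants_of Gamma (conicE (E *m G)) `&` secants_of Gamma (conicE (E' *m G)) =
  actl G @` (secants_of Gamma (conicE E) `&` secants_of Gamma (conicE E')).
Proof.
move=> iG uE uE'; have [Gu _] := iG; apply/seteqP; split=> L; last first.
  move=> [L' [h1 h2] <-].
  by split; [apply/(secants_of_act L' iG uE) | apply/(secants_of_act L' iG uE')].
set L' := actl (invmx G) L; have <- : actl G L' = L.
  by have := @actlK (invmx G); rewrite unitmx_inv invmxK; apply.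
by case=> /(secants_of_act L' iG uE) h1 /(secants_of_act L' iG uE') h2; exists L'.
Qed.

Lemma adjacent_act G E E' : isometry G -> uframe E -> uframe E' ->
  adjacent Gamma (conicE E) (conicE E') ->
  adjacent Gamma (conicE (E *m G)) (conicE (E' *m G)).
Proof.
move=> iG uE uE' [_ _ ne c4 c3]; have [Gu _] := iG; have [Eu _] := uE; have [E'u _] := uE'.
split.
- by apply/(totally_tangentP char5 Hu g0 form_Gamma); exists (E *m G); first exact: uframe_isometry.
- by apply/(totally_tangentP char5 Hu g0 form_Gamma); exists (E' *m G); first exact: uframe_isometry.
- move=> e; apply: ne; rewrite -[E](mulmxK Gu) -[E'](mulmxK Gu).
  by apply: conicE_mulr e; rewrite ?unitmx_mul ?Eu ?E'u ?unitmx_inv.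
- rewrite (cap2_act Gu Eu E'u); apply: (proj2 (card_image_ord _ _) c4).
  by move=> x y _ _; apply: (can_inj (actpK Gu)).
- rewrite (secants_cap_act iG uE uE'); apply: (proj2 (card_image_ord _ _) c3).
  by move=> x y _ _; apply: (can_inj (actlK Gu)).
Qed.

Lemma sym_of_conic (Q : plane_curve k 2) : exists S, S^T = S /\ form Q = quadf S.
Proof. by have [S h1 h2] := quadf_dhomog n2 (form_homog Q); exists S. Qed.
Definition qcoef (Q : plane_curve k 2) : 'M[k]_3 := projT1 (cid (sym_of_conic Q)).
(** Defined on coefficient matrices because a conic carries no distinguished frame; on [conicE E] it
    amounts to replacing [E] by E G. *)
Definition actq (G : 'M[k]_3) (Q : plane_curve k 2) : plane_curve k 2 :=
  curve 2 (quadf (invmx G *m qcoef Q *m (invmx G)^T)).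

Lemma actq_conicE G E : G \in unitmx -> E \in unitmx -> actq G (conicE E) = conicE (E *m G).
Proof.
move=> Gu Eu; rewrite /actq /qcoef; case: cid => S /= [sS eS].
have [c c0 h] := form_conicE n2 Eu.
have -> : S = c *: conic_mx E.
  by apply: (quadf_inj n2); rewrite ?linearZ /= ?tr_conic_mx // quadfZ -h.
by rewrite -scalemxAr -scalemxAl -conic_mx_mul // quadfZ curveZ ?quadf_homog.
Qed.

Local Notation TT := (totally_tangent_conic Gamma).
Local Notation adj := (adjacent Gamma).

(** Adjacency is only asked to be preserved, not reflected; the converse comes from applying the
    same statement to the inverse isometry. *)
Definition automorphism (f f' : plane_curve k 2 -> plane_curve k 2) : Prop :=
  (forall Q, TT Q -> TT (f Q) /\ f' (f Q) = Q) /\ (forall Q Q', adj Q Q' -> adj (f Q) (f Q')).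

Lemma actq_automorphism G : isometry G -> automorphism (actq G) (actq (invmx G)).
Proof.
move=> iG; have [Gu _] := iG; have ttP := totally_tangentP char5 Hu g0 form_Gamma.
split.
- move=> Q /ttP [E uE ->]; have [Eu _] := uE; rewrite (actq_conicE Gu Eu); split.
    by apply/ttP; exists (E *m G); first exact: uframe_isometry.
  have EGu : E *m G \in unitmx by rewrite unitmx_mul Eu.
  by rewrite (@actq_conicE (invmx G) _ _ EGu) ?unitmx_inv // mulmxK.
- move=> Q Q' a; have [/ttP [E uE eQ] /ttP [E' uE' eQ'] _ _ _] := a.
  rewrite eQ eQ' (actq_conicE Gu (proj1 uE)) (actq_conicE Gu (proj1 uE')).
  by apply: (adjacent_act iG uE uE'); rewrite -eQ -eQ'.
Qed.

End Action.

(** * The finite model over F_25 *)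

Section FiniteModel.
Local Open Scope nat_scope.

(** Plain constructors make all arithmetic a matter of pattern matching, fast enough for
    enumerations over thousands of conics. *)
Variant F5 := c0 | c1 | c2 | c3 | c4.
Definition succ5 x := match x with c0 => c1 | c1 => c2 | c2 => c3 | c3 => c4 | c4 => c0 end.
Definition pred5 x := match x with c0 => c4 | c1 => c0 | c2 => c1 | c3 => c2 | c4 => c3 end.
Definition opp5 x := match x with c0 => c0 | c1 => c4 | c2 => c3 | c3 => c2 | c4 => c1 end.
Definition add5 x y :=
  match x with
  | c0 => y | c1 => succ5 y | c2 => succ5 (succ5 y) | c3 => pred5 (pred5 y) | c4 => pred5 y
  end.
Definition mul5 x y :=
  match x with
  | c0 => c0 | c1 => y | c2 => add5 y y | c3 => opp5 (add5 y y) | c4 => opp5 y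
  end.
Definition inv5 x := match x with c0 => c0 | c1 => c1 | c2 => c3 | c3 => c2 | c4 => c4 end.
Definition zero5 x := if x is c0 then true else false.

(* [Elt a b] is a + b eps with eps^2 = 2. *)
Variant F25 := Elt of F5 & F5.
Definition add x y := let: Elt a b := x in let: Elt c d := y in Elt (add5 a c) (add5 b d).
Definition opp x := let: Elt a b := x in Elt (opp5 a) (opp5 b).
Definition conjF x := let: Elt a b := x in Elt a (opp5 b).
Definition mul x y :=
  let: Elt a b := x in let: Elt c d := y in
  Elt (add5 (mul5 a c) (mul5 c2 (mul5 b d))) (add5 (mul5 a d) (mul5 b c)).
(** The norm a^2 - 2 b^2 to F_5, with 3 for -2; the nonresidue 2 makes the quadratic extension a
    field. *)
Definition norm5 x := let: Elt a b := x in add5 (mul5 a a) (mul5 c3 (mul5 b b)).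
Definition scal5 c x := let: Elt a b := x in Elt (mul5 c a) (mul5 c b).
Definition inv x := scal5 (inv5 (norm5 x)) (conjF x).
Definition is0 x := let: Elt a b := x in zero5 a && zero5 b.
Definition eqF x y := is0 (add x (opp y)).
Definition of5 c := Elt c c0.
Definition zero := of5 c0.
Definition one := of5 c1.

Definition elems5 := [:: c0; c1; c2; c3; c4].
Definition elems25 := [seq Elt a b | a <- elems5, b <- elems5].

Definition fvec : Type := F25 * F25 * F25.
Definition addv (u v : fvec) : fvec :=
  let: (x, y, z) := u in let: (x', y', z') := v in (add x x', add y y', add z z').
Definition scalv c (u : fvec) : fvec := let: (x, y, z) := u in (mul c x, mul c y, mul c z).
Definition dot (u v : fvec) :=
  let: (x, y, z) := u in let: (x', y', z') := v in
  add (mul x x') (add (mul y y') (mul z z')).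
Definition cross (u v : fvec) : fvec :=
  let: (x, y, z) := u in let: (x', y', z') := v in
  (add (mul y z') (opp (mul z y')), add (mul z x') (opp (mul x z')),
   add (mul x y') (opp (mul y x'))).

Definition hermJ (u v : fvec) :=
  let: (x, y, z) := u in let: (x', y', z') := v in
  add (mul x (conjF z')) (add (scal5 c3 (mul y (conjF y'))) (mul z (conjF x'))).

(* Matrices are triples of columns. *)
Definition mat : Type := fvec * fvec * fvec.
Definition mulmv (A : mat) (x : fvec) : fvec :=
  let: (u, v, w) := A in let: (a, b, c) := x in
  addv (scalv a u) (addv (scalv b v) (scalv c w)).
Definition mulmm (A B : mat) : mat :=
  let: (u, v, w) := B in (mulmv A u, mulmv A v, mulmv A w).
Definition idm : mat := ((one, zero, zero), (zero, one, zero), (zero, zero, one)).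
Definition unitary (A : mat) :=
  let: (u, v, w) := A in
  [&& is0 (hermJ u u), is0 (hermJ u v), eqF (hermJ u w) one,
      is0 (hermJ v u), eqF (hermJ v v) (of5 c3), is0 (hermJ v w),
      eqF (hermJ w u) one, is0 (hermJ w v) & is0 (hermJ w w)].

Variant sym := Sym of F25 & F25 & F25 & F25 & F25 & F25.
Definition quad (S : sym) (p : fvec) :=
  let: Sym a b c d e f := S in let: (x, y, z) := p in
  add (mul a (mul x x)) (add (mul d (mul y y)) (add (mul f (mul z z))
   (scal5 c2 (add (mul b (mul x y)) (add (mul c (mul x z)) (mul e (mul y z))))))).
(* Gram matrix J A^ J^-1 A^^T J of the image under A of the conic xz = y^2, where A^ is
   the conjugate matrix; it agrees with the inverse-transpose formula for unitary A. *)
Definition sym_of (A : mat) :=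
  let: ((u0, u1, u2), (v0, v1, v2), (w0, w1, w2)) := A in
  let m a a' b b' c c' := conjF (add (mul a c') (add (mul a' c) (scal5 c2 (mul b b')))) in
  Sym (m u2 u2 v2 v2 w2 w2) (scal5 c3 (m u2 u1 v2 v1 w2 w1)) (m u2 u0 v2 v0 w2 w0)
      (scal5 c4 (m u1 u1 v1 v1 w1 w1)) (scal5 c3 (m u1 u0 v1 v0 w1 w0)) (m u0 u0 v0 v0 w0 w0).

(* A transversal of the stabilizer of the first component: it consists of matrices
   fixing the isotropic point (1, 0, 0). *)
Definition torus_unip a r t : mat :=
  ((a, zero, zero), (mul a (Elt c0 r), one, zero),
   (mul a (Elt (mul5 c2 (mul5 r r)) t), Elt c0 (mul5 c2 r), inv (conjF a))).
(** The six values of [a] represent the nonzero elements of F_25 modulo those of F_5; with five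
    values for each of [r] and [t] this gives 150 matrices, the first being the identity. *)
Definition borel := [seq torus_unip a.1 a.2 t |
  a <- [seq (a, r) | a <- [:: one; Elt c1 c1; Elt c1 c2; Elt c1 c3; Elt c1 c4; Elt c0 c1],
                     r <- elems5], t <- elems5].
(* Unitary matrices of projective orders 7 and 3, found by computer search; they
   generate a group of order 21 that is simply transitive on the first component. *)
Definition sigma : mat :=
  ((Elt c0 c3, zero, Elt c2 c0), (Elt c0 c4, one, one), (Elt c2 c3, Elt c4 c0, Elt c2 c3)).
Definition rho : mat :=
  ((Elt c1 c4, one, Elt c4 c1), (of5 c3, of5 c4, Elt c0 c3), (one, zero, Elt c0 c1)).
Definition frob21 := [seq mulmm (iter a (mulmm sigma) idm) (iter b (mulmm rho) idm)
                 | a <- iota 0 7, b <- iota 0 3].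

Definition rep i j := mulmm (nth idm borel i) (nth idm frob21 j).
Definition pairs := [seq (i, j) | i <- iota 0 150, j <- iota 0 21].

Definition scals (t : F25) (S : sym) :=
  let: Sym a b c d e f := S in
  Sym (mul t a) (mul t b) (mul t c) (mul t d) (mul t e) (mul t f).
(** For conics with a unitary frame a = 0 implies b = 0 and then c is nonzero, so the pivot never
    vanishes. *)
Definition pivot (S : sym) := let: Sym a b c d e f := S in if is0 a then c else a.
Definition normal (S : sym) := scals (inv (pivot S)) S.

Definition dig (x : F25) (s : seq F5) := let: Elt a b := x in [:: a, b & s].
Definition digits (S : sym) := let: Sym a b c d e f := S in
  dig a (dig b (dig c (dig d (dig e (dig f [::]))))).

(* Tries keep membership tests among the 3150 conics cheap in kernel reduction. *)
Inductive trie := Empty | Leaf of nat | Node of trie & trie & trie & trie & trie.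
Definition child c t :=
  if t is Node t0 t1 t2 t3 t4 then
    match c with c0 => t0 | c1 => t1 | c2 => t2 | c3 => t3 | c4 => t4 end
  else Empty.
Fixpoint lookup k t := match k with [::] => if t is Leaf n then Some n else None
  | c :: k' => lookup k' (child c t) end.
Fixpoint insert k n t := match k with [::] => Leaf n
  | c :: k' => let s := insert k' n (child c t) in
     let ch d := child d t in
     match c with
     | c0 => Node s (ch c1) (ch c2) (ch c3) (ch c4)
     | c1 => Node (ch c0) s (ch c2) (ch c3) (ch c4)
     | c2 => Node (ch c0) (ch c1) s (ch c3) (ch c4)
     | c3 => Node (ch c0) (ch c1) (ch c2) s (ch c4)
     | c4 => Node (ch c0) (ch c1) (ch c2) (ch c3) s
     end end.
(** Fails on a repeated key, so that success certifies that the keys are pairwise distinct. *)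
Fixpoint build ks t := match ks with [::] => Some t
  | k :: ks' => if lookup k t is Some _ then None else build ks' (insert k 0 t) end.

Definition keys := [seq digits (normal (sym_of (rep ij.1 ij.2))) | ij <- pairs].
Definition known := if build keys Empty is Some t then t else Empty.
Definition is_known S := isSome (lookup (digits S) known).

(** The Hermitian form of the inverse of J: the middle entry is 2, the inverse of -2 modulo 5. Conic
    matrices are compared through it because they act on the dual side. *)
Definition gJ (u v : fvec) :=
  let: (x, y, z) := u in let: (x', y', z') := v in
  add (mul x (conjF z')) (add (scal5 c2 (mul y (conjF y'))) (mul z (conjF x'))).
Definition all25 p := all p elems25.
(* For a conic matrix S = (1 b c; b d e; c e f) the unitarity relations
   [gJ row_i row_j = nu J_ij] determine e and f from b, c and d. *)
Definition solve_e b c d := conjF (opp (add (scal5 c2 (mul b (conjF d))) (mul c (conjF b)))).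
Definition solve_f b c d e :=
  conjF (add (scal5 c2 (gJ (b,d,e) (b,d,e))) (opp (add (scal5 c2 (mul b (conjF e))) (mul c (conjF c))))).
Definition complete1 b c := is0 (gJ (one,b,c) (one,b,c)) ==>
  all25 (fun d =>
    let e := solve_e b c d in
    let f := solve_f b c d e in
    (~~ is0 (gJ (b,d,e) (b,d,e)) && is0 (gJ (b,d,e) (c,e,f)) && is0 (gJ (c,e,f) (c,e,f)))
      ==> is_known (Sym one b c d e f)).
(** The case a = b = 0, normalized by c = 1. The multiplier nu is then 1, and the middle diagonal
    relation says that d has norm -1. *)
Definition complete0 d := eqF (mul d (conjF d)) (of5 c4) ==>
  all25 (fun e => all25 (fun f =>
    (is0 (gJ (zero,d,e) (one,e,f)) && is0 (gJ (one,e,f) (one,e,f)))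
      ==> is_known (Sym zero zero one d e f))).

Definition pts (A : mat) : seq fvec :=
  let: (u, v, w) := A in
  u :: [seq addv (scalv (of5 (mul5 s s)) u) (addv (scalv (of5 s) v) w) | s <- elems5].
Definition origin : fvec := (zero, zero, zero).

Definition chords := [seq ab <- [seq (a, b) | a <- iota 0 6, b <- iota 0 6] | ab.1 < ab.2].
Definition chord (ab : nat * nat) : fvec :=
  cross (nth origin (pts idm) ab.1) (nth origin (pts idm) ab.2).
Definition chord_ok ab := all (fun c =>
   is0 (dot (chord ab) (nth origin (pts idm) c)) == (c == ab.1) || (c == ab.2)) (iota 0 6).
(** Counts the 15 secants of the first conic that join two contact points of the conic of [A], that
    is, the common secants of the two conics. *)
Definition common_chords (A : mat) :=
  let P := pts A in
  count (fun ab => let l := chord ab in 2 <= count (fun p => is0 (dot l p)) P) chords.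

Definition sub x y := add x (opp y).
(* Coefficients of S in the parameter s of the conic (s^2, s, 1); a vanishing leading
   coefficient means that the point at infinity is common. *)
Definition quartic (S : sym) := let: Sym a b c d e f := S in
  (a, scal5 c2 b, add (scal5 c2 c) d, scal5 c2 e, f).
(** Tests q = q4 (s^2 + bt s + g1)(s^2 + bt s + g2). With equal linear terms [bt] is forced by the
    cubic coefficient, so only [g1] and [g2] are searched. *)
Definition factors4 (q : F25 * F25 * F25 * F25 * F25) (bt g1 g2 : F25) :=
  let: (q4, q3, q2, q1, q0) := q in
  [&& eqF q3 (mul q4 (scal5 c2 bt)), eqF q2 (mul q4 (add (mul bt bt) (add g1 g2))),
      eqF q1 (mul q4 (mul bt (add g1 g2))) & eqF q0 (mul q4 (mul g1 g2))].
Definition lead_ratio (S : sym) := let: Sym a b c d e f := S in mul (inv a) b.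
(* [scal5 c4 g] is 4 g = - g: D g is the discriminant of s^2 + bt s + g. *)
Definition split4 (S : sym) :=
  let q := quartic S in let bt := lead_ratio S in
  let D g := sub (mul bt bt) (scal5 c4 g) in
  ~~ is0 q.1.1.1.1 &&
  has (fun g1 => ~~ is0 (D g1) && has (fun g2 =>
     [&& ~~ is0 (D g2), ~~ eqF g1 g2 & factors4 q bt g1 g2]) elems25) elems25.
(** Excludes four common points of distinct conics. Either infinity is common and at most two affine
    roots remain, unless the quartic is zero, or the quartic is a constant times a square and has at
    most two roots. *)
Definition repeated4 (S : sym) :=
  let q := quartic S in
  if is0 q.1.1.1.1 then is0 q.1.1.1.2
  else has (fun g => factors4 q (lead_ratio S) g g) elems25.

(* Indices of the neighbours of the first conic; all lie in its own component. *)
Definition nbrs := [:: 1; 2; 3; 4; 5; 11; 14; 16; 18; 19].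
(** A non-neighbour fails one of the two conditions: the number of common secants is not 3, or the
    intersection has a repeated point or is the whole conic. *)
Definition adjacency_ok (ij : nat * nat) := let: (i, j) := ij in
  if (i == 0) && (j \in nbrs) then (common_chords (rep i j) == 3) && split4 (sym_of (rep i j))
  else (common_chords (rep i j) != 3) || repeated4 (sym_of (rep i j)).

Definition eqsym (S S' : sym) :=
  let: Sym a b c d e f := S in let: Sym a' b' c' d' e' f' := S' in
  [&& eqF a a', eqF b b', eqF c c', eqF d d', eqF e e' & eqF f f'].
Definition same_conic A B := eqsym (normal (sym_of A)) (normal (sym_of B)).
(** The matrix [rep 0 j] carries the first conic to conic j, so it carries the neighbours of the
    first to those of conic j. The table is computed once and only rechecked by [moves_ok], where
    [j' < 21] excludes a failed search. *)
Definition moves := Eval vm_compute in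
  [seq [seq seq.find (fun j' => same_conic (mulmm (rep 0 j) (rep 0 l)) (rep 0 j')) (iota 0 21)
       | l <- nbrs] | j <- iota 0 21].
Definition moved j := nth [::] moves j.
Definition moves_ok j := (size (moved j) == 10) && all (fun i =>
    let j' := nth 0 (moved j) i in
    (j' < 21) && same_conic (mulmm (rep 0 j) (rep 0 (nth 0 nbrs i))) (rep 0 j')) (iota 0 10).
(** Any two of the 21 conics are at distance at most 2. *)
Definition connected_ok j := all (fun j' =>
    [|| j == j', j' \in moved j | has (fun l => j' \in moved l) (moved j)]) (iota 0 21).

Definition normv (p : fvec) := let: (x, y, z) := p in scalv (inv (if is0 x then z else x)) p.
Definition vdigits (p : fvec) := let: (x, y, z) := p in dig x (dig y (dig z [::])).
(* The 21 conics of the first component partition the 126 points of Gamma over F_25;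
   the label of a point is the index of the conic through it. *)
Definition add_labels j t := foldr (fun p => insert (vdigits (normv p)) j) t (pts (rep 0 j)).
Definition labels := foldr add_labels Empty (iota 0 21).
Definition label p := lookup (vdigits (normv p)) labels.
Definition has_label p j := if label p is Some j' then eqn j' j else false.
Definition label_ok p :=
  all (fun j => is0 (quad (sym_of (rep 0 j)) p) == has_label p j) (iota 0 21).
Definition affine_label_ok y z := is0 (hermJ (one, y, z) (one, y, z)) ==> label_ok (one, y, z).

Definition meets i j' : seq nat :=
  let P := pts (rep i j') in [seq count (fun p => has_label p j) P | j <- iota 0 21].
Definition meet_table i := [seq meets i j' | j' <- iota 0 21].
(** [meet_table] lists the intersections from the side of component i; its transpose lists them from
    the side of the first component. The two readings give T(D_i, D_0) and T(D_0, D_i). *)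
Definition rows i := let t := meet_table i in [seq [seq nth 0 r j | r <- t] | j <- iota 0 21].

Definition has_profile (ms : seq nat) t :=
  all (fun n => eqn (count (eqn n) ms) (nth 0 (conic_type_profile t) n)) (iota 0 7).
Definition split_table (tb : seq (seq nat)) t m t' m' :=
  [&& all (fun r => has_profile r t || has_profile r t') tb,
      eqn (count (has_profile^~ t) tb) m & eqn (count (has_profile^~ t') tb) m'].
Definition table_type tb T :=
  match T with
  | beta21 => all (has_profile^~ beta) tb
  | gamma21 => all (has_profile^~ gamma) tb
  | alpha15gamma6 => split_table tb alpha 15 gamma 6
  | alpha3gamma18 => split_table tb alpha 3 gamma 18
  end.
Definition type_code tb :=
  if table_type tb beta21 then 0 else if table_type tb gamma21 then 1
  else if table_type tb alpha15gamma6 then 2 else 3.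
Definition all_types := [:: beta21; gamma21; alpha15gamma6; alpha3gamma18].
Definition type_index T := match T with beta21 => 0 | gamma21 => 1 | alpha15gamma6 => 2 | alpha3gamma18 => 3 end.
Definition types := Eval vm_compute in [seq type_code (rows i) | i <- iota 0 150].
(** All four types are tested in both directions against one code, which yields existence,
    uniqueness and symmetry together. Entry 0 of [types] compares the first component with itself
    and is never consulted. *)
Definition types_ok i :=
  let t := nth 0 types i in let tb := rows i in let tb' := meet_table i in
  all (fun T => (table_type tb T == eqn (type_index T) t) && (table_type tb' T == eqn (type_index T) t)) all_types.
Definition count_ok T := count (fun i => eqn (type_index T) (nth 0 types i)) (iota 1 149)
   == component_type_count T.

Lemma unitary_borel : all unitary borel. Proof. by vm_compute. Qed.
Lemma unitary_frob21 : all unitary frob21. Proof. by vm_compute. Qed.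
Lemma rep00 : rep 0 0 = idm. Proof. by vm_compute. Qed.
Lemma chords_ok : all chord_ok chords. Proof. by vm_compute. Qed.
Lemma adjacency_pairs : all adjacency_ok pairs. Proof. by vm_compute. Qed.
Lemma moves_iota : all moves_ok (iota 0 21). Proof. by vm_compute. Qed.
Lemma connected_iota : all connected_ok (iota 0 21). Proof. by vm_compute. Qed.
Lemma label_origin : label_ok (zero, zero, one). Proof. by vm_compute. Qed.
Lemma label_affine : all25 (fun y => all25 (affine_label_ok y)). Proof. by vm_compute. Qed.
Lemma types_iota : all types_ok (iota 1 149). Proof. by vm_compute. Qed.
Lemma counts_ok : all count_ok all_types. Proof. by vm_compute. Qed.

End FiniteModel.

Lemma card_seq (I : eqType) (T : Type) (c : I -> T) (s : seq I) (p : pred I) (A : set T) :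
  uniq s -> {in s &, injective c} ->
  (forall x, A x <-> exists2 j, (j \in s) && p j & x = c j) -> A #= `I_(count p s).
Proof.
move=> us ic hA; apply/card_ordP; rewrite -size_filter; set s' := filter p s.
have in_s (i : 'I_(size s')) : (tnth (in_tuple s') i \in s) && p (tnth (in_tuple s') i).
  by rewrite andbC -mem_filter; apply: mem_tnth.
exists (fun i : 'I_(size s') => c (tnth (in_tuple s') i)); split.
  move=> i j; have /andP[sj _] := in_s j; have /andP[si _] := in_s i => /(ic _ _ si sj).
  by apply/tuple_uniqP; rewrite filter_uniq.
move=> x; rewrite hA; split=> [[j sj ->]|[i <-]]; last by exists (tnth (in_tuple s') i).
have /seq_tnthP [i ->] : j \in s' by rewrite mem_filter andbC.
by exists i.
Qed.

(** * Components and types from finite tables *)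

Section Components.
Variables (k : closedFieldType) (Gamma : plane_curve k 6).
Local Notation TT := (totally_tangent_conic Gamma).
Local Notation adj := (adjacent Gamma).
Local Notation meet Q Q' := (on_curve Q `&` on_curve Q' `&` on_curve Gamma).
Implicit Types (Q : plane_curve k 2) (D : set (plane_curve k 2)).

Definition component Q : set (plane_curve k 2) := [set Q' | clos_refl_trans _ adj Q Q'].

Lemma adjacent_sym Q Q' : adj Q Q' -> adj Q' Q.
Proof. by case=> h1 h2 h3 h4 h5; split=> //; [move=> e; apply: h3 | rewrite setIC | rewrite setIC]. Qed.

Lemma component_sym Q Q' : component Q Q' -> component Q' Q.
Proof.
elim=> [x y h|x|x y z _ h1 _ h2]; [exact/rt_step/adjacent_sym | exact: rt_refl | exact: rt_trans h2 h1].
Qed.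

Lemma component_eq Q Q' : component Q Q' -> component Q' = component Q.
Proof.
move=> h; apply/seteqP; split=> x hx; first exact: rt_trans h hx.
exact: rt_trans (component_sym h) hx.
Qed.

Lemma component_self Q : component Q Q. Proof. exact: rt_refl. Qed.

End Components.

Section FiniteTables.
Variables (k : closedFieldType) (Gamma : plane_curve k 6).
Local Notation meet Q Q' := (on_curve Q `&` on_curve Q' `&` on_curve Gamma).
Variables (n : nat) (c c' : nat -> plane_curve k 2) (D D' : set (plane_curve k 2)).
Hypothesis c_inj : {in iota 0 n &, injective c}.
Hypothesis c'_inj : {in iota 0 n &, injective c'}.
Hypothesis D_def : forall Q, D Q <-> exists2 j, j \in iota 0 n & Q = c j.
Hypothesis D'_def : forall Q, D' Q <-> exists2 j, j \in iota 0 n & Q = c' j.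
Variable m : nat -> nat -> nat.
Hypothesis m_le : forall j j', j \in iota 0 n -> j' \in iota 0 n -> (m j j' < 7)%N.
Hypothesis meet_card : forall j j', j \in iota 0 n -> j' \in iota 0 n ->
  meet (c j) (c' j') #= `I_(m j j').

Definition table := [seq [seq m j j' | j' <- iota 0 n] | j <- iota 0 n].

Lemma has_conic_typeE j t : j \in iota 0 n ->
  has_conic_type Gamma (c j) D' t <-> has_profile [seq m j j' | j' <- iota 0 n] t.
Proof.
move=> hj.
have cnt a : [set Q' | D' Q' /\ meet (c j) Q' #= `I_a] #=
    `I_(count (eqn a) [seq m j j' | j' <- iota 0 n]).
  rewrite count_map; apply: (@card_seq _ _ c') => // [|Q]; first exact: iota_uniq.
  split=> [[/D'_def [j' hj' ->] ha]|[j' /andP[hj' /eqP ->] ->]]; last first.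
    by split; [apply/D'_def; exists j' | exact: meet_card].
  exists j' => //; rewrite hj' /=; apply/eqP; exact: card_ord_unique ha (meet_card hj hj').
split=> h.
  by apply/allP => a _; apply/eqP/(card_ord_unique (cnt a) (h a)).
(* From 7 on both sides are zero: the profile by the default value of [nth], the count because the
   numbers [m j j'] are below 7. *)
move=> a; case: (ltnP a 7) => ha.
  have := allP h a; rewrite mem_iota => /(_ ha) /eqnP e.
  by have := cnt a; rewrite e.
have -> : nth 0%N (conic_type_profile t) a = 0%N.
  by rewrite nth_default //; case: t {h}; apply: leq_trans ha.
suff e : count (eqn a) [seq m j j' | j' <- iota 0 n] = 0%N by have := cnt a; rewrite e.
apply/eqP; rewrite -leqn0 leqNgt -has_count; apply/hasPn => b /mapP [j' hj' ->].
by apply: contraL (m_le hj hj') => /eqP <-; rewrite -leqNgt.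
Qed.

Lemma has_component_typeE T :
  has_component_type Gamma D D' T <-> table_type table T.
Proof.
have const t : (forall Q, D Q -> has_conic_type Gamma Q D' t) <-> all (has_profile^~ t) table.
  split=> h.
    by apply/allP => _ /mapP [j hj ->]; apply/has_conic_typeE/h/D_def => //; exists j.
  move=> Q /D_def [j hj ->]; apply/has_conic_typeE => //.
  by apply: (allP h); apply/mapP; exists j.
have cnt t : [set Q | D Q /\ has_conic_type Gamma Q D' t] #= `I_(count (has_profile^~ t) table).
  rewrite count_map; apply: (@card_seq _ _ c) => // [|Q]; first exact: iota_uniq.
  split=> [[/D_def [j hj ->] h]|[j /andP[hj h] ->]].
    by exists j => //; apply/andP; split=> //; apply/(has_conic_typeE _ hj).
  by split; [apply/D_def; exists j | apply/has_conic_typeE].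
have spl t a t' a' : splits Gamma D D' t a t' a' <-> split_table table t a t' a'.
  split=> [[h1 h2 h3]|/and3P[/allP h1 /eqnP h2 /eqnP h3]]; last first.
    split; try by [have := cnt t; rewrite h2 | have := cnt t'; rewrite h3].
    move=> Q /D_def [j hj ->]; have /orP[] := h1 _ (map_f _ hj) => h; [left|right];
      exact/has_conic_typeE.
  apply/and3P; split; last 2 first.
  - exact/eqP/(card_ord_unique (cnt t) h2).
  - exact/eqP/(card_ord_unique (cnt t') h3).
  apply/allP => _ /mapP [j hj ->]; apply/orP.
  have Dj : D (c j) by apply/D_def; exists j.
  by have [/(has_conic_typeE _ hj) h|/(has_conic_typeE _ hj) h] := h1 _ Dj; [left|right].
by case: T => /=.
Qed.

End FiniteTables.

Definition eq5 x y := zero5 (add5 x (opp5 y)).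
Lemma eq5P : Equality.axiom eq5. Proof. by move=> [] []; constructor. Qed.
HB.instance Definition _ := hasDecEq.Build F5 eq5P.

Lemma eqF_axiom : Equality.axiom eqF.
Proof. by move=> [[] []] [[] []]; constructor. Qed.
HB.instance Definition _ := hasDecEq.Build F25 eqF_axiom.

Lemma elems5P (P : F5 -> bool) : all P elems5 -> forall x, P x.
Proof. by case/and5P => h0 h1 h2 h3 /andP[h4 _] []. Qed.

Lemma all25P (P : F25 -> bool) : all25 P -> forall x, P x.
Proof.
move=> h [a b].
have : all (fun a => all (fun b => P (Elt a b)) elems5) elems5.
  by move: h; rewrite /all25 /elems25 /= !andbT -!andbA.
by move/elems5P/(_ a)/elems5P/(_ b).
Qed.

(** * Embedding the finite model *)

Section Iota.
Variable k : closedFieldType.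
Hypothesis char5 : 5%N \in [pchar k].
Local Notation F := (pFrobenius_aut char5).
Local Notation FM := (map_mx F).
Local Notation J := (Jmx k).
Variable eps : k.
Hypothesis eps2 : eps ^+ 2 = 2%:R.

Lemma h5 : 5%:R = 0 :> k. Proof. by apply/eqP; rewrite (char5_neq0 char5). Qed.

Definition nat5 (x : F5) : nat := match x with c0 => 0 | c1 => 1 | c2 => 2 | c3 => 3 | c4 => 4 end.
Definition iota5 (x : F5) : k := (nat5 x)%:R.
Definition iota (x : F25) : k := let: Elt a b := x in iota5 a + iota5 b * eps.

Lemma natr_mod5 n : (n %% 5)%:R = n%:R :> k.
Proof. by rewrite [in RHS](divn_eq n 5) natrD natrM h5 mulr0 add0r. Qed.

Lemma iota5_add x y : iota5 (add5 x y) = iota5 x + iota5 y.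
Proof. by rewrite /iota5 -natrD -[RHS]natr_mod5; case: x; case: y. Qed.
Lemma iota5_mul x y : iota5 (mul5 x y) = iota5 x * iota5 y.
Proof. by rewrite /iota5 -natrM -[RHS]natr_mod5; case: x; case: y. Qed.
Lemma iota5_opp x : iota5 (opp5 x) = - iota5 x.
Proof.
apply/eqP; rewrite -addr_eq0 -iota5_add; apply/eqP.
by case: x.
Qed.
Lemma iota5_pow x : iota5 x ^+ 5 = iota5 x.
Proof. by rewrite /iota5 natr_F5. Qed.

Lemma eps5 : eps ^+ 5 = - eps.
Proof.
have -> : eps ^+ 5 = eps ^+ 2 * eps ^+ 2 * eps by ring.
rewrite eps2; apply/eqP; rewrite -subr_eq0 opprK.
have -> : 2%:R * 2%:R * eps + eps = 5%:R * eps by ring.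
by rewrite h5 mul0r.
Qed.

Lemma iota_add x y : iota (add x y) = iota x + iota y.
Proof. case: x y => a b [c d] /=; rewrite !iota5_add; ring. Qed.
Lemma iota_opp x : iota (opp x) = - iota x.
Proof. case: x => a b /=; rewrite !iota5_opp; ring. Qed.
Lemma iota_mul x y : iota (mul x y) = iota x * iota y.
Proof.
case: x y => a b [c d] /=; rewrite !(iota5_add, iota5_mul).
set A := iota5 a; set B := iota5 b; set C := iota5 c; set D := iota5 d.
have -> : (A + B * eps) * (C + D * eps) = A * C + B * D * eps ^+ 2 + (A * D + B * C) * eps by ring.
rewrite eps2; ring.
Qed.
Lemma iota_conj x : iota (conjF x) = iota x ^+ 5.
Proof.
case: x => a b /=; rewrite -(pFrobenius_autE char5) rmorphD rmorphM /= !pFrobenius_autE.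
by rewrite eps5 !iota5_pow iota5_opp mulrN mulNr.
Qed.
Lemma iota_scal5 c x : iota (scal5 c x) = iota5 c * iota x.
Proof. case: x => a b /=; rewrite !iota5_mul; ring. Qed.
Lemma iota_of5 c : iota (of5 c) = iota5 c.
Proof. by rewrite /= mul0r addr0. Qed.
Lemma iota_zero : iota zero = 0. Proof. by rewrite iota_of5. Qed.
Lemma iota_one : iota one = 1. Proof. by rewrite iota_of5. Qed.
Lemma iota5E : (iota5 c2 = 2%:R) * (iota5 c3 = - 2%:R) * (iota5 c4 = - 1).
Proof.
do !split=> //; rewrite /iota5 /=; apply/eqP; rewrite -subr_eq0 opprK -?natrD ?(char5_neq0 char5) //.
by rewrite -[X in _ + X]/(1%:R) -natrD (char5_neq0 char5).
Qed.

(** A nonzero element has an inverse in the model, checked on all 25 elements, so its image cannot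
    vanish. *)
Lemma is0P x : is0 x = (iota x == 0).
Proof.
apply/idP/eqP; first by case: x => -[] [] // _; exact: iota_zero.
have inv_ok : forall x, is0 x || eqF (mul (inv x) x) one by apply: all25P.
move=> x0; have /orP[//|] := inv_ok x; rewrite /eqF => e.
have eqz y : is0 y -> iota y = 0 by case: y => -[] [] // _; exact: iota_zero.
move/eqz: e; rewrite iota_add iota_opp iota_mul x0 mulr0 add0r iota_one => /eqP.
by rewrite oppr_eq0 oner_eq0.
Qed.

Lemma eqFP x y : eqF x y = (iota x == iota y).
Proof. by rewrite /eqF is0P iota_add iota_opp subr_eq0. Qed.

Lemma iota_inj : injective iota.
Proof. by move=> x y e; apply/eqF_axiom; rewrite eqFP e. Qed.

Lemma iota_inv x : iota (inv x) = (iota x)^-1.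
Proof.
have inv_ok : forall x, (is0 x && is0 (inv x)) || eqF (mul (inv x) x) one by apply: all25P.
have /orP[/andP[]|] := inv_ok x; first by rewrite !is0P => /eqP -> /eqP ->; rewrite invr0.
rewrite eqFP iota_mul iota_one => /eqP e.
have x0 : iota x != 0 by apply/eqP => x0; move/eqP: e; rewrite x0 mulr0 eq_sym oner_eq0.
by rewrite -[LHS](mulfK x0) e mul1r.
Qed.

Lemma iota_pow25 x : iota x ^+ 25 = iota x.
Proof. by rewrite -[25%N]/(5 * 5)%N exprM -!iota_conj; case: x => a [] . Qed.

(** A solution outside the image would be a 26th root of X^25 - X. *)
Lemma iota_surj (y : k) : y ^+ 25 = y -> exists x, iota x = y.
Proof.
move=> y25; apply: contrapT => /forallNP ny.
pose p : {poly k} := 'X^25 - 'X.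
have sp : size p = 26%N.
  by rewrite /p size_polyDl ?size_polyXn // size_polyN size_polyX.
have p0 : p != 0 by rewrite -size_poly_eq0 sp.
pose s := y :: [seq iota x | x <- elems25].
have us : uniq s.
  rewrite cons_uniq map_inj_uniq ?andbT; last exact: iota_inj.
  by apply/mapP => -[x _ e]; case: (ny x).
have rs : all (root p) s.
  have rp z : root p z = (z ^+ 25 == z) by rewrite rootE !hornerE subr_eq0.
  apply/allP => z; rewrite in_cons rp => /orP[/eqP->|/mapP [x _ ->]]; first exact/eqP.
  by rewrite iota_pow25.
by have := max_poly_roots p0 rs us; rewrite sp.
Qed.

End Iota.

Section Vectors.
Variable k : closedFieldType.
Hypothesis char5 : 5%N \in [pchar k].
Local Notation F := (pFrobenius_aut char5).
Local Notation FM := (map_mx F).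
Local Notation J := (Jmx k).
Variable eps : k.
Hypothesis eps2 : eps ^+ 2 = 2%:R.
Local Notation iota := (iota eps).

Definition iv (p : fvec) : 'rV[k]_3 := let: (x, y, z) := p in row3 (iota x) (iota y) (iota z).
(** Columns of the model become rows here, since vectors of the plane are rows; products are
    therefore reversed in [im_mulmm]. *)
Definition im (A : mat) : 'M[k]_3 := let: (u, v, w) := A in mat3 (iv u) (iv v) (iv w).
Definition sm (S : sym) : 'M[k]_3 := let: Sym a b c d e f := S in
  mat3 (row3 (iota a) (iota b) (iota c)) (row3 (iota b) (iota d) (iota e))
       (row3 (iota c) (iota e) (iota f)).

Lemma iv_inj : injective iv.
Proof.
move=> [[x y] z] [[x' y'] z'] /rowP h; have := h o0; have := h o1; have := h o2.
rewrite !mxE /=; have inj := iota_inj char5 eps2.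
by move=> /inj -> /inj -> /inj ->.
Qed.

Lemma iv_add u v : iv (addv u v) = iv u + iv v.
Proof.
case: u v => -[x y] z [[x' y'] z'].
by apply/rowP; apply: I3_ind; rewrite !mxE /= (iota_add char5).
Qed.

Lemma iv_scal c u : iv (scalv c u) = iota c *: iv u.
Proof.
case: u => -[x y] z.
by apply/rowP; apply: I3_ind; rewrite !mxE /= (iota_mul char5 eps2).
Qed.

Lemma row3_mat3 (x y z : k) (u v w : 'rV[k]_3) :
  row3 x y z *m mat3 u v w = x *: u + y *: v + z *: w.
Proof. by apply/rowP => j; rewrite row3_mulmx !mxE. Qed.

Lemma iv_mulmv A x : iv (mulmv A x) = iv x *m im A.
Proof.
case: A x => -[u v] w [[a b] c].
by rewrite /= row3_mat3 !iv_add !iv_scal addrA.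
Qed.

Lemma im_mulmm A B : im (mulmm A B) = im B *m im A.
Proof.
case: B => -[u v] w; rewrite /= !iv_mulmv; apply/matrixP => i j; rewrite [in RHS]mxE.
by move: i; apply: I3_ind; rewrite !mxE; apply: eq_bigr => l _; rewrite !mxE.
Qed.

Lemma im_id : im idm = 1%:M.
Proof.
have i1 := iota_one eps; have i0 := iota_zero eps.
by apply/matrixP; apply: I3_ind; apply: I3_ind; rewrite !mxE /= -?/one -?/zero ?i1 ?i0.
Qed.

Lemma iota_dot u v : iota (dot u v) = (iv u *m (iv v)^T) 0 0.
Proof.
case: u v => -[x y] z [[x' y'] z'].
by rewrite mxE sum3 !mxE /= !(iota_add char5) !(iota_mul char5 eps2) addrA.
Qed.

Lemma Jmx_herm (u v : 'rV[k]_3) : (u *m J *m (FM v)^T) 0 0 =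
  u 0 o0 * v 0 o2 ^+ 5 - 2%:R * (u 0 o1 * v 0 o1 ^+ 5) + u 0 o2 * v 0 o0 ^+ 5.
Proof. by rewrite Jmx_form !mxE !pFrobenius_autE. Qed.

Lemma iota_hermJ u v : iota (hermJ u v) = (iv u *m J *m (FM (iv v))^T) 0 0.
Proof.
case: u v => -[x y] z [[x' y'] z'].
rewrite Jmx_herm !mxE /= !(iota_add char5) (iota_scal5 char5) !(iota_mul char5 eps2).
by rewrite !(iota_conj char5 eps2) (iota5E char5) mulNr addrA.
Qed.

Lemma gram_entry (X : 'M[k]_3) i j :
  (X *m J *m (FM X)^T) i j = (row i X *m J *m (FM (row j X))^T) 0 0.
Proof.
by rewrite !Jmx_entry !mxE.
Qed.

Lemma im_unitary A : unitary A -> im A *m J *m (FM (im A))^T = J.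
Proof.
case: A => -[u v] w; rewrite /unitary !(is0P char5 eps2) !(eqFP char5 eps2) => h.
apply/matrixP => i j; rewrite gram_entry.
have e5 := iota5E char5.
case/and5P: h => /eqP uu /eqP uv /eqP uw /eqP vu /and5P[/eqP vv /eqP vw /eqP wu /eqP wv /eqP ww].
move: i j; apply: I3_ind; apply: I3_ind; rewrite /im !row_mat3 -iota_hermJ !mxE /=;
  by rewrite ?uu ?uv ?uw ?vu ?vv ?vw ?wu ?wv ?ww ?(iota_one eps) ?iota_of5 ?e5.
Qed.

Lemma unitary_unit (X : 'M[k]_3) : X *m J *m (FM X)^T = J -> X \in unitmx.
Proof.
move=> e; have := Jmx_unit (n2 char5); rewrite -e !unitmx_mul.
by case/andP => /andP[].
Qed.

Lemma Jmx_entry2 (Y : 'M[k]_3) i j (w := fun i : 'I_3 => if val i == 1%N then - 2%:R else 1 : k) :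
  (J *m Y *m J) i j = w i * Y (rev_ord i) (rev_ord j) * w j.
Proof.
have sE (M : 'M[k]_3) i' j' : (J *m M) i' j' = w i' * M (rev_ord i') j'.
  rewrite mxE sum3; move: i'; apply: I3_ind; rewrite !mxE /= !(mul0r, mul1r, add0r, addr0);
    by rewrite /w /= ?mul1r; congr (_ * M _ _) || congr (M _ _); apply: val_inj.
have sE' (M : 'M[k]_3) i' j' : (M *m J) i' j' = M i' (rev_ord j') * w j'.
  rewrite mxE sum3; move: j'; apply: I3_ind; rewrite !mxE /= !(mulr0, mulr1, add0r, addr0);
    by rewrite /w /= ?mulr1; congr (M _ _ * _) || congr (M _ _); apply: val_inj.
by rewrite sE' sE.
Qed.

(** The inverse of J, because 2 times -2 is 1 modulo 5. *)
Definition Jinv : 'M[k]_3 := mat3 (row3 0 0 1) (row3 0 2%:R 0) (row3 1 0 0).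

Lemma Jinv_entry (X Y : 'M[k]_3) i j : (X^T *m Jinv *m Y) i j =
  X o0 i * Y o2 j + 2%:R * (X o1 i * Y o1 j) + X o2 i * Y o0 j.
Proof.
have e l : (X^T *m Jinv) i l = if val l is 0%N then X o2 i else if val l is 1%N then 2%:R * X o1 i else X o0 i.
  by rewrite mxE sum3; move: l; apply: I3_ind; rewrite !mxE /=; ring.
by rewrite mxE sum3 !e /=; ring.
Qed.

Lemma mulJinv : J *m Jinv = 1%:M.
Proof.
apply/matrixP => i j; rewrite mxE sum3.
move: i j; apply: I3_ind; apply: I3_ind; rewrite !mxE /=; try ring.
by rewrite !(mul0r, mulr0, add0r, addr0); apply/eqP; rewrite -subr_eq0 mulNr -opprD oppr_eq0 -!natrM -natrD (char5_neq0 char5).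
Qed.

Lemma sm_sym_of A : sm (sym_of A) = J *m ((FM (im A))^T *m Jinv *m FM (im A)) *m J.
Proof.
case: A => -[[[u0 u1] u2] [[v0 v1] v2]] [[w0 w1] w2].
apply/matrixP => i j; rewrite Jmx_entry2 Jinv_entry.
have r0 : rev_ord o0 = o2 by apply: val_inj.
have r1 : rev_ord o1 = o1 by apply: val_inj.
have r2 : rev_ord o2 = o0 by apply: val_inj.
have [[e2 e3] e4] := iota5E char5.
have {}e4 : iota5 k c4 = - 2%:R * - 2%:R.
  rewrite e4; apply/esym/eqP; rewrite -subr_eq0 opprK mulrNN -[X in _ + X]/(1%:R).
  by rewrite -natrM -natrD (char5_neq0 char5).
move: i j; apply: I3_ind; apply: I3_ind; rewrite ?r0 ?r1 ?r2 !mxE /=;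
rewrite ?(iota_scal5 char5) ?e4 ?e3 !(iota_conj char5 eps2) -?(pFrobenius_autE char5);
rewrite !(iota_add char5) !(iota_scal5 char5) !(iota_mul char5 eps2) e2;
rewrite !(rmorphD, rmorphM, rmorph_nat) /=; ring.
Qed.

(** Unitarity gives X^-1 = J F(X)^T J^-1, which makes the conic matrix polynomial in the conjugate
    entries. *)
Lemma conic_mx_im A : im A *m J *m (FM (im A))^T = J -> conic_mx (im A) = sm (sym_of A).
Proof.
move=> e; have Xu := unitary_unit e.
have e' : FM (im A) *m J *m (im A)^T = J.
  by rewrite -[RHS]tr_Jmx -[in RHS]e !trmx_mul trmxK tr_Jmx mulmxA.
have h : im A *m sm (sym_of A) *m (im A)^T = J.
  rewrite sm_sym_of !mulmxA -[im A *m J *m _]/(im A *m J *m (FM (im A))^T) e.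
  by rewrite mulJinv mul1mx e'.
rewrite /conic_mx -[in LHS]h !mulmxA mulVmx // mul1mx -mulmxA -trmx_mul mulVmx //.
by rewrite trmx1 mulmx1.
Qed.

Lemma iota_quad S p : iota (quad S p) = (iv p *m sm S *m (iv p)^T) 0 0.
Proof.
case: S p => a b c d e f [[x y] z].
rewrite -mulmxA mxE sum3 !mxE !sum3 !mxE /=.
rewrite !(iota_add char5) (iota_scal5 char5) !(iota_add char5) !(iota_mul char5 eps2) (iota5E char5).
ring.
Qed.

End Vectors.

(** * Soundness of the tries and of the list of conics *)

Section Tries.
Local Open Scope nat_scope.

Lemma lookup_empty q : lookup q Empty = None.
Proof. by elim: q => //= -[]. Qed.

Lemma lookup_insert q p n t m :
  lookup q (insert p n t) = Some m -> q = p \/ lookup q t = Some m.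
Proof.
elim: p q t => [|c p IH] [|d q] t /=; first by left.
- by case: d => /=; rewrite ?lookup_empty.
- by case: c.
have -> : child d (match c with
     | c0 => Node (insert p n (child c t)) (child c1 t) (child c2 t) (child c3 t) (child c4 t)
     | c1 => Node (child c0 t) (insert p n (child c t)) (child c2 t) (child c3 t) (child c4 t)
     | c2 => Node (child c0 t) (child c1 t) (insert p n (child c t)) (child c3 t) (child c4 t)
     | c3 => Node (child c0 t) (child c1 t) (child c2 t) (insert p n (child c t)) (child c4 t)
     | c4 => Node (child c0 t) (child c1 t) (child c2 t) (child c3 t) (insert p n (child c t))
     end) = if d == c then insert p n (child c t) else child d t by case: c; case: d.
by case: eqP => [->|_]; [case/IH => [->|]; [left | right] | right].
Qed.

Lemma lookup_insert_same p n t : lookup p (insert p n t) = Some n.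
Proof. by elim: p t => //= c p IH t; case: c; rewrite /= IH. Qed.

Lemma lookup_insert_other q p n t : size q = size p -> q != p ->
  lookup q (insert p n t) = lookup q t.
Proof.
elim: p q t => [|c p IH] [|d q] t //= [sq]; rewrite eqseq_cons.
case: eqP => [->|ne] /= qp; first by case: c; rewrite /= IH.
by case: c ne; case: d.
Qed.

Lemma build_sound ks t t' q : build ks t = Some t' -> isSome (lookup q t') ->
  q \in ks \/ isSome (lookup q t).
Proof.
elim: ks t => [|p ks IH] t /=; first by case=> ->; right.
case e: (lookup p t) => [//|] /IH h /h [qks|]; first by left; rewrite in_cons qks orbT.
case e' : (lookup q _) => [m|//] _.
by have [->|->] := lookup_insert e'; [left; rewrite mem_head | right].
Qed.

(** Keys of equal length end at different leaves, so inserting one key does not disturb the lookup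
    of another. *)
Lemma build_uniq n ks t t' : all (fun p => size p == n) ks -> build ks t = Some t' ->
  uniq ks /\ forall p, p \in ks -> lookup p t = None.
Proof.
elim: ks t => [|p ks IH] t //= /andP[/eqP sp sks].
case e: (lookup p t) => [//|] /(IH _ sks) [uks hks].
have pks : p \notin ks.
  by apply/negP => /hks; rewrite lookup_insert_same.
rewrite pks uks; split=> // q; rewrite in_cons => /orP[/eqP->//|qks].
rewrite -(hks q qks) lookup_insert_other //; last by apply: contraNneq pks => <-.
by rewrite sp; apply/eqP/(allP sks).
Qed.

Lemma digits_inj : injective digits.
Proof.
move=> [[a a'] [b b'] [c c'] [d d'] [e e'] [f f']] [[g g'] [h h'] [i i'] [j j'] [l l'] [m m']].
by move=> [] *; subst.
Qed.

Lemma keys_ok : isSome (build keys Empty). Proof. by vm_compute. Qed.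

Lemma is_knownP S : is_known S ->
  exists2 ij, ij \in pairs & S = normal (sym_of (rep ij.1 ij.2)).
Proof.
rewrite /is_known /known; have := keys_ok; case e: (build keys Empty) => [t|//] _.
case/(build_sound e) => [/mapP [ij hij /digits_inj eS]|]; first exact: (ex_intro2 _ _ ij hij eS).
by rewrite lookup_empty.
Qed.

Lemma uniq_map_inj (T1 T2 : eqType) (f : T1 -> T2) s : uniq (map f s) ->
  {in s &, injective f}.
Proof.
elim: s => //= a s IH /andP[nfa us] x y; rewrite !in_cons.
case/predU1P => [->|xs] /predU1P[->|ys] // e.
- by case/negP: nfa; rewrite e map_f.
- by case/negP: nfa; rewrite -e map_f.
- exact: IH.
Qed.

Lemma normal_inj ij ij' : ij \in pairs -> ij' \in pairs ->
  normal (sym_of (rep ij.1 ij.2)) = normal (sym_of (rep ij'.1 ij'.2)) -> ij = ij'.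
Proof.
have := keys_ok; case e: (build keys Empty) => [t|//] _.
have sk : all (fun p => size p == 12) keys.
  by apply/allP => p /mapP [ij0 _ ->]; case: normal => -[? ?] [? ?] [? ?] [? ?] [? ?] [? ?].
have [uk _] := build_uniq sk e.
by move=> h h' e'; apply: (uniq_map_inj uk h h'); rewrite e'.
Qed.

Lemma complete1_ok : all25 (fun b => all25 (complete1 b)). Proof. by vm_compute. Qed.
Lemma complete0_ok : all25 complete0. Proof. by vm_compute. Qed.

Lemma complete1P b c d e f : e = solve_e b c d -> f = solve_f b c d e ->
  is0 (gJ (one, b, c) (one, b, c)) -> ~~ is0 (gJ (b, d, e) (b, d, e)) ->
  is0 (gJ (b, d, e) (c, e, f)) -> is0 (gJ (c, e, f) (c, e, f)) -> is_known (Sym one b c d e f).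
Proof.
move=> ee ff h1 h2 h3 h4.
move: complete1_ok => /all25P/(_ b)/all25P/(_ c)/implyP/(_ h1)/all25P/(_ d).
by cbv zeta; rewrite -ee -ff => /implyP; apply; rewrite h2 h3 h4.
Qed.

Lemma complete0P d e f : eqF (mul d (conjF d)) (of5 c4) ->
  is0 (gJ (zero, d, e) (one, e, f)) -> is0 (gJ (one, e, f) (one, e, f)) ->
  is_known (Sym zero zero one d e f).
Proof.
move=> h1 h2 h3; move: complete0_ok => /all25P/(_ d)/implyP/(_ h1)/all25P/(_ e)/all25P/(_ f).
by move/implyP; apply; rewrite h2 h3.
Qed.

End Tries.

(** * Completeness of the list of conics *)

Section Completeness.
Variable k : closedFieldType.
Hypothesis char5 : 5%N \in [pchar k].
Local Notation F := (pFrobenius_aut char5).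
Local Notation FM := (map_mx F).
Local Notation J := (Jmx k).
Variable eps : k.
Hypothesis eps2 : eps ^+ 2 = 2%:R.
Local Notation iota := (iota eps).
Local Notation im := (im eps).
Local Notation sm := (sm eps).

(** Transposing the unitarity relation gives F(X) J X^T = J, and applying F to it gives F(X) J
    F(F(X))^T = J. Cancelling F(X) J shows that every entry is fixed by the 25th power map. *)
Lemma rational_mx (X : 'M[k]_3) : X *m J *m (FM X)^T = J -> exists A, X = im A.
Proof.
move=> e; have Xu := unitary_unit e.
have e1 : FM X *m J *m X^T = J.
  by rewrite -[RHS]tr_Jmx -[in RHS]e !trmx_mul trmxK tr_Jmx mulmxA.
have e2 : FM X *m J *m (FM (FM X))^T = J.
  by rewrite -[in RHS](map_Jmx F) -[in RHS]e !map_mxM map_Jmx map_trmx.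
have XFF : X = FM (FM X).
  have FXJ : FM X *m J \in unitmx by rewrite unitmx_mul map_unitmx Xu Jmx_unit ?n2.
  by apply: trmx_inj; apply: (can_inj (mulKmx FXJ)); rewrite e1 e2.
have /choice [a ha] (ij : 'I_3 * 'I_3) : exists x, iota x = X ij.1 ij.2.
  apply: (iota_surj char5 eps2).
  by rewrite [in RHS]XFF !mxE !pFrobenius_autE -exprM.
exists ((a (o0, o0), a (o0, o1), a (o0, o2)), (a (o1, o0), a (o1, o1), a (o1, o2)),
        (a (o2, o0), a (o2, o1), a (o2, o2))).
by apply/matrixP; apply: I3_ind; apply: I3_ind; rewrite !mxE /= ha.
Qed.

Definition srow (S : sym) (i : nat) : fvec := let: Sym a b c d e f := S in
  match i with 0%N => (a, b, c) | 1%N => (b, d, e) | _ => (c, e, f) end.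

Lemma iota_gJ S (i j : 'I_3) :
  iota (gJ (srow S i) (srow S j)) = ((sm S)^T *m Jinv k *m FM (sm S)) i j.
Proof.
rewrite Jinv_entry; case: S => a b c d e f.
move: i j; apply: I3_ind; apply: I3_ind; rewrite !mxE /= !pFrobenius_autE;
  by rewrite !(iota_add char5) (iota_scal5 char5) !(iota_mul char5 eps2) !(iota_conj char5 eps2)
             (iota5E char5) addrA.
Qed.

Lemma sm_scals t S : sm (scals t S) = iota t *: sm S.
Proof.
case: S => a b c d e f.
by apply/matrixP; apply: I3_ind; apply: I3_ind; rewrite !mxE /= (iota_mul char5 eps2).
Qed.

(** Turns the existence of a unitary frame into equations on the six coefficients of the conic
    alone, which can be enumerated. *)
Lemma conic_mx_unitary (X : 'M[k]_3) (S := conic_mx X) :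
  X *m J *m (FM X)^T = J -> S^T *m Jinv k *m FM S = J.
Proof.
move=> e; have Xu := unitary_unit e; have FXu : FM X \in unitmx by rewrite map_unitmx.
have e1 : FM X *m J *m X^T = J.
  by rewrite -[RHS]tr_Jmx -[in RHS]e !trmx_mul trmxK tr_Jmx mulmxA.
have Ju := Jmx_unit (n2 char5).
have FYE : FM (invmx X) = invmx (FM X) by rewrite map_invmx.
have key : (invmx X)^T *m Jinv k *m FM (invmx X) = Jinv k.
  apply: (can_inj (mulKmx Ju)); rewrite (mulJinv char5) -[in LHS]e1 FYE !mulmxA.
  rewrite -[_ *m X^T *m _]mulmxA -trmx_mul mulVmx // trmx1 mulmx1.
  by rewrite -[_ *m J *m _]mulmxA (mulJinv char5) mulmx1 mulmxV.
rewrite /S tr_conic_mx /conic_mx !map_mxM map_Jmx -map_trmx !mulmxA.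
have -> : invmx X *m J *m (invmx X)^T *m Jinv k *m FM (invmx X) =
  invmx X *m J *m ((invmx X)^T *m Jinv k *m FM (invmx X)) by rewrite !mulmxA.
rewrite key -[invmx X *m J *m _]mulmxA (mulJinv char5) mulmx1 FYE.
rewrite -[J in LHS]e !mulmxA mulVmx // mul1mx -mulmxA -trmx_mul mulVmx //.
by rewrite trmx1 mulmx1.
Qed.

Lemma iota_conjK x : (iota x ^+ 5) ^+ 5 = iota x.
Proof. by rewrite -exprM (iota_pow25 char5 eps2). Qed.

Lemma iota_gJ3 x y z x' y' z' : iota (gJ (x, y, z) (x', y', z')) =
  iota x * iota z' ^+ 5 + (2%:R * (iota y * iota y' ^+ 5) + iota z * iota x' ^+ 5).
Proof.
have [[e2 _] _] := iota5E char5.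
by rewrite !(iota_add char5) (iota_scal5 char5) !(iota_mul char5 eps2) !(iota_conj char5 eps2) e2.
Qed.

(** [nu] absorbs the normalization of [S]. The entries of the relation provide exactly the
    hypotheses of the two finite enumerations. *)
Lemma known_of_gJ S (nu : k) : nu != 0 ->
  (forall i j : 'I_3, iota (gJ (srow S i) (srow S j)) = nu * J i j) ->
  (exists b c d e f, S = Sym one b c d e f) \/ (exists d e f, S = Sym zero zero one d e f) ->
  is_known S.
Proof.
move=> nu0 eqs normS.
have [[e2 e3] e4] := iota5E char5.
have i1 := iota_one eps; have i0 := iota_zero eps.
have four : 2%:R * 2%:R = -1 :> k.
  by apply/eqP; rewrite -subr_eq0 opprK -[X in _ + X]/(1%:R) -natrM -natrD (char5_neq0 char5).
have vals : [/\ nu * J o0 o0 = 0, nu * J o0 o1 = 0, nu * J o0 o2 = nu,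
    nu * J o1 o1 = - (2%:R * nu) & nu * J o1 o2 = 0 /\ nu * J o2 o2 = 0].
  by split; [| | | |split]; rewrite !mxE /= ?mulr0 ?mulr1 // mulrN mulrC.
case: vals => v00 v01 v02 v11 [v12 v22].
move: eqs; case: normS => [[b [c [d [e [f ->]]]]]|[d [e [f ->]]]] eqs.
  have z00 : is0 (gJ (one, b, c) (one, b, c)).
    by rewrite (is0P char5 eps2); apply/eqP; rewrite -v00; apply: eqs o0 o0.
  have q01 := eqs o0 o1; have q02 := eqs o0 o2; have q11 := eqs o1 o1.
  have q12 := eqs o1 o2; have q22 := eqs o2 o2.
  rewrite v01 in q01; rewrite v02 in q02; rewrite v11 in q11; rewrite v12 in q12; rewrite v22 in q22.
  (* Entry (0, 1) is linear in the conjugate of [e]; conjugating once more isolates [e]. Entries (0,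
     2) and (1, 1) give [f] likewise after eliminating [nu], since 2 times -2 is 1. *)
  have ee : e = solve_e b c d.
    apply: (iota_inj char5 eps2); rewrite /solve_e (iota_conj char5 eps2) iota_opp //.
    rewrite -[LHS]iota_conjK; congr (_ ^+ 5).
    move: q01; rewrite (iota_gJ3 one b c b d e) i1 mul1r => /eqP; rewrite addr_eq0 => /eqP ->.
    by rewrite (iota_add char5) (iota_scal5 char5) !(iota_mul char5 eps2) !(iota_conj char5 eps2) e2.
  have ff : f = solve_f b c d e.
    apply: (iota_inj char5 eps2); rewrite /solve_f (iota_conj char5 eps2).
    rewrite -[LHS]iota_conjK; congr (_ ^+ 5).
    rewrite (iota_add char5) (iota_scal5 char5) q11 e2 iota_opp //.
    move: q02; rewrite (iota_gJ3 one b c c e f) i1 mul1r => q02.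
    rewrite (iota_add char5) (iota_scal5 char5) !(iota_mul char5 eps2) !(iota_conj char5 eps2) e2.
    have -> : 2%:R * - (2%:R * nu) = - (2%:R * 2%:R) * nu by ring.
    by rewrite four opprK mul1r -q02; ring.
  apply: (complete1P ee ff z00); rewrite (is0P char5 eps2) ?q11 ?q12 ?q22 //.
  by rewrite oppr_eq0 mulf_neq0 // (n2 char5).
have q02 := eqs o0 o2; have q11 := eqs o1 o1; have q12 := eqs o1 o2; have q22 := eqs o2 o2.
rewrite v02 in q02; rewrite v11 in q11; rewrite v12 in q12; rewrite v22 in q22.
have dd : eqF (mul d (conjF d)) (of5 c4).
  have nu1 : nu = 1.
    rewrite -q02 (iota_gJ3 zero zero one one e f) i1 i0.
    by rewrite !mul0r mulr0 !add0r expr1n mulr1.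
  rewrite (eqFP char5 eps2) iota_of5 e4; apply/eqP/(mulfI (n2 char5)).
  move: q11; rewrite (iota_gJ3 zero d e zero d e) (iota_mul char5 eps2) (iota_conj char5 eps2) i0 nu1.
  by rewrite expr0n /= mul0r mulr0 add0r addr0 mulr1 => ->; rewrite mulrN mulr1.
by apply: (complete0P dd); rewrite (is0P char5 eps2) ?q12 ?q22.
Qed.

Lemma known_normal S : (sm S)^T *m Jinv k *m FM (sm S) = J ->
  iota (pivot S) != 0 /\ is_known (normal S).
Proof.
move=> eS.
have eqs (i j : 'I_3) : iota (gJ (srow S i) (srow S j)) = J i j by rewrite iota_gJ eS.
(* When a = 0, isotropy of the first row reduces to 2 b b^5 = 0. *)
have b0 a b c : iota a = 0 -> iota (gJ (a, b, c) (a, b, c)) = 0 -> iota b = 0.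
  move=> a0; rewrite iota_gJ3 a0 mul0r add0r expr0n /= mulr0 addr0 => /eqP.
  rewrite mulf_eq0 (negbTE (n2 char5)) mulf_eq0 expf_eq0 /= orbb; by move/eqP.
have J00 : J o0 o0 = 0 by rewrite !mxE.
have pivot_nz : iota (pivot S) != 0.
  case: S eS eqs => a b c d e f _ eqs; rewrite /pivot (is0P char5 eps2).
  case: ifP => [/eqP a0|->] //; apply/eqP => c0.
  have bz : iota b = 0 by apply: (b0 a b c a0); rewrite -J00; apply: eqs o0 o0.
  have := eqs o0 o2; rewrite (iota_gJ3 a b c c e f) a0 bz c0 !mul0r mulr0 !addr0 => /esym/eqP.
  by rewrite !mxE /= oner_eq0.
split=> //; set t := iota (pivot S) in pivot_nz.
have t'0 : iota (inv (pivot S)) != 0 by rewrite (iota_inv char5 eps2) invr_eq0.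
(* Scaling [S] by t multiplies its Hermitian Gram matrix by t t^5. *)
apply: (@known_of_gJ _ (iota (inv (pivot S)) ^+ 6)).
- by rewrite expf_neq0.
- move=> i j; rewrite iota_gJ /normal sm_scals map_mxZ [(_ *: sm S)^T]linearZ /=.
  by rewrite -scalemxAr -!scalemxAl scalerA pFrobenius_autE -exprSr eS mxE.
have inj := iota_inj char5 eps2.
case: S @t pivot_nz t'0 {eS} eqs => a b c d e f; rewrite /normal /pivot (is0P char5 eps2).
case: ifP => [/eqP a0|/negbT a0] t0 t'0 eqs.
  right; have bz : iota b = 0 by apply: (b0 a b c a0); rewrite -J00; apply: eqs o0 o0.
  exists (mul (inv c) d), (mul (inv c) e), (mul (inv c) f); rewrite /scals; congr Sym; apply: inj.
  - by rewrite (iota_mul char5 eps2) a0 mulr0 iota_zero.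
  - by rewrite (iota_mul char5 eps2) bz mulr0 iota_zero.
  - by rewrite (iota_mul char5 eps2) (iota_inv char5 eps2) mulVf // iota_one.
left; exists (mul (inv a) b), (mul (inv a) c), (mul (inv a) d), (mul (inv a) e), (mul (inv a) f).
rewrite /scals; congr Sym; apply: inj.
by rewrite (iota_mul char5 eps2) (iota_inv char5 eps2) mulVf // iota_one.
Qed.

Lemma conic_mx_known (X : 'M[k]_3) : X *m J *m (FM X)^T = J ->
  exists2 ij, ij \in pairs & exists2 t, t != 0 &
  conic_mx X = t *: sm (sym_of (rep ij.1 ij.2)).
Proof.
move=> e; have [A eA] := rational_mx e.
have eS : conic_mx X = sm (sym_of A) by rewrite eA (conic_mx_im eps2 (_ : im A *m J *m (FM (im A))^T = J)) -?eA.
have [p0 /is_knownP [ij hij en]] : iota (pivot (sym_of A)) != 0 /\ is_known (normal (sym_of A)).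
  by apply: known_normal; rewrite -eS; apply: conic_mx_unitary.
exists ij => //; set t := iota (inv (pivot (sym_of A))).
have t0 : t != 0 by rewrite /t (iota_inv char5 eps2) invr_eq0.
set t' := iota (inv (pivot (sym_of (rep ij.1 ij.2)))).
exists (t^-1 * t').
  rewrite mulf_neq0 ?invr_eq0 //; apply: contraTneq (Jmx_unit (n2 char5)) => t'0.
  have : t *: conic_mx X = 0.
    by rewrite eS -sm_scals -/(normal _) en sm_scals -/t' t'0 scale0r.
  move/eqP; rewrite scaler_eq0 (negbTE t0) /= => /eqP X0.
  have := conic_mx_unitary e; rewrite X0 trmx0 !mul0mx => <-.
  by rewrite unitmxE det0 unitr0.
by rewrite -scalerA -sm_scals -/(normal _) -en sm_scals scalerA mulVf // scale1r.
Qed.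

End Completeness.

(** * The 3150 conics of the model as conics of Gamma *)

Section ModelConics.
Variable k : closedFieldType.
Hypothesis char5 : 5%N \in [pchar k].
Local Notation F := (pFrobenius_aut char5).
Local Notation FM := (map_mx F).
Local Notation J := (Jmx k).
Local Notation n2 := (n2 char5).
Variable eps : k.
Hypothesis eps2 : eps ^+ 2 = 2%:R.
Local Notation iota := (iota eps).
Local Notation iv := (iv eps).
Local Notation im := (im eps).
Local Notation sm := (sm eps).
Variables (H : 'M[k]_3) (Hu : H \in unitmx) (g : k) (g0 : g != 0).
Variables (Gamma : plane_curve k 6).
Hypothesis form_Gamma : form Gamma = g *: hermf H.
Local Notation uframe := (unitary_frame_of char5 H).
Variable B : 'M[k]_3.
Hypothesis uB : uframe B.
Local Notation TT := (totally_tangent_conic Gamma).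
Local Notation adj := (adjacent Gamma).

Definition preserves_J (X : 'M[k]_3) := X *m J *m (FM X)^T = J.

Lemma preserves_J_mul X Y : preserves_J X -> preserves_J Y -> preserves_J (X *m Y).
Proof.
rewrite /preserves_J => hX hY; rewrite map_mxM trmx_mul !mulmxA.
by rewrite -(mulmxA X Y) -(mulmxA X) hY.
Qed.

Lemma preserves_J_frame X : preserves_J X -> uframe (X *m B).
Proof.
move=> hX; split; first by rewrite unitmx_mul (unitary_unit hX) (proj1 uB).
by rewrite gram_mul (proj2 uB).
Qed.

(** Isometries are transitive on unitary frames; this transports statements about the first conic to
    all others. *)
Lemma isometry_between E E' : uframe E -> uframe E' -> isometry char5 H (invmx E *m E').
Proof.
move=> [Eu hE] [E'u hE']; split; first by rewrite unitmx_mul unitmx_inv Eu.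
have e : E' *m H *m (FM E')^T = E *m H *m (FM E)^T by rewrite -/(gram _ _ _) hE' -hE.
rewrite map_mxM trmx_mul map_invmx !mulmxA -(mulmxA (invmx E)) -(mulmxA (invmx E)).
rewrite e !mulmxA mulVmx // mul1mx -mulmxA -trmx_mul mulVmx ?map_unitmx //.
by rewrite trmx1 mulmx1.
Qed.

Lemma all_nth_unitary s i : all unitary s -> unitary (nth idm s i).
Proof.
move=> us; case: (ltnP i (size s)) => hi; first exact: (allP us) (mem_nth _ hi).
by rewrite nth_default.
Qed.

Definition borelmx i := im (nth idm borel i).
Definition repmx i j := im (rep i j).

Lemma borelmx_J i : preserves_J (borelmx i).
Proof. exact: (im_unitary char5 eps2 (all_nth_unitary i unitary_borel)). Qed.

Lemma repmxE i j : repmx i j = im (nth idm frob21 j) *m borelmx i.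
Proof. exact: (im_mulmm char5 eps2). Qed.

Lemma repmx_J i j : preserves_J (repmx i j).
Proof.
rewrite repmxE; apply: preserves_J_mul (borelmx_J i).
exact: (im_unitary char5 eps2 (all_nth_unitary j unitary_frob21)).
Qed.

Lemma repmx00 : repmx 0 0 = 1%:M.
Proof. by rewrite /repmx rep00 im_id. Qed.

Lemma borelmx0 : borelmx 0 = 1%:M.
Proof. exact: im_id. Qed.

Definition Qc i j := conicE (repmx i j *m B).

Lemma repmx_frame i j : uframe (repmx i j *m B).
Proof. exact/preserves_J_frame/repmx_J. Qed.

Lemma Qc_tangent i j : TT (Qc i j).
Proof.
apply/(totally_tangentP char5 Hu g0 form_Gamma); exists (repmx i j *m B) => //; exact: repmx_frame.
Qed.

Lemma eqsymP S S' : eqsym S S' -> S = S'.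
Proof.
case: S S' => a b c d e f [a' b' c' d' e' f'] /and5P[h1 h2 h3 h4 /andP[h5 h6]].
have eqF_eq x y : eqF x y -> x = y.
  by rewrite (eqFP char5 eps2) => /eqP /(iota_inj char5 eps2).
by rewrite (eqF_eq _ _ h1) (eqF_eq _ _ h2) (eqF_eq _ _ h3) (eqF_eq _ _ h4) (eqF_eq _ _ h5) (eqF_eq _ _ h6).
Qed.

Lemma sm_inj : injective sm.
Proof.
have inj := iota_inj char5 eps2.
move=> [a b c d e f] [a' b' c' d' e' f'] /matrixP h.
have := h o0 o0; have := h o0 o1; have := h o0 o2; have := h o1 o1; have := h o1 o2.
have := h o2 o2; rewrite !mxE /= => /inj -> /inj -> /inj -> /inj -> /inj -> /inj -> //.
Qed.

Lemma pivot_neq0 X A : X = im A -> preserves_J X -> iota (pivot (sym_of A)) != 0.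
Proof.
move=> -> hA; have e := conic_mx_im eps2 hA.
have eS : (sm (sym_of A))^T *m Jinv k *m FM (sm (sym_of A)) = J.
  by rewrite -e; apply: conic_mx_unitary.
by have [] := known_normal eps2 eS.
Qed.

Lemma conicE_imP A A' : preserves_J (im A) -> preserves_J (im A') ->
  conicE (im A *m B) = conicE (im A' *m B) <-> normal (sym_of A) = normal (sym_of A').
Proof.
move=> hA hA'; have [Bu _] := uB; have [Au A'u] := (unitary_unit hA, unitary_unit hA').
have -> : conicE (im A *m B) = conicE (im A' *m B) <-> conicE (im A) = conicE (im A').
  split=> e; last exact: (conicE_mulr char5).
  rewrite -[im A](mulmxK Bu) -[im A'](mulmxK Bu).
  by apply: (conicE_mulr char5); rewrite ?unitmx_mul ?Au ?A'u ?unitmx_inv.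
rewrite (conicE_eq char5 Au A'u) !(conic_mx_im eps2) //.
have p0 := pivot_neq0 erefl hA; have p0' := pivot_neq0 erefl hA'.
split=> [[c c0 e]|]; last first.
  move=> e; exists (iota (pivot (sym_of A)) * iota (inv (pivot (sym_of A')))).
    by rewrite mulf_neq0 // (iota_inv char5 eps2) invr_eq0.
  rewrite -scalerA -(sm_scals char5 eps2) -/(normal _) -e (sm_scals char5 eps2) scalerA.
  by rewrite (iota_inv char5 eps2) mulfV // scale1r.
apply: sm_inj; rewrite !(sm_scals char5 eps2) e scalerA !(iota_inv char5 eps2).
suff -> : iota (pivot (sym_of A)) = c * iota (pivot (sym_of A')).
  by rewrite invfM -mulrA [_ * c]mulrC mulrA mulVf // mul1r.
move: e p0 p0'; case: (sym_of A) => a1 a2 a3 a4 a5 a6; case: (sym_of A') => b1 b2 b3 b4 b5 b6.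
move/matrixP=> e _ _; have := e o0 o0; have := e o0 o2; rewrite !mxE /= => e3 e1.
rewrite !(is0P char5 eps2) e1 mulf_eq0 (negbTE c0) /=.
by case: ifP.
Qed.

Lemma same_conicP A A' : preserves_J (im A) -> preserves_J (im A') -> same_conic A A' ->
  conicE (im A *m B) = conicE (im A' *m B).
Proof. by move=> hA hA' /eqsymP e; apply/conicE_imP. Qed.

Lemma mem_pairs i j : (i < 150)%N -> (j < 21)%N -> (i, j) \in pairs.
Proof. by move=> hi hj; apply/allpairsP; exists (i, j); rewrite !mem_iota. Qed.

Lemma Qc_inj i j i' j' : (i < 150)%N -> (j < 21)%N -> (i' < 150)%N -> (j' < 21)%N ->
  Qc i j = Qc i' j' -> i = i' /\ j = j'.
Proof.
move=> hi hj hi' hj' /(conicE_imP (repmx_J i j) (repmx_J i' j')) e.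
by have [-> ->] := normal_inj (mem_pairs hi hj) (mem_pairs hi' hj') e.
Qed.

Lemma tangentP Q : TT Q <-> exists i j, [/\ (i < 150)%N, (j < 21)%N & Q = Qc i j].
Proof.
split=> [/(totally_tangentP char5 Hu g0 form_Gamma) [E uE ->]|[i [j [_ _ ->]]]]; last exact: Qc_tangent.
have [Eu hE] := uE; have [Bu hB] := uB.
have eX : (E *m invmx B) *m J *m (FM (E *m invmx B))^T = J.
  have [iu ei] := isometry_between uB uE; rewrite -[RHS]hE -[in RHS](mulmxKV Bu E) gram_mul hB //.
have [[i j] hij [t t0 e]] := conic_mx_known eps2 eX.
exists i, j; have [hi hj] : (i < 150)%N /\ (j < 21)%N.
  by move: hij => /allpairsP [[i' j'] [hi hj [-> ->]]]; rewrite mem_iota in hi; rewrite mem_iota in hj.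
split=> //.
rewrite -(mulmxKV Bu E) /Qc; apply: (conicE_mulr char5) => //.
- by rewrite unitmx_mul Eu unitmx_inv.
- exact: (unitary_unit (repmx_J i j)).
apply/(conicE_eq char5); rewrite ?unitmx_mul ?Eu ?unitmx_inv //; first exact: (unitary_unit (repmx_J i j)).
by exists t => //; rewrite e (conic_mx_im eps2 (repmx_J i j)).
Qed.

End ModelConics.

(** * The first conic and its neighbours *)

Section Lines.
Variable k : closedFieldType.

Definition crossr (u v : 'rV[k]_3) : 'rV[k]_3 :=
  row3 (u 0 o1 * v 0 o2 - u 0 o2 * v 0 o1) (u 0 o2 * v 0 o0 - u 0 o0 * v 0 o2)
       (u 0 o0 * v 0 o1 - u 0 o1 * v 0 o0).

Lemma dot3 (u v : 'rV[k]_3) :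
  (u *m v^T) 0 0 = u 0 o0 * v 0 o0 + u 0 o1 * v 0 o1 + u 0 o2 * v 0 o2.
Proof. by rewrite mxE sum3 !mxE. Qed.

(** The entries of the vector product of l with u x v are combinations of the scalar products of l
    with u and v, hence vanish, so l and u x v are proportional. *)
Lemma cross_orthogonal (u v l : 'rV[k]_3) : (u *m l^T) 0 0 = 0 -> (v *m l^T) 0 0 = 0 ->
  crossr u v != 0 -> exists c, l = c *: crossr u v.
Proof.
rewrite !dot3 => eu ev w0.
have /rV0Pn [i wi] := w0.
exists (l 0 i / crossr u v 0 i); apply/rowP => j; rewrite mxE mulrAC.
suff e : l 0 j * crossr u v 0 i = l 0 i * crossr u v 0 j by rewrite -e mulfK.
move: i j {wi w0} eu ev; rewrite /crossr; apply: I3_ind; apply: I3_ind; rewrite !mxE /=;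
set u0 := u 0 o0; set u1 := u 0 o1; set u2 := u 0 o2; set v0 := v 0 o0; set v1 := v 0 o1;
set v2 := v 0 o2; set l0 := l 0 o0; set l1 := l 0 o1; set l2 := l 0 o2 => eu ev //.
- have : l1 * (u1 * v2 - u2 * v1) - l0 * (u2 * v0 - u0 * v2) =
    v2 * (u0 * l0 + u1 * l1 + u2 * l2) - u2 * (v0 * l0 + v1 * l1 + v2 * l2) by ring.
  by rewrite eu ev !mulr0 subr0 => /eqP; rewrite subr_eq0 => /eqP.
- have : l2 * (u1 * v2 - u2 * v1) - l0 * (u0 * v1 - u1 * v0) =
    u1 * (v0 * l0 + v1 * l1 + v2 * l2) - v1 * (u0 * l0 + u1 * l1 + u2 * l2) by ring.
  by rewrite eu ev !mulr0 subr0 => /eqP; rewrite subr_eq0 => /eqP.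
- have : l0 * (u2 * v0 - u0 * v2) - l1 * (u1 * v2 - u2 * v1) =
    u2 * (v0 * l0 + v1 * l1 + v2 * l2) - v2 * (u0 * l0 + u1 * l1 + u2 * l2) by ring.
  by rewrite eu ev !mulr0 subr0 => /eqP; rewrite subr_eq0 => /eqP.
- have : l2 * (u2 * v0 - u0 * v2) - l1 * (u0 * v1 - u1 * v0) =
    v0 * (u0 * l0 + u1 * l1 + u2 * l2) - u0 * (v0 * l0 + v1 * l1 + v2 * l2) by ring.
  by rewrite eu ev !mulr0 subr0 => /eqP; rewrite subr_eq0 => /eqP.
- have : l0 * (u0 * v1 - u1 * v0) - l2 * (u1 * v2 - u2 * v1) =
    v1 * (u0 * l0 + u1 * l1 + u2 * l2) - u1 * (v0 * l0 + v1 * l1 + v2 * l2) by ring.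
  by rewrite eu ev !mulr0 subr0 => /eqP; rewrite subr_eq0 => /eqP.
- have : l1 * (u0 * v1 - u1 * v0) - l2 * (u2 * v0 - u0 * v2) =
    u0 * (v0 * l0 + v1 * l1 + v2 * l2) - v0 * (u0 * l0 + u1 * l1 + u2 * l2) by ring.
  by rewrite eu ev !mulr0 subr0 => /eqP; rewrite subr_eq0 => /eqP.
Qed.

Variable B : 'M[k]_3.
Hypothesis Bu : B \in unitmx.

Definition line_in_frame (c : 'rV[k]_3) : plane_curve k 1 := curve 1 (linf (c *m (invmx B)^T)).

Lemma on_line_in_frame c v : c != 0 -> v != 0 ->
  on_curve (line_in_frame c) (pt (v *m B)) <-> (v *m c^T) 0 0 = 0.
Proof.
move=> c0 v0; have iu : (invmx B)^T \in unitmx by rewrite unitmx_tr unitmx_inv.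
have [d d0 e] : exists2 d, d != 0 & form (line_in_frame c) = d *: linf (c *m (invmx B)^T).
  by apply: form_curve; [exact: linf_homog | rewrite linf_eq0 row_mul_neq0].
rewrite (on_curve_pt _ (row_mul_neq0 Bu v0)) e /ev mevalZ -/(ev _ _) ev_linf.
rewrite trmx_mul trmxK mulmxA mulmxK //; split=> [/eqP|->]; last by rewrite mulr0.
by rewrite mulf_eq0 (negbTE d0) => /eqP.
Qed.

Lemma line_in_frameZ d c : d != 0 -> line_in_frame (d *: c) = line_in_frame c.
Proof. by move=> d0; rewrite /line_in_frame -scalemxAl linfZ curveZ ?linf_homog. Qed.

Lemma line_in_frameP L : exists2 c, c != 0 & L = line_in_frame c.
Proof.
exists (lcoef L *m B^T); first by rewrite row_mul_neq0 ?unitmx_tr ?lcoef_neq0.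
by rewrite /line_in_frame -mulmxA -trmx_mul mulVmx // trmx1 mulmx1 -lcoefE curve_form.
Qed.

End Lines.

(** * Common secants with the first conic *)

Section Chords.
Variable k : closedFieldType.
Hypothesis char5 : 5%N \in [pchar k].
Local Notation J := (Jmx k).
Variable eps : k.
Hypothesis eps2 : eps ^+ 2 = 2%:R.
Local Notation iota := (iota eps).
Local Notation iv := (iv eps).
Local Notation im := (im eps).
Variables (H : 'M[k]_3) (Hu : H \in unitmx) (g : k) (g0 : g != 0).
Variables (Gamma : plane_curve k 6).
Hypothesis form_Gamma : form Gamma = g *: hermf H.
Local Notation uframe := (unitary_frame_of char5 H).
Variable B : 'M[k]_3.
Hypothesis uB : uframe B.

Lemma iv_pts A (i : 'I_6) : iv (nth origin (pts A) i) = hexv k i *m im A.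
Proof.
case: A => -[u v] w.
have affine x : iv (addv (scalv (of5 (mul5 x x)) u) (addv (scalv (of5 x) v) w)) =
    row3 (iota5 k x ^+ 2) (iota5 k x) 1 *m im (u, v, w).
  rewrite !(iv_add char5) !(iv_scal char5 eps2) !iota_of5 (iota5_mul char5).
  by rewrite row3_mat3 scale1r addrA -expr2.
case: i => -[|[|[|[|[|[|//]]]]]] hi.
- by rewrite /= row3_mat3 scale1r !scale0r !addr0.
- exact: affine c0.
- exact: affine c1.
- exact: affine c2.
- exact: affine c3.
- exact: affine c4.
Qed.

Lemma pts_neq0 A i : preserves_J char5 (im A) -> (i < 6)%N -> iv (nth origin (pts A) i) != 0.
Proof.
move=> hA hi; rewrite (iv_pts A (Ordinal hi)) row_mul_neq0 ?hexv_neq0 //.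
exact: (unitary_unit hA).
Qed.

Lemma hexpt_im A (i : 'I_6) : hexpt (im A *m B) i = pt (iv (nth origin (pts A) i) *m B).
Proof. by rewrite /hexpt mulmxA iv_pts. Qed.

Lemma preserves_J_id : preserves_J char5 (im idm).
Proof. exact: (im_unitary char5 eps2). Qed.

Lemma iv_cross u v : iv (cross u v) = crossr (iv u) (iv v).
Proof.
case: u v => -[x y] z [[x' y'] z']; apply/rowP; apply: I3_ind; rewrite !mxE /=;
  by rewrite (iota_add char5) (iota_opp char5) !(iota_mul char5 eps2) ?[iota z * _]mulrC.
Qed.

Lemma is0_dot u v : is0 (dot u v) = ((iv v *m (iv u)^T) 0 0 == 0).
Proof.
rewrite (is0P char5 eps2) (iota_dot char5 eps2) -[iv u *m _]trmxK mxE trmx_mul trmxK.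
by [].
Qed.

Lemma chordP ab c : ab \in chords -> (c < 6)%N ->
  is0 (dot (chord ab) (nth origin (pts idm) c)) = (c == ab.1) || (c == ab.2).
Proof.
move=> hab hc; have h := allP chords_ok ab hab.
by apply/eqP; apply: (allP h); rewrite mem_iota.
Qed.

Lemma mem_chords ab : ab \in chords = [&& ab.1 < ab.2 & ab.2 < 6]%N.
Proof.
rewrite mem_filter; apply: andb_id2l => lt_ab.
apply/allpairsP/idP => [[[a b] [_ hb ->]]|hb]; first by rewrite mem_iota in hb.
by exists ab; rewrite !mem_iota -surjective_pairing; split=> //; apply: ltn_trans lt_ab hb.
Qed.

Lemma chord_neq0 ab : ab \in chords -> iv (chord ab) != 0.
Proof.
move=> hab; apply/eqP => e0.
have h c : (c < 6)%N -> (c == ab.1) || (c == ab.2).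
  by move=> hc; rewrite -(chordP hab hc) is0_dot e0 trmx0 mulmx0 mxE.
have := h 0%N erefl; have := h 1%N erefl; have := h 2%N erefl.
by case: ab {hab e0 h} => -[|[|[|a]]] [|[|[|b]]].
Qed.

Definition chord_line ab := line_in_frame B (iv (chord ab)).

Lemma on_chord_line ab p : ab \in chords -> iv p != 0 ->
  on_curve (chord_line ab) (pt (iv p *m B)) <-> is0 (dot (chord ab) p).
Proof.
move=> hab p0; rewrite (on_line_in_frame (proj1 uB) (chord_neq0 hab) p0) is0_dot.
by split=> [->|/eqP].
Qed.

(** A chord contains exactly two of the six contact points, so the line determines the pair. *)
Lemma chord_line_inj : {in chords &, injective chord_line}.
Proof.
move=> ab ab' hab hab' e.
have h c : (c < 6)%N -> ((c == ab.1) || (c == ab.2)) = ((c == ab'.1) || (c == ab'.2)).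
  move=> hc; rewrite -!chordP //; have p0 := pts_neq0 preserves_J_id hc.
  by apply/idP/idP => /on_chord_line hh; apply/on_chord_line => //; [rewrite -e|rewrite e]; apply: hh.
move: hab hab'; rewrite !mem_chords => /andP[h1 h2] /andP[h1' h2'].
have a1 := h _ (ltn_trans h1 h2); have a2 := h _ h2.
have b1 := h _ (ltn_trans h1' h2'); have b2 := h _ h2'.
case: ab ab' {e h} h1 h2 h1' h2' a1 a2 b1 b2 => a b [a' b'] /= h1 h2 h1' h2'.
rewrite !eqxx !orbT /= => /esym a1 /esym a2 b1 b2; congr pair; clear -h1 h1' a1 a2 b1 b2; lia.
Qed.

Lemma secants_of_frame L :
  secants_of Gamma (conicE B) L <-> exists2 ab, ab \in chords & L = chord_line ab.
Proof.
have Bu := proj1 uB; rewrite (secants_ofP g0 form_Gamma _ uB).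
have hB (i : 'I_6) : hexpt B i = pt (iv (nth origin (pts idm) i) *m B).
  by rewrite -hexpt_im im_id mul1mx.
split=> [|[ab hab ->]]; last first.
  have := hab; rewrite mem_chords => /andP[h1 h2].
  exists (Ordinal (ltn_trans h1 h2)), (Ordinal h2); rewrite !hB; split.
  - by move/(congr1 val) => /= e; rewrite e ltnn in h1.
  - apply/(on_chord_line hab); first by apply: pts_neq0 preserves_J_id _ .
    by rewrite chordP //= ?eqxx //; apply: ltn_trans h1 h2.
  - apply/(on_chord_line hab); first by apply: pts_neq0 preserves_J_id _ .
    by rewrite chordP //= eqxx orbT.
have wlog_lt (i j : 'I_6) : (i < j)%N -> on_curve L (hexpt B i) -> on_curve L (hexpt B j) ->
    exists2 ab, ab \in chords & L = chord_line ab.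
  move=> ltij; have [c c0 ->] := line_in_frameP Bu L; rewrite !hB.
  have hab : (val i, val j) \in chords by rewrite mem_chords ltij /=.
  rewrite !(on_line_in_frame Bu c0) ?(pts_neq0 preserves_J_id) // => hi hj.
  have [|d e] := cross_orthogonal hi hj; first by rewrite -iv_cross; apply: chord_neq0 hab.
  exists (val i, val j) => //; rewrite e -iv_cross line_in_frameZ //.
  by apply: contraNneq c0 => d0; rewrite e d0 scale0r.
move=> [i [j [nij Li Lj]]]; case: (ltngtP i j) => h.
- exact: wlog_lt h Li Lj.
- exact: wlog_lt h Lj Li.
- by case: nij; apply: val_inj.
Qed.

Lemma chord_line_secant A ab : preserves_J char5 (im A) -> ab \in chords ->
  secants_of Gamma (conicE (im A *m B)) (chord_line ab) <->
  (1 < count (fun p => is0 (dot (chord ab) p)) (pts A))%N.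
Proof.
move=> hA hab; rewrite (secants_ofP g0 form_Gamma _ (preserves_J_frame uB hA)).
have -> : count (fun p => is0 (dot (chord ab) p)) (pts A) =
    #|[pred i : 'I_6 | is0 (dot (chord ab) (nth origin (pts A) i))]|.
  have sA : size (pts A) = 6%N by case: (A) => -[u v] w.
  by rewrite -sum1_count (big_nth origin) sA big_mkord sum1_card.
have on (i : 'I_6) : on_curve (chord_line ab) (hexpt (im A *m B) i) <->
    is0 (dot (chord ab) (nth origin (pts A) i)).
  by rewrite hexpt_im on_chord_line // (pts_neq0 hA).
split=> [[i [j [nij /on hi /on hj]]]|/card_gt1P [i [j [hi hj nij]]]].
  by apply/card_gt1P; exists i, j; split=> //; apply/eqP.
by exists i, j; split; [apply/eqP | apply/on | apply/on].
Qed.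

Lemma card_common_chords A : preserves_J char5 (im A) ->
  secants_of Gamma (conicE B) `&` secants_of Gamma (conicE (im A *m B)) #= `I_(common_chords A).
Proof.
move=> hA; apply: card_seq chord_line_inj _ => [|L].
  by apply: filter_uniq; apply: allpairs_uniq => [||[a b] [a' b'] _ _ /= ->]; rewrite ?iota_uniq.
split=> [[/secants_of_frame [ab hab ->] /(chord_line_secant hA hab) h]|].
  by exists ab => //; rewrite hab.
move=> [ab /andP[hab h] ->]; split; first by apply/secants_of_frame; exists ab.
exact/chord_line_secant.
Qed.

End Chords.

Lemma quadratic_three_roots (K : fieldType) (a b c x y z : K) : x != y -> x != z -> y != z ->
  a * x ^+ 2 + b * x + c = 0 -> a * y ^+ 2 + b * y + c = 0 -> a * z ^+ 2 + b * z + c = 0 ->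
  [/\ a = 0, b = 0 & c = 0].
Proof.
move=> xy xz yz hx hy hz.
have dq u v : u != v -> a * u ^+ 2 + b * u + c = 0 -> a * v ^+ 2 + b * v + c = 0 ->
    a * (u + v) + b = 0.
  move=> uv hu hv; have : (u - v) * (a * (u + v) + b) = 0.
    by rewrite -[RHS](subrr 0) -{1}hu -hv; ring.
  by move/eqP; rewrite mulf_eq0 subr_eq0 (negbTE uv) => /eqP.
have h1 := dq _ _ xy hx hy; have h2 := dq _ _ xz hx hz.
have a0 : a = 0.
  have : (y - z) * a = 0 by rewrite -[RHS](subrr 0) -{1}h1 -h2; ring.
  by move/eqP; rewrite mulf_eq0 subr_eq0 (negbTE yz) => /eqP.
have b0 : b = 0 by move: h1; rewrite a0 mul0r add0r.
by split=> //; move: hx; rewrite a0 b0 !mul0r !add0r.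
Qed.

(** * Common points with the first conic *)

Section ConicIntersections.
Variable k : closedFieldType.
Hypothesis char5 : 5%N \in [pchar k].
Local Notation J := (Jmx k).
Local Notation n2 := (n2 char5).
Variable eps : k.
Hypothesis eps2 : eps ^+ 2 = 2%:R.
Local Notation iota := (iota eps).
Local Notation im := (im eps).
Local Notation sm := (sm eps).
Variable B : 'M[k]_3.
Hypothesis Bu : B \in unitmx.
Variable A : mat.
Hypothesis hA : preserves_J char5 (im A).
Local Notation S := (sym_of A).
Local Notation common := (on_curve (conicE B) `&` on_curve (conicE (im A *m B))).

Lemma on_conic_im y : y != 0 ->
  on_curve (conicE (im A *m B)) (pt (y *m B)) <-> (y *m sm S *m y^T) 0 0 = 0.
Proof.
move=> y0; have Au := unitary_unit hA.
have ABu : im A *m B \in unitmx by rewrite unitmx_mul Au.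
have y'0 : y *m invmx (im A) != 0 by rewrite row_mul_neq0 ?unitmx_inv.
have e : y *m B = (y *m invmx (im A)) *m (im A *m B) by rewrite mulmxA mulmxKV.
rewrite {1}e (on_conicE n2 ABu y'0) -(conic_mx_im eps2 hA) /conic_mx.
have -> : y *m (invmx (im A) *m J *m (invmx (im A))^T) *m y^T =
    (y *m invmx (im A)) *m J *m (y *m invmx (im A))^T by rewrite trmx_mul !mulmxA.
rewrite Jmx_form; move: (y *m invmx (im A)) => z.
have -> : z 0 o0 * z 0 o2 - 2 * (z 0 o1 * z 0 o1) + z 0 o2 * z 0 o0 =
  2 * (z 0 o0 * z 0 o2 - z 0 o1 ^+ 2) by ring.
split=> [->|/eqP]; first by rewrite subrr mulr0.
by rewrite mulf_eq0 (negbTE n2) subr_eq0 => /eqP.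
Qed.

Definition coefq (i : nat) : k :=
  let: (q4, q3, q2, q1, q0) := quartic S in iota (nth zero [:: q0; q1; q2; q3; q4] i).
Definition evalq (s : k) := coefq 4 * s ^+ 4 + coefq 3 * s ^+ 3 + coefq 2 * s ^+ 2 + coefq 1 * s + coefq 0.

Lemma form3 (x y z : k) (T : sym) : (row3 x y z *m sm T *m (row3 x y z)^T) 0 0 =
  let: Sym a b c d e f := T in
  iota a * x ^+ 2 + iota d * y ^+ 2 + iota f * z ^+ 2 +
  2%:R * (iota b * (x * y) + iota c * (x * z) + iota e * (y * z)).
Proof.
by case: T => a b c d e f; rewrite mxE sum3 row3_mat3 !mxE /=; ring.
Qed.

Lemma coefqE i : coefq i = match S with Sym a b c d e f =>
  nth 0 [:: iota f; 2%:R * iota e; 2%:R * iota c + iota d; 2%:R * iota b; iota a] i end.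
Proof.
rewrite /coefq; have [[e2 _] _] := iota5E char5; case: S => a b c d e f.
case: i => [|[|[|[|[|i]]]]] //=;
  by rewrite ?(iota_add char5) ?(iota_scal5 char5) ?e2 ?nth_nil ?iota_zero.
Qed.

Lemma on_conic_curve_pt s : on_curve (conicE (im A *m B)) (curve_pt B s) <-> evalq s = 0.
Proof.
rewrite /curve_pt on_conic_im; last first.
  by apply/eqP => /rowP/(_ o2)/eqP; rewrite !mxE /= oner_eq0.
rewrite form3 /evalq !coefqE; case: S => a b c d e f /=.
by split=> h; rewrite -[RHS]h; ring.
Qed.

Lemma on_conic_curve_oo : on_curve (conicE (im A *m B)) (curve_oo B) <-> coefq 4 = 0.
Proof.
rewrite /curve_oo on_conic_im; last first.
  by apply/eqP => /rowP/(_ o0)/eqP; rewrite !mxE /= oner_eq0.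
rewrite form3 !coefqE; case: S => a b c d e f /=.
by split=> h; rewrite -[RHS]h; ring.
Qed.

Lemma commonP P : common P <->
  (exists2 s, evalq s = 0 & P = curve_pt B s) \/ (coefq 4 = 0 /\ P = curve_oo B).
Proof.
split=> [[/(conicE_points n2 Bu) [[s ->]|->]]|].
- by move/on_conic_curve_pt => h; left; exists s.
- by move/on_conic_curve_oo => h; right.
- case=> [[s h ->]|[h ->]].
    have onB := proj2 (conicE_points n2 Bu _) (or_introl (ex_intro _ s erefl)).
    split; [exact: onB | exact: (proj2 (on_conic_curve_pt s) h)].
  have onB := proj2 (conicE_points n2 Bu _) (or_intror erefl).
  split; [exact: onB | exact: (proj2 on_conic_curve_oo h)].
Qed.

Lemma factors4P bt g1 g2 s : factors4 (quartic S) bt g1 g2 ->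
  evalq s = coefq 4 * ((s ^+ 2 + iota bt * s + iota g1) * (s ^+ 2 + iota bt * s + iota g2)).
Proof.
rewrite /evalq /coefq; case: (quartic S) => -[[[q4 q3] q2] q1] q0 /and4P[].
have [[e2 _] _] := iota5E char5.
rewrite !(eqFP char5 eps2) !(iota_mul char5 eps2) !(iota_add char5) (iota_scal5 char5) e2.
rewrite ?(iota_mul char5 eps2) ?(iota_add char5) /=.
by move=> /eqP -> /eqP -> /eqP -> /eqP ->; ring.
Qed.

Lemma lead0 : is0 (quartic S).1.1.1.1 = (coefq 4 == 0).
Proof. by rewrite (is0P char5 eps2) /coefq; case: (quartic S) => -[[[q4 q3] q2] q1] q0. Qed.

(** In t = 2 s + bt the quartic becomes, up to a constant, (t^2 - r1^2)(t^2 - r2^2) with r1^2 and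
    r2^2 the discriminants. If these are nonzero and distinct, the four roots are distinct, whether
    or not they lie in F_25. *)
Lemma split4_card : split4 S -> common #= `I_4.
Proof.
rewrite /split4 lead0; set bt := lead_ratio S => /andP[q40 /hasP [g1 _ /andP[d1 /hasP [g2 _]]]].
move=> /and3P[d2 g12 hf].
have disc x : ~~ is0 (sub (mul bt bt) (scal5 c4 x)) -> exists r : k,
    [/\ r != 0, r ^+ 2 = iota bt ^+ 2 + iota x &
     forall s, 2%:R * 2%:R * (s ^+ 2 + iota bt * s + iota x) = (2%:R * s + iota bt) ^+ 2 - r ^+ 2].
  rewrite (is0P char5 eps2) /sub (iota_add char5) (iota_opp char5) (iota_scal5 char5) (iota_mul char5 eps2).
  rewrite (iota5E char5).2 mulN1r opprK -expr2 => h.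
  have [r e] := root_exists (iota bt ^+ 2 + iota x) (isT : (0 < 2)%N); exists r; split=> //.
    by apply: contraNneq h => r0; rewrite -e r0 expr0n.
  move=> s; rewrite e.
  (* The discriminant is bt^2 - 4 x, and -4 x = x modulo 5. *)
  transitivity ((2%:R * s + iota bt) ^+ 2 - (iota bt ^+ 2 + iota x) + 5%:R * iota x); first by ring.
  by rewrite (h5 char5) mul0r addr0.
have [r1 [r10 e1 f1]] := disc _ d1; have [r2 [r20 e2 f2]] := disc _ d2.
have r12 : r1 ^+ 2 != r2 ^+ 2.
  rewrite e1 e2; apply: contra g12 => /eqP/addrI h; by rewrite (eqFP char5 eps2) h.
have n22 : 2%:R * 2%:R != 0 :> k by rewrite mulf_neq0 ?n2.
pose ts := [:: r1; - r1; r2; - r2].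
have root_ts s : (evalq s == 0) = (2%:R * s + iota bt \in ts).
  have -> : (evalq s == 0) = (((2%:R * s + iota bt) ^+ 2 - r1 ^+ 2) *
      ((2%:R * s + iota bt) ^+ 2 - r2 ^+ 2) == 0).
    rewrite (factors4P s hf) -f1 -f2 !mulf_eq0 (negbTE q40) (negbTE n2) /=; by [].
  by rewrite mulf_eq0 !subr_eq0 !eqf_sqr !inE !orbA.
pose c t := curve_pt B ((t - iota bt) / 2%:R).
have c_inj : injective c.
  by move=> t t' /(curve_pt_inj Bu) /(mulIf (_ : 2%:R^-1 != 0 :> k)); rewrite invr_eq0 n2 => /(_ isT)/addIr.
have neg_neq (r : k) : r != 0 -> r != - r.
  by move=> r0; rewrite -addr_eq0 (_ : r + r = 2%:R * r) ?mulf_neq0 ?n2 //; ring.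
have uts : uniq ts.
  have sq (u v : k) : u ^+ 2 != v ^+ 2 -> u != v by apply: contraNneq => ->.
  have [h1 h2] := (neg_neq r1 r10, neg_neq r2 r20).
  have [h3 h4] : r1 != r2 /\ r1 != - r2 by split; apply: sq; rewrite ?sqrrN.
  have [h5 h6] : - r1 != r2 /\ - r1 != - r2 by split; apply: sq; rewrite ?sqrrN.
  by rewrite /ts /= !inE !negb_or h1 h2 h3 h4 h5 h6.
apply: (@card_seq _ _ c ts predT) => // [|P]; first by move=> x y _ _; apply: c_inj.
have half t : 2%:R * ((t - iota bt) / 2%:R) + iota bt = t by rewrite mulrC divfK ?n2 // subrK.
split=> [/commonP [[s /eqP es ->]|[h _]]|[t /andP[ht _] ->]].
- exists (2%:R * s + iota bt); first by rewrite -root_ts es.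
  by rewrite /c addrK mulrAC divff ?n2 // mul1r.
- by rewrite h eqxx in q40.
- apply/commonP; left; exists ((t - iota bt) / 2%:R) => //.
  by apply/eqP; rewrite root_ts half.
Qed.

(** At most one of the four common points is at infinity; the others have distinct parameters. *)
Lemma common_three : common #= `I_4 -> exists x y z, [/\ x != y, x != z, y != z &
  [/\ evalq x = 0, evalq y = 0 & evalq z = 0]].
Proof.
move=> /card_ordP [f [fi hf]].
have fin i : f i <> curve_oo B -> exists2 s, evalq s = 0 & f i = curve_pt B s.
  have /commonP[//|[_ ->]//] : common (f i) by apply/hf; exists i.
have three i j l : f i <> curve_oo B -> f j <> curve_oo B -> f l <> curve_oo B ->
    i != j -> i != l -> j != l -> exists x y z, [/\ x != y, x != z, y != z &
  [/\ evalq x = 0, evalq y = 0 & evalq z = 0]].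
  move=> /fin [x hx ex] /fin [y hy ey] /fin [z hz ez] ij il jl; exists x, y, z.
  have ne a b u v : f a = curve_pt B u -> f b = curve_pt B v -> a != b -> u != v.
    by move=> ea eb; apply: contraNneq => uv; apply/eqP/fi; rewrite ea eb uv.
  by split; [exact: ne ex ey ij|exact: ne ex ez il|exact: ne ey ez jl|].
pose i0 : 'I_4 := inord 0; pose i1 : 'I_4 := inord 1; pose i2 : 'I_4 := inord 2; pose i3 : 'I_4 := inord 3.
have d a b : (a < 4)%N -> (b < 4)%N -> a != b -> inord a != inord b :> 'I_4.
  by move=> ha hb; apply: contra => /eqP/(congr1 val) /=; rewrite !inordK // => ->.
have other i j : f i = curve_oo B -> j != i -> f j <> curve_oo B.
  by move=> ei ji ej; case/eqP: ji; apply: fi; rewrite ei ej.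
have [e0|n0] := pselect (f i0 = curve_oo B).
  by apply: (three i1 i2 i3); rewrite ?d //; apply: other e0 _; rewrite d.
have [e1|n1] := pselect (f i1 = curve_oo B).
  by apply: (three i0 i2 i3); rewrite ?d //; apply: other e1 _; rewrite d.
have [e2'|n2'] := pselect (f i2 = curve_oo B).
  by apply: (three i0 i1 i3); rewrite ?d //; apply: other e2' _; rewrite d.
by apply: (three i0 i1 i2); rewrite ?d.
Qed.

(** Three distinct roots are too many for the nonzero quadratic whose square the quartic is. In the
    other case they annihilate the remaining quadratic, and then a = b = e = f = 0 and d = -2 c: the
    matrix is a multiple of J. *)
Lemma repeated4_card : repeated4 S -> common #= `I_4 -> conicE (im A *m B) = conicE B.
Proof.
rewrite /repeated4 lead0 => hS /common_three [x [y [z [xy xz yz [hx hy hz]]]]].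
move: hS; case: eqP => [q40|/eqP q40 /hasP [gg _ hf]]; last first.
  have root s : evalq s = 0 -> 1 * s ^+ 2 + iota (lead_ratio S) * s + iota gg = 0.
    rewrite (factors4P s hf) => /eqP; rewrite !mulf_eq0 (negbTE q40) orbb mul1r => /eqP; exact.
  have [/eqP] := quadratic_three_roots xy xz yz (root _ hx) (root _ hy) (root _ hz).
  by rewrite oner_eq0.
have -> : is0 (quartic S).1.1.1.2 = (coefq 3 == 0).
  by rewrite (is0P char5 eps2) /coefq; case: (quartic S) => -[[[q4 q3] q2] q1] q0.
move/eqP=> q30.
have red s : evalq s = 0 -> coefq 2 * s ^+ 2 + coefq 1 * s + coefq 0 = 0.
  by rewrite /evalq q40 q30 !mul0r !add0r.
have [q20 q10 q00] := quadratic_three_roots xy xz yz (red _ hx) (red _ hy) (red _ hz).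
have p0 := pivot_neq0 eps2 erefl hA.
have Au := unitary_unit hA.
rewrite -[in RHS](mul1mx B); apply: (conicE_mulr char5 Au (unitmx1 _ _) Bu).
apply/(conicE_eq char5 Au (unitmx1 _ _)); rewrite (conic_mx_im eps2 hA).
have -> : conic_mx 1%:M = J by rewrite /conic_mx invmx1 trmx1 mul1mx mulmx1.
move: p0 q40 q30 q20 q10 q00; rewrite !coefqE; case: S => a b c d e f /= p0.
have half (u : k) : 2%:R * u = 0 -> u = 0 by move=> /eqP; rewrite mulf_eq0 (negbTE n2) => /eqP.
move=> a0 /half b0 /eqP; rewrite addrC addr_eq0 => /eqP d0 /half e0 f0.
move: p0; rewrite (is0P char5 eps2) a0 eqxx => c0.
exists (iota c) => //.
apply/matrixP; apply: I3_ind; apply: I3_ind; rewrite !mxE /= ?a0 ?b0 ?d0 ?e0 ?f0 ?mulr0 ?mulr1 //.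
by rewrite mulrN mulrC.
Qed.

End ConicIntersections.

(** * Components and their types *)

Section ModelComponents.
Variable k : closedFieldType.
Hypothesis char5 : 5%N \in [pchar k].
Local Notation FM := (map_mx (pFrobenius_aut char5)).
Local Notation J := (Jmx k).
Local Notation n2 := (n2 char5).
Variable eps : k.
Hypothesis eps2 : eps ^+ 2 = 2%:R.
Local Notation iota := (iota eps).
Local Notation iv := (iv eps).
Local Notation im := (im eps).
Local Notation sm := (sm eps).
Variables (H : 'M[k]_3) (Hu : H \in unitmx) (g : k) (g0 : g != 0).
Variables (Gamma : plane_curve k 6).
Hypothesis form_Gamma : form Gamma = g *: hermf H.
Local Notation uframe := (unitary_frame_of char5 H).
Variable B : 'M[k]_3.
Hypothesis uB : uframe B.
Local Notation TT := (totally_tangent_conic Gamma).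
Local Notation adj := (adjacent Gamma).
Local Notation meet Q Q' := (on_curve Q `&` on_curve Q' `&` on_curve Gamma).
Local Notation repmx := (repmx eps).
Local Notation borelmx := (borelmx eps).
Local Notation Qc := (Qc eps B).
Local Notation component := (component Gamma).

Lemma Qc00 : Qc 0 0 = conicE B.
Proof. by rewrite /Qc repmx00 mul1mx. Qed.

Lemma adjacent_origin i j : (i < 150)%N -> (j < 21)%N ->
  adj (Qc 0 0) (Qc i j) <-> i = 0%N /\ j \in nbrs.
Proof.
move=> hi hj; rewrite Qc00.
have hN : preserves_J char5 (im (rep i j)) := repmx_J char5 eps2 i j.
have cs := card_common_chords eps2 g0 form_Gamma uB hN.
have := allP adjacency_pairs _ (mem_pairs hi hj); rewrite /adjacency_ok.
case: ifP => [/andP[/eqP i0 jn] /andP[/eqP cc /(split4_card eps2 (proj1 uB) hN) c4]|nin h].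
  split=> // _; split.
  - by rewrite -Qc00; apply: (Qc_tangent eps2 Hu g0 form_Gamma uB).
  - exact: (Qc_tangent eps2 Hu g0 form_Gamma uB).
  - rewrite -Qc00 => /(Qc_inj eps2 uB (isT : (0 < 150)%N) (isT : (0 < 21)%N) hi hj) [_ j0].
    by rewrite -j0 in jn.
  - exact: c4.
  - by have := cs; rewrite cc.
split=> [[_ _ ne c4 c3]|[i0 jn]]; last by rewrite i0 jn in nin.
case/orP: h => h; first by case/eqP: h; apply: card_ord_unique cs c3.
by case: ne; rewrite -(repeated4_card eps2 (proj1 uB) hN h c4).
Qed.

Lemma nbr_move j l : (j < 21)%N -> l \in nbrs -> exists2 j', j' \in moved j &
  conicE (im (mulmm (rep 0 j) (rep 0 l)) *m B) = Qc 0 j'.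
Proof.
move=> hj hl; have := allP moves_iota j; rewrite mem_iota => /(_ hj) /andP[/eqP sz /allP h].
have hi : (index l nbrs < 10)%N by rewrite -[10%N]/(size nbrs) index_mem.
have := h (index l nbrs); rewrite mem_iota => /(_ hi) /andP[_].
rewrite nth_index // => sc; exists (nth 0%N (moved j) (index l nbrs)).
  by rewrite mem_nth ?sz.
apply: (same_conicP eps2 uB _ (repmx_J char5 eps2 _ _) sc).
rewrite (im_mulmm char5 eps2); apply: preserves_J_mul; exact: repmx_J.
Qed.

Lemma move_nbr j j' : (j < 21)%N -> j' \in moved j -> (j' < 21)%N /\ exists2 l, l \in nbrs &
  conicE (im (mulmm (rep 0 j) (rep 0 l)) *m B) = Qc 0 j'.
Proof.
move=> hj hj'; have := allP moves_iota j; rewrite mem_iota => /(_ hj) /andP[/eqP sz /allP h].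
have hi : (index j' (moved j) < 10)%N by rewrite -sz index_mem.
have := h (index j' (moved j)); rewrite mem_iota => /(_ hi).
rewrite nth_index // => /andP[-> sc]; split=> //.
exists (nth 0%N nbrs (index j' (moved j))); first by rewrite mem_nth.
apply: (same_conicP eps2 uB _ (repmx_J char5 eps2 _ _) sc).
rewrite (im_mulmm char5 eps2); apply: preserves_J_mul; exact: repmx_J.
Qed.

Lemma repmx_split i j : repmx i j = repmx 0 j *m borelmx i.
Proof. by rewrite !(repmxE char5 eps2) borelmx0 mulmx1. Qed.

Definition to_conic i j := invmx B *m (repmx i j *m B).

Lemma to_conic_isometry i j : isometry char5 H (to_conic i j).
Proof. exact: (isometry_between uB (repmx_frame eps2 uB i j)). Qed.

Lemma act_to_conic X i j : X \in unitmx ->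
  actq char5 (to_conic i j) (conicE (X *m B)) = conicE (X *m repmx i j *m B).
Proof.
move=> Xu; have [Bu _] := uB; have [Gu _] := to_conic_isometry i j.
have XBu : X *m B \in unitmx by rewrite unitmx_mul Xu.
rewrite (actq_conicE char5 Gu XBu); congr conicE.
by rewrite /to_conic mulmxA mulmxK // mulmxA.
Qed.

Lemma act_Qc i j l : actq char5 (to_conic i j) (Qc 0 l) = 
  conicE (im (mulmm (rep 0 j) (rep 0 l)) *m borelmx i *m B).
Proof.
rewrite act_to_conic; last exact: (unitary_unit (repmx_J char5 eps2 0 l)).
have -> : im (mulmm (rep 0 j) (rep 0 l)) *m borelmx i = repmx 0 l *m repmx i j; last by [].
by rewrite (repmx_split i j) mulmxA; congr (_ *m _); apply: (im_mulmm char5 eps2).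
Qed.

(** The matrix of conic (i, j) is that of (0, j) followed by the Borel element i, so a coincidence
    inside the first component is carried to component i. *)
Lemma act_Qc_moved i j l j' : conicE (im (mulmm (rep 0 j) (rep 0 l)) *m B) = Qc 0 j' ->
  actq char5 (to_conic i j) (Qc 0 l) = Qc i j'.
Proof.
move=> e; have [Bu _] := uB; have [Gu' _] := isometry_between uB (preserves_J_frame uB (borelmx_J char5 eps2 i)).
have Mu : im (mulmm (rep 0 j) (rep 0 l)) \in unitmx.
  rewrite (im_mulmm char5 eps2); apply: (unitary_unit (char5 := char5)).
  by apply: preserves_J_mul; exact: repmx_J.
have MBu : im (mulmm (rep 0 j) (rep 0 l)) *m B \in unitmx by rewrite unitmx_mul Mu.
have NBu := proj1 (repmx_frame eps2 uB 0 j').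
have cancel_B (X Y : 'M[k]_3) : X *m B *m (invmx B *m (Y *m B)) = X *m Y *m B.
  by rewrite !mulmxA mulmxK.
have := conicE_mulr char5 MBu NBu Gu' e; rewrite !cancel_B act_Qc => ->.
by rewrite /Qc (repmx_split i).
Qed.

(** The isometry sending the first conic to (i, j) reduces adjacency to the enumerated case; its
    inverse gives the direction that bounds the neighbours. *)
Lemma adjacent_Qc i j Q : (i < 150)%N -> (j < 21)%N ->
  adj (Qc i j) Q <-> exists2 j', j' \in moved j & Q = Qc i j'.
Proof.
move=> hi hj; have iso := to_conic_isometry i j.
have [hf fadj] := actq_automorphism Hu g0 form_Gamma iso.
have [hf' fadj'] := actq_automorphism Hu g0 form_Gamma (isometry_inv iso).
rewrite invmxK in hf'.
have to00 : actq char5 (to_conic i j) (Qc 0 0) = Qc i j.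
  by have := @act_to_conic 1%:M i j (unitmx1 _ _); rewrite Qc00 !mul1mx.
have TQ a b : TT (Qc a b) := Qc_tangent eps2 Hu g0 form_Gamma uB a b.
split=> [adjQ|[j' hj' ->]]; last first.
  have [lt_j' [l hl e]] := move_nbr hj hj'.
  rewrite -(act_Qc_moved i e) -to00; apply: fadj; apply/adjacent_origin => //.
  exact: (allP (isT : all (fun l => l < 21)%N nbrs) l hl).
have [_ TTQ _ _ _] := adjQ.
have := fadj' _ _ adjQ; rewrite -to00 (proj2 (hf _ (TQ 0%N 0%N))).
have [/(tangentP eps2 Hu g0 form_Gamma uB) [a [b [ha hb eQ]]] eQ'] := hf' _ TTQ.
rewrite eQ => /(adjacent_origin ha hb) [a0 bn].
have [j' hj' e] := nbr_move hj bn; exists j'; first exact: hj'.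
by rewrite -eQ' eQ a0 (act_Qc_moved i e).
Qed.

(** Adjacency never changes the index i, and within one index every conic is reached in at most two
    steps. *)
Lemma component_Qc i j Q : (i < 150)%N -> (j < 21)%N ->
  component (Qc i j) Q <-> exists2 j', (j' < 21)%N & Q = Qc i j'.
Proof.
move=> hi hj; have lt_moved a b : (a < 21)%N -> b \in moved a -> (b < 21)%N.
  by move=> ha hb; have [] := move_nbr ha hb.
have step a b : (a < 21)%N -> b \in moved a -> component (Qc i a) (Qc i b).
  by move=> ha hb; apply: rt_step; apply/adjacent_Qc => //; exists b.
split=> [hQ|[j' hj' ->]].
  suff h x y : clos_refl_trans _ adj x y -> (exists2 a, (a < 21)%N & x = Qc i a) ->
      exists2 b, (b < 21)%N & y = Qc i b by apply: h hQ _; exists j.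
  elim=> [{}x {}y xy [a ha ex]|//|{}x {}y z _ h1 _ h2 /h1/h2 //].
  by move: xy; rewrite ex => /(adjacent_Qc _ hi ha) [b hb ->]; exists b; first exact: lt_moved hb.
have := allP connected_iota j; rewrite mem_iota => /(_ hj) /allP /(_ j').
rewrite mem_iota => /(_ hj') /or3P[/eqP <-|h|/hasP [l hl h]].
- exact: component_self.
- exact: step.
- by apply: rt_trans; [exact: step hj hl | exact: step (lt_moved _ _ hj hl) h].
Qed.

Definition Dc i := component (Qc i 0).

Lemma DcP i Q : (i < 150)%N -> Dc i Q <-> exists2 j, j \in seq.iota 0 21 & Q = Qc i j.
Proof.
move=> hi; rewrite /Dc component_Qc //.
by split=> -[j hj ->]; exists j => //; move: hj; rewrite mem_iota.
Qed.

Lemma components_Dc D : components Gamma D <-> exists2 i, (i < 150)%N & D = Dc i.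
Proof.
split=> [[Q /(tangentP eps2 Hu g0 form_Gamma uB) [i [j [hi hj ->]]] ->]|[i hi ->]].
  exists i; first exact: hi.
  apply: esym; apply: component_eq; apply/(component_Qc _ hi hj); by exists 0%N.
by exists (Qc i 0) => //; apply: (Qc_tangent eps2 Hu g0 form_Gamma uB).
Qed.

Lemma Dc_inj i i' : (i < 150)%N -> (i' < 150)%N -> Dc i = Dc i' -> i = i'.
Proof.
move=> hi hi' e; have : Dc i (Qc i 0) by apply: component_self.
rewrite e => /(component_Qc _ hi' (isT : (0 < 21)%N)) [j hj /(Qc_inj eps2 uB hi (isT : (0 < 21)%N) hi' hj)].
by case.
Qed.

Lemma quad_scal S c p : iota (quad S (scalv c p)) = iota c ^+ 2 * iota (quad S p).
Proof.
rewrite !(iota_quad char5 eps2) (iv_scal char5 eps2) [(_ *: _)^T]linearZ /=.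
by rewrite -scalemxAr -!scalemxAl scalerA mxE expr2.
Qed.

Lemma hermJ_scal c p :
  iota (hermJ (scalv c p) (scalv c p)) = iota c * iota c ^+ 5 * iota (hermJ p p).
Proof.
rewrite !(iota_hermJ char5 eps2) (iv_scal char5 eps2) map_mxZ [(_ *: _)^T]linearZ /=.
by rewrite -scalemxAr -!scalemxAl scalerA mxE pFrobenius_autE [_ ^+ 5 * _]mulrC.
Qed.

Lemma scalv_one p : scalv (inv one) p = p.
Proof.
apply: (iv_inj char5 eps2).
by rewrite (iv_scal char5 eps2) (iota_inv char5 eps2) iota_one invr1 scale1r.
Qed.

(** If the first coordinate vanishes, isotropy leaves -2 y y^5 = 0. So normalized isotropic vectors
    are (0, 0, 1) or start with 1, the two shapes for which labels are tabulated. *)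
Lemma normv_isotropic p : iv p != 0 -> is0 (hermJ p p) ->
  exists c, [/\ iota c != 0, normv p = scalv c p &
    normv p = (zero, zero, one) \/ exists y z, normv p = (one, y, z)].
Proof.
have inj := iota_inj char5 eps2.
have unit_inv x : iota x != 0 -> mul (inv x) x = one.
  by move=> x0; apply: inj; rewrite (iota_mul char5 eps2) (iota_inv char5 eps2) mulVf // iota_one.
have scal0 c x : iota x = 0 -> mul c x = zero.
  by move=> x0; apply: inj; rewrite (iota_mul char5 eps2) x0 mulr0 iota_zero.
have inv_neq0 x : iota x != 0 -> iota (inv x) != 0.
  by rewrite (iota_inv char5 eps2) invr_eq0.
case: p => -[x y] z p0 hp.
have e : normv (x, y, z) = scalv (inv (if is0 x then z else x)) (x, y, z) by [].
rewrite e /scalv (is0P char5 eps2); case: ifP => [/eqP x0|/negbT x0]; last first.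
  exists (inv x); split=> //; first exact: inv_neq0.
  by right; exists (mul (inv x) y), (mul (inv x) z); rewrite unit_inv.
have y0 : iota y = 0.
  move: hp; rewrite (is0P char5 eps2) !(iota_add char5) (iota_scal5 char5).
  rewrite !(iota_mul char5 eps2) !(iota_conj char5 eps2).
  rewrite x0 expr0n mul0r mulr0 add0r addr0 mulf_eq0 (iota5E char5).1.2 oppr_eq0 (negbTE n2) /=.
  by rewrite mulf_eq0 expf_eq0 /= orbb => /eqP.
have z0 : iota z != 0.
  apply: contraNneq p0 => z0; apply/eqP/rowP; apply: I3_ind; by rewrite !mxE /= ?x0 ?y0 ?z0.
exists (inv z); split=> //; first exact: inv_neq0.
by left; rewrite unit_inv // !scal0.
Qed.

Lemma has_labelP p j : iv p != 0 -> is0 (hermJ p p) -> (j < 21)%N ->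
  is0 (quad (sym_of (rep 0 j)) p) = has_label p j.
Proof.
move=> p0 hp hj; have [c [c0 e shape]] := normv_isotropic p0 hp.
have hp' : is0 (hermJ (normv p) (normv p)).
  by move: hp; rewrite e !(is0P char5 eps2) hermJ_scal => /eqP ->; rewrite mulr0.
have [ok idem] : label_ok (normv p) /\ normv (normv p) = normv p.
  case: shape hp' => [->|[y [z ->]]] hp'; first by split; [exact: label_origin | vm_compute].
  split; last exact: scalv_one.
  by move: label_affine => /all25P/(_ y)/all25P/(_ z)/implyP; apply.
have -> : has_label p j = has_label (normv p) j by rewrite /has_label /label idem.
move: ok => /allP/(_ j); rewrite mem_iota => /(_ hj) /eqP <-.
by rewrite e !(is0P char5 eps2) quad_scal mulf_eq0 expf_eq0 /= (negbTE c0).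
Qed.

(** The second conic meets Gamma only in its six contact points, so it suffices to count those
    labelled by the first conic. *)
Lemma meet_Qc i j j' : (j < 21)%N ->
  meet (Qc 0 j) (Qc i j') #= `I_(count (fun p => has_label p j) (pts (rep i j'))).
Proof.
move=> hj; have hN : preserves_J char5 (im (rep i j')) := repmx_J char5 eps2 i j'.
have uN := preserves_J_frame uB hN; have [Bu _] := uB.
have h0 : preserves_J char5 (im (rep 0 j)) := repmx_J char5 eps2 0 j.
have sN : size (pts (rep i j')) = 6%N by case: (rep i j') => -[u v] w.
have -> : count (fun p => has_label p j) (pts (rep i j')) =
    count (fun a : 'I_6 => has_label (nth origin (pts (rep i j')) a) j) (enum 'I_6).
  rewrite -[pts _ in LHS](mkseq_nth origin) sN /mkseq count_map -val_enum_ord count_map.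
  by [].
apply: (@card_seq _ _ (hexpt (im (rep i j') *m B))); first exact: enum_uniq.
  by move=> a b _ _; apply: (hexpt_inj uN).
have on a : on_curve (Qc 0 j) (hexpt (im (rep i j') *m B) a) <->
    has_label (nth origin (pts (rep i j')) a) j.
  have p0 := pts_neq0 eps2 hN (ltn_ord a).
  rewrite (hexpt_im char5 eps2) (on_conic_im eps2 Bu h0 p0) -has_labelP //.
    by rewrite (is0P char5 eps2) (iota_quad char5 eps2); split=> [->|/eqP].
  rewrite (is0P char5 eps2) (iota_hermJ char5 eps2) (iv_pts char5 eps2) map_mxM trmx_mul !mulmxA.
  have -> : hexv k a *m im (rep i j') *m J *m (FM (im (rep i j')))^T *m (FM (hexv k a))^T =
    hexv k a *m (im (rep i j') *m J *m (FM (im (rep i j')))^T) *m (FM (hexv k a))^T by rewrite !mulmxA.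
  rewrite hN Jmx_form !mxE !pFrobenius_autE /hexv.
  case: (val a) => [|s]; rewrite !mxE /= ?expr0n ?expr1n ?mulr0 ?mul0r ?addr0 ?subr0 //.
  (* For s in F_5 the value is s^2 - 2 s^2 + s^2. *)
  by rewrite [(s%:R ^+ 2) ^+ 5]exprAC (natr_F5 char5); apply/eqP; ring.
move=> P; split=> [[[h1 h2] h3]|[a /andP[_ ha] ->]].
  have /(conic_meets g0 form_Gamma uN) [a eP] := conj h2 h3.
  by exists a => //; rewrite mem_enum; apply/on; rewrite -eP.
have /(conic_meets g0 form_Gamma uN) [h2 h3] : exists b, hexpt (im (rep i j') *m B) a = hexpt (im (rep i j') *m B) b.
  by exists a.
by split; [split; [apply/on|]|].
Qed.

End ModelComponents.

Lemma types_lt4 : all (fun t => t < 4)%N types. Proof. by []. Qed.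

Lemma mem_all_types (P : pred component_type) T : all P all_types -> P T.
Proof. by case/and5P; case: T. Qed.

Lemma type_index_inj : injective type_index. Proof. by case; case. Qed.

Lemma type_index_surj n : (n < 4)%N -> exists T, type_index T = n.
Proof. by case: n => [|[|[|[|//]]]] _; [exists beta21|exists gamma21|exists alpha15gamma6|exists alpha3gamma18]. Qed.

Section Types.
Variable k : closedFieldType.
Hypothesis char5 : 5%N \in [pchar k].
Variable eps : k.
Hypothesis eps2 : eps ^+ 2 = 2%:R.
Variables (H : 'M[k]_3) (Hu : H \in unitmx) (g : k) (g0 : g != 0).
Variables (Gamma : plane_curve k 6).
Hypothesis form_Gamma : form Gamma = g *: hermf H.
Variable B : 'M[k]_3.
Hypothesis uB : unitary_frame_of char5 H B.
Local Notation Qc := (Qc eps B).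
Local Notation Dc := (Dc eps Gamma B).
Local Notation meet Q Q' := (on_curve Q `&` on_curve Q' `&` on_curve Gamma).

(** Both directions read the same intersection numbers, once by rows and once by columns, and the
    finite check assigns them the same code. *)
Lemma types_of_Dc i T : (0 < i)%N -> (i < 150)%N ->
  (has_component_type Gamma (Dc 0) (Dc i) T <-> type_index T = nth 0%N types i) /\
  (has_component_type Gamma (Dc i) (Dc 0) T <-> type_index T = nth 0%N types i).
Proof.
move=> i_gt0 hi.
have D0P Q := DcP eps2 Hu g0 form_Gamma uB Q (isT : (0 < 150)%N).
have DiP Q := DcP eps2 Hu g0 form_Gamma uB Q hi.
have inj a : (a < 150)%N -> {in seq.iota 0 21 &, injective (Qc a)}.
  move=> ha j j'; rewrite !mem_iota => hj hj' e.
  by have [] := Qc_inj eps2 uB ha hj ha hj' e.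
pose m j j' := count (fun p => has_label p j) (pts (rep i j')).
have m_lt j j' : j \in seq.iota 0 21 -> j' \in seq.iota 0 21 -> (m j j' < 7)%N.
  by move=> _ _; apply: leq_ltn_trans (count_size _ _) _; case: (rep i j') => -[u v] w.
have meet_m j j' : j \in seq.iota 0 21 -> j' \in seq.iota 0 21 ->
    meet (Qc 0 j) (Qc i j') #= `I_(m j j').
  by rewrite mem_iota => hj _; apply: (meet_Qc eps2 g0 form_Gamma uB).
have e1 : table 21 m = rows i.
  apply/eq_in_map => j; rewrite mem_iota => hj; rewrite -map_comp; apply: eq_map => j' /=.
  by rewrite /meets (nth_map 0%N) ?size_iota // nth_iota.
have e2 : table 21 (fun j' j => m j j') = meet_table i by [].
have := allP types_iota i; rewrite mem_iota i_gt0 => /(_ hi).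
move/(mem_all_types T) => /andP[/eqP h1 /eqP h2]; split.
  apply: iff_trans (has_component_typeE (inj 0%N isT) (inj i hi) D0P DiP m_lt meet_m T) _.
  by rewrite e1 h1; split=> /eqnP.
have meet_m' j' j : j' \in seq.iota 0 21 -> j \in seq.iota 0 21 ->
    meet (Qc i j') (Qc 0 j) #= `I_(m j j').
  by move=> hj' hj; rewrite [on_curve (Qc i j') `&` _]setIC; apply: meet_m.
have m_lt' j' j : j' \in seq.iota 0 21 -> j \in seq.iota 0 21 -> (m j j' < 7)%N.
  by move=> hj' hj; apply: m_lt.
apply: iff_trans (has_component_typeE (inj i hi) (inj 0%N isT) DiP D0P m_lt' meet_m' T) _.
by rewrite e2 h2; split=> /eqnP.
Qed.

Lemma type_exists_unique i : (0 < i)%N -> (i < 150)%N ->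
  exists! T, has_component_type Gamma (Dc 0) (Dc i) T.
Proof.
move=> i0 hi; have [T hT] := type_index_surj (allP types_lt4 _ (mem_nth 0%N (hi : (i < size types)%N))).
exists T; split; first exact: (proj2 (types_of_Dc T i0 hi).1 hT).
by move=> T' /(proj1 (types_of_Dc T' i0 hi).1) e; apply: type_index_inj; rewrite hT e.
Qed.

Lemma type_count T :
  [set D' | [/\ components Gamma D', D' <> Dc 0 & has_component_type Gamma (Dc 0) D' T]]
    #= `I_(component_type_count T).
Proof.
have /eqP <- := mem_all_types T counts_ok.
apply: (@card_seq _ _ Dc); first exact: iota_uniq.
  move=> i j; rewrite !mem_iota => /andP[_ hi] /andP[_ hj].
  exact: (Dc_inj eps2 Hu g0 form_Gamma uB hi hj).
move=> D'; split=> [[/(components_Dc eps2 Hu g0 form_Gamma uB) [i hi ->] ne hT]|].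
  have i0 : (0 < i)%N by rewrite lt0n; apply/eqP => e; apply: ne; rewrite e.
  exists i => //; rewrite mem_iota i0 hi /=; apply/eqnP.
  exact: (proj1 (types_of_Dc T i0 hi).1 hT).
move=> [i /andP[hi /eqnP hT] ->]; move: hi; rewrite mem_iota => /andP[i0 hi]; split.
- by apply/(components_Dc eps2 Hu g0 form_Gamma uB); exists i.
- by move/(Dc_inj eps2 Hu g0 form_Gamma uB hi (isT : (0 < 150)%N)) => e; rewrite e in i0.
- exact: (proj2 (types_of_Dc T i0 hi).1 hT).
Qed.

End Types.

(** Each summand is l^6 = l l^5 for a linear form l, and in characteristic 5 the form l^5 is linear
    in the fifth powers of the variables. *)
Lemma fermat_hermf (k : closedFieldType) (char5 : 5%N \in [pchar k]) (A : 'M[k]_3) :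
  linear_subst A (fermat k 6) = hermf (A^T *m map_mx (pFrobenius_aut char5) A).
Proof.
have char5P : 5%N \in [pchar {mpoly k[3]}] by rewrite pchar_lalg.
rewrite /linear_subst /fermat rmorph_sum /=.
pose l i : {mpoly k[3]} := \sum_(j < 3) A i j *: 'X_j.
have lE i : ('X_i ^+ 6) \mPo [tuple l i | i < 3] = l i * l i ^+ 5.
  by rewrite rmorphXn /= comp_mpolyXU -tnth_nth tnth_mktuple exprS.
have l5 i : l i ^+ 5 = \sum_j A i j ^+ 5 *: 'X_j ^+ 5.
  rewrite -(pFrobenius_autE char5P) raddf_sum; apply: eq_bigr => j _.
  by rewrite /= pFrobenius_autE exprZn.
rewrite (eq_bigr _ (fun i _ => lE i)).
rewrite (eq_bigr (fun i => \sum_a \sum_b (A i a * A i b ^+ 5) *: ('X_a * 'X_b ^+ 5))); last first.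
  move=> i _; rewrite l5 mulr_suml; apply: eq_bigr => a _; rewrite mulr_sumr.
  by apply: eq_bigr => b _; rewrite -scalerAl -scalerAr scalerA.
rewrite exchange_big; apply: eq_bigr => a _; rewrite exchange_big; apply: eq_bigr => b _.
by rewrite -scaler_suml mxE; congr (_ *: _); apply: eq_bigr => i _; rewrite !mxE pFrobenius_autE.
Qed.

Theorem proposition1p7 (k : closedFieldType) (char5 : 5%N \in [pchar k])
    (Gamma : plane_curve k 6) (hGamma : hermitian_curve Gamma) :
  (forall D D' : set (plane_curve k 2),
     components Gamma D -> components Gamma D' -> D <> D' ->
     (exists! T : component_type, has_component_type Gamma D D' T) /\
     (forall T : component_type,
        has_component_type Gamma D D' T <-> has_component_type Gamma D' D T)) /\
  (forall D : set (plane_curve k 2), components Gamma D ->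
     forall T : component_type,
       [set D' | [/\ components Gamma D', D' <> D
                   & has_component_type Gamma D D' T]]
         #= `I_(component_type_count T)).
Proof.
have [A Au [g g0 eG]] := hGamma; set H := A^T *m map_mx (pFrobenius_aut char5) A.
have form_Gamma : form Gamma = g *: hermf H by rewrite eG (fermat_hermf char5).
have Hu : H \in unitmx by rewrite unitmx_mul unitmx_tr Au map_unitmx.
have [eps eps2] := root_exists (2%:R : k) (isT : (0 < 2)%N).
(* The base frame is chosen from a conic of the given component, which thereby gets index 0. *)
have based D : components Gamma D ->
    exists2 B, unitary_frame_of char5 H B & D = Dc eps Gamma B 0.
  move=> [Q /(totally_tangentP char5 Hu g0 form_Gamma) [B uB ->] ->]; exists B => //.
  by rewrite /Dc Qc00.
split=> [D D' /based [B uB ->] hD' ne|D /based [B uB ->] T]; last first.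
  exact: (type_count eps2 Hu g0 form_Gamma uB).
move/(components_Dc eps2 Hu g0 form_Gamma uB): hD' ne => [i hi ->] ne.
have i0 : (0 < i)%N by rewrite lt0n; apply/eqP => e; apply: ne; rewrite e.
split; first exact: (type_exists_unique eps2 Hu g0 form_Gamma uB).
by move=> T; have [-> ->] := types_of_Dc eps2 Hu g0 form_Gamma uB T i0 hi.
Qed.
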